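(* Suppose the convergence assumption on initial conditions (Assumption A in the context) holds for some $\mathcal S_0$-valued random variable $(\overline E,\overline X(0),\overline\nu_0)$ and $h$ is continuous on $[0,M)$. Let $(\overline X,\overline\nu)$ be the unique solution of the fluid equations associated with $(\overline E,\overline X(0),\overline\nu_0)$ and $h$, let $\overline K(t)=\langle\mathbf 1,\overline\nu_t\rangle-\langle\mathbf 1,\overline\nu_0\rangle+\int_0^t\langle h,\overline\nu_s\rangle ds$ and $\overline D(t)=\int_0^t\langle h,\overline\nu_s\rangle ds$. Suppose that $\overline E$ is uniformly strictly increasing. If, in addition, $\overline K$ is uniformly strictly increasing, then $\overline w^{(N)}\Rightarrow\overline w$ as $N\to\infty$. Likewise, if $\overline D$ is uniformly strictly increasing, then $\overline v^{(N)}\Rightarrow\overline v$ as $N\to\infty$. Here $\Rightarrow$ denotes convergence in distribution.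
   Context: Service distribution: $G$ is a cumulative distribution function on $[0,\infty)$ with density $g$ and mean $1$; $M\doteq\sup\{x\ge0:G(x)<1\}\in(0,\infty]$; $h\doteq g/(1-G)$ on $[0,M)$. Notation: $\langle f,\xi\rangle\doteq\int_{[0,M)}f\,d\xi$; $\mathbf 1$ is the constant function $1$; $\mathcal M_{\le1}[0,M)$ is the space of sub-probability measures on $[0,M)$ with the weak topology; $\mathcal D_{\mathcal H}[0,\infty)$ is the space of càdlàg $\mathcal H$-valued functions with the Skorokhod $J_1$ topology. $\mathcal I_{\mathbb R_+}[0,\infty)$: non-decreasing $f\in\mathcal D_{\mathbb R_+}[0,\infty)$ with $f(0)=0$. $\mathcal S_0\doteq\{(f,x,\mu)\in\mathcal I_{\mathbb R_+}[0,\infty)\times\mathbb R_+\times\mathcal M_{\le1}[0,M):1-\langle\mathbf 1,\mu\rangle=[1-x]^+\}$. Inverses: for non-decreasing càdlàg $f$ with $L_f\doteq\sup_s f(s)$, $\mathrm{inv}[f](t)\doteq\inf\{s\ge0:f(s)\ge t\}$ for $t\in[0,L_f]$ ($[0,\infty)$ if $L_f=\infty$) and $\mathrm{inv}[f](t)\doteq\infty$ for $t>L_f$; $f^{-1}(t)\doteq\sup\{s\ge0:f(s)\le t\}$ for $t\in[0,L_f)$ and $f^{-1}(t)\doteq\infty$ for $t\ge L_f$. A càdlàg $f$ is uniformly strictly increasing if it is absolutely continuous and there is $\theta>0$ with $\dot f(t)\ge\theta$ for all $t\in[0,\infty)$. Model. For each $N$ there are $N$ servers operating in a non-idling, first-come-first-served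 manner. $E^{(N)}$ is the cumulative arrival process ($E^{(N)}(t)$, a.s. finite, is the number of arrivals in $[0,t]$, $E^{(N)}(0)=0$); $R_E^{(N)}(s)\doteq\inf\{t>0:E^{(N)}(s+t)>E^{(N)}(s)\}$ is assumed Markovian with respect to its own filtration, and $E^{(N)}(t)$ is the number of jumps of $R_E^{(N)}$ in $[0,t]$. $X^{(N)}(t)$ is the number of customers in system at time $t$. At time $0$ the customers in service have labels $j=-\langle\mathbf 1,\nu^{(N)}_0\rangle+1,\dots,0$, ages (time since entering service) $a^{(N)}_j(0)\in[0,M)$ and service requirements $v_j>a^{(N)}_j(0)$; $\nu_0^{(N)}=\sum_j\delta_{a_j^{(N)}(0)}$, and $N-\langle\mathbf 1,\nu_0^{(N)}\rangle=[N-X^{(N)}(0)]^+$. The $j$th customer to enter service after time $0$ ($j\ge1$) has requirement $v_j$. Conditionally on $E^{(N)}$, $X^{(N)}(0)$ and the initial ages, the $v_j$ are independent, with $v_j\sim G$ for $j\ge1$ and $\mathbb P(v_j>a_j^{(N)}(0)+u)=\frac{1-G(a_j^{(N)}(0)+u)}{1-G(a_j^{(N)}(0))}$, $u\ge0$, for customers in service at time $0$. Let $K^{(N)}(t)$ be the number of customers entering service in $[0,t]$ and $\sigma_j^{(N)}\doteq\inf\{t:K^{(N)}(t)\ge j\}$. Then $a_j^{(N)}(t)=(a_j^{(N)}(0)+t)\wedge v_j$ for $j\le0$, $a_j^{(N)}(t)=(t-\sigma^{(N)}_j)^+\wedge v_j$ for $j\ge1$; the age measure is $\nu^{(N)}_t=\sum_{j=-\langle\mathbf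 1,\nu_0^{(N)}\rangle+1}^{K^{(N)}(t)}\delta_{a_j^{(N)}(t)}\mathbf 1_{\{a_j^{(N)}(t)<v_j\}}$; the cumulative departures $D^{(N)}(t)$ count the $j\le K^{(N)}(t)$ with $a_j^{(N)}(t)=v_j$; $X^{(N)}=X^{(N)}(0)+E^{(N)}-D^{(N)}$; $K^{(N)}=\langle\mathbf 1,\nu^{(N)}\rangle-\langle\mathbf 1,\nu_0^{(N)}\rangle+D^{(N)}$; and non-idling means $N-\langle\mathbf 1,\nu^{(N)}_t\rangle=[N-X^{(N)}(t)]^+$ for all $t$. A bar denotes division by $N$: $\overline E^{(N)},\overline X^{(N)},\overline\nu^{(N)},\overline K^{(N)},\overline D^{(N)}$. Waiting and sojourn times are given by $w^{(N)}(j)\doteq\mathrm{inv}[K^{(N)}](j)-\mathrm{inv}[E^{(N)}](j)$ and $v^{(N)}(j)\doteq\mathrm{inv}[D^{(N)}](j)-\mathrm{inv}[E^{(N)}](j)$, and $\overline w^{(N)}(t)\doteq w^{(N)}(E^{(N)}(t))=\mathrm{inv}[\overline K^{(N)}](\overline E^{(N)}(t))-\mathrm{inv}[\overline E^{(N)}](\overline E^{(N)}(t))$, $\overline v^{(N)}(t)\doteq v^{(N)}(E^{(N)}(t))=\mathrm{inv}[\overline D^{(N)}](\overline E^{(N)}(t))-\mathrm{inv}[\overline E^{(N)}](\overline E^{(N)}(t))$. Their candidate limits are $\overline w(t)\doteq\overline K^{-1}(\overline E(t))-t$ and $\overline v(t)\doteq\overline D^{-1}(\overline E(t))-t$, $t\ge0$.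 Assumption A: there is an $\mathcal S_0$-valued random variable $(\overline E,\overline X(0),\overline\nu_0)$ such that, almost surely as $N\to\infty$: (1) $\overline E^{(N)}\to\overline E$ in $\mathcal D_{\mathbb R_+}[0,\infty)$, where $\mathbb E[\overline E(t)]<\infty$ for all $t\in(0,\infty)$; (2) $\overline X^{(N)}(0)\to\overline X(0)$, where $\mathbb E[\overline X(0)]<\infty$; (3) $\overline\nu_0^{(N)}\to\overline\nu_0$ in $\mathcal M_{\le1}[0,M)$. Fluid equations: a càdlàg $(\overline X,\overline\nu)$ with values in $\mathbb R_+\times\mathcal M_{\le1}[0,M)$ solves the fluid equations associated with $(\overline E,\overline X(0),\overline\nu_0)\in\mathcal S_0$ and $h$ if for every $t\ge0$, $\int_0^t\langle h,\overline\nu_s\rangle ds<\infty$, and for every $C^1$ compactly supported $\varphi$ on $[0,M)\times\mathbb R_+$, $$\langle\varphi(\cdot,t),\overline\nu_t\rangle=\langle\varphi(\cdot,0),\overline\nu_0\rangle+\int_0^t\langle\varphi_s(\cdot,s)+\varphi_x(\cdot,s),\overline\nu_s\rangle ds-\int_0^t\langle h(\cdot)\varphi(\cdot,s),\overline\nu_s\rangle ds+\int_0^t\varphi(0,s)\,d\overline K(s),$$ $$\overline X(t)=\overline X(0)+\overline E(t)-\int_0^t\langle h,\overline\nu_s\rangle ds,\qquad 1-\langle\mathbf 1,\overline\nu_t\rangle=[1-\overline X(t)]^+,$$ with $\overline K(t)=\langle\mathbf 1,\overline\nu_t\rangle-\langle\mathbf 1,\overline\nu_0\rangle+\int_0^t\langle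 h,\overline\nu_s\rangle ds$. *)

(* Defs.v *)
From HB Require Import structures.
From mathcomp Require Import all_boot all_order all_algebra.
From mathcomp Require Import all_classical all_reals all_analysis.
From mathcomp Require Import measurable_realfun.

Set Implicit Arguments.
Unset Strict Implicit.
Unset Printing Implicit Defensive.
Import Order.TTheory GRing.Theory Num.Theory.
Import numFieldNormedType.Exports.
Local Open Scope classical_set_scope.
Local Open Scope ring_scope.

(** A path on [0, oo[ is a function on [R] whose values at [t < 0] are ignored. *)

Section paths.
Context {R : realType}.
Implicit Types f : R -> R.

Definition cadlag f :=
  forall t, 0 <= t -> f @ t^'+ --> f t /\ (0 < t -> cvg (f @ t^'-)).

Definition nondecreasing_path f := forall s t, 0 <= s -> s <= t -> f s <= f t.

(** Since [ereal_inf set0 = +oo] and [ereal_sup `[0, +oo[ = +oo], the two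
    inverses below take the value [+oo] above the range of [f]. *)
Definition inv f (t : R) : \bar R :=
  ereal_inf [set s%:E | s in [set s | 0 <= s /\ t <= f s]].

Definition right_inv f (t : R) : \bar R :=
  ereal_sup [set s%:E | s in [set s | 0 <= s /\ f s <= t]].

Definition absolutely_continuous_on f (T : R) :=
  forall e, 0 < e -> exists2 d, 0 < d &
    forall (n : nat) (a b : nat -> R),
      (forall i, (i < n)%N -> 0 <= a i /\ a i <= b i /\ b i <= T) ->
      (forall i, (i.+1 < n)%N -> b i <= a i.+1) ->
      \sum_(i < n) (b i - a i) < d -> \sum_(i < n) `|f (b i) - f (a i)| < e.

(** The derivative of an absolutely continuous function exists only almost
    everywhere, and the lower bound is imposed where it exists. *)
Definition uniformly_strictly_increasing f :=
  (forall T, absolutely_continuous_on f T) /\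
  exists2 theta, 0 < theta &
    {ae lebesgue_measure, forall t : R,
      0 <= t -> derivable f t 1 /\ theta <= derive1 f t}.

(** The Lebesgue-Stieltjes integral over ]0, t] with respect to a
    right-continuous function of bounded variation. The value does not depend
    on the decomposition. *)
Definition is_stieltjes_integral f (F : R -> R) (t v : R) :=
  exists F1 F2 : cumulative R R,
    (forall s, 0 <= s -> F s = F1 s - F2 s) /\
    v = \int[lebesgue_stieltjes_measure F1]_(s in `]0, t]) f s
      - \int[lebesgue_stieltjes_measure F2]_(s in `]0, t]) f s.

End paths.

(** An alias of [R -> R] that carries the J1 topology instead of the topology of
    pointwise convergence. *)
Definition skorokhod (R : realType) : Type := R -> R.

Section skorokhod.
Context {R : realType}.

(** Such a [l] restricts to an increasing homeomorphism of [0, oo[. *)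
Definition time_change (l : R -> R) :=
  [/\ l 0 = 0, (forall s t, 0 <= s -> s < t -> l s < l t) &
      forall t, 0 <= t -> exists2 s, 0 <= s & l s = t].

Definition J1_ball (T e : R) (x y : skorokhod R) :=
  exists2 l, time_change l & forall s, 0 <= s <= T ->
    `|l s - s| < e /\ `|y (l s) - x s| < e.

(** On càdlàg functions these filters are the J1 neighbourhoods: the time change
    may depend on the horizon [T] (Ethier and Kurtz, Markov Processes,
    Proposition 3.5.3). *)
Definition J1_nbhs (x : skorokhod R) : set_system (skorokhod R) :=
  [set A | exists T e : R, 0 < e /\ J1_ball T e x `<=` A].

HB.instance Definition _ := gen_eqMixin (skorokhod R).
HB.instance Definition _ := gen_choiceMixin (skorokhod R).
HB.instance Definition _ := hasNbhs.Build (skorokhod R) J1_nbhs.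

Lemma time_change_ge0 l s : time_change l -> 0 <= s -> 0 <= l s.
Proof.
move=> [l0 linc _]; rewrite le_eqVlt => /predU1P[<-|s0]; first by rewrite l0.
by rewrite -l0 ltW// linc.
Qed.

Lemma time_change_id : time_change id.
Proof. by split=> // t t0; exists t. Qed.

Lemma time_change_comp l m :
  time_change l -> time_change m -> time_change (m \o l).
Proof.
move=> tl tm; have [l0 linc lsur] := tl; have [m0 minc msur] := tm.
split=> [|s t s0 st|t t0] /=; first by rewrite l0.
- by apply: minc; [exact: time_change_ge0|exact: linc].
- have [s s0 <-] := msur _ t0; have [r r0 <-] := lsur _ s0.
  by exists r.
Qed.

Lemma J1_ball_refl T e (x : skorokhod R) : 0 < e -> J1_ball T e x x.
Proof.
by move=> e0; exists id => [|s _]; [exact: time_change_id|rewrite !subrr normr0].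
Qed.

Lemma J1_ballS T T' e e' (x : skorokhod R) :
  T <= T' -> e' <= e -> J1_ball T' e' x `<=` J1_ball T e x.
Proof.
move=> TT ee y [l tl H]; exists l => // s /andP[s0 sT].
have [|H1 H2] := H s; first by rewrite s0 (le_trans sT).
by split; exact: lt_le_trans ee.
Qed.

Lemma J1_ball_trans T e (x y z : skorokhod R) :
  J1_ball T (e / 2) x y -> J1_ball (T + e / 2) (e / 2) y z -> J1_ball T e x z.
Proof.
move=> [l tl H] [m tm K]; exists (m \o l); first exact: time_change_comp.
move=> s /andP[s0 sT]; have [|H1 H2] := H s; first by rewrite s0.
have [|K1 K2] := K (l s).
  rewrite (time_change_ge0 tl s0)/= -lerBlDl; apply: le_trans (ltW H1).
  apply: le_trans (ler_norm _).
  by rewrite lerD2l lerN2.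
split=> /=.
- rewrite -(subrKA (l s)) [e]splitr.
  by apply: le_lt_trans (ler_normD _ _) _; rewrite ltrD.
- rewrite -(subrKA (y (l s))) [e]splitr.
  by apply: le_lt_trans (ler_normD _ _) _; rewrite ltrD.
Qed.

Let J1_filter (x : skorokhod R) : ProperFilter (nbhs x).
Proof.
split; first by move=> [T [e [e0 /(_ x)]]]; apply; exact: J1_ball_refl.
split=> [|A B [T [e [e0 TA]]] [T' [e' [e0' TB]]]|A B AB [T [e [e0 TA]]]].
- by exists 0, 1; split.
- exists (Num.max T T'), (Num.min e e').
  split; first by rewrite lt_min e0.
  move=> y xy; split.
  + by apply/TA/(J1_ballS _ _ xy); [rewrite le_max lexx|rewrite ge_min lexx].
  + apply/TB/(J1_ballS _ _ xy); first by rewrite le_max lexx orbT.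
    by rewrite ge_min lexx orbT.
- by exists T, e; split=> //; exact: subset_trans AB.
Qed.

Let J1_singleton (x : skorokhod R) (A : set (skorokhod R)) : nbhs x A -> A x.
Proof. by move=> [T [e [e0 TA]]]; apply: TA; exact: J1_ball_refl. Qed.

Let J1_open (x : skorokhod R) (A : set (skorokhod R)) :
  nbhs x A -> nbhs x (nbhs^~ A).
Proof.
move=> [T [e [e0 TA]]]; exists T, (e / 2); rewrite divr_gt0//; split=> // y xy.
exists (T + e / 2), (e / 2); rewrite divr_gt0//; split=> // z yz.
by apply: TA; exact: J1_ball_trans xy yz.
Qed.

HB.instance Definition _ :=
  Nbhs_isNbhsTopological.Build (skorokhod R) J1_filter J1_singleton J1_open.

Definition Dspace : set (skorokhod R) := [set x | cadlag x].

End skorokhod.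

Section probability.
Context {d : measure_display} {T : measurableType d} {R : realType}.
Variable P : probability T R.

Definition Drandom_element (Z : T -> skorokhod R) :=
  (forall w, Dspace (Z w)) /\
  (forall U : set (skorokhod R), open U -> measurable (Z @^-1` U)).

(** The processes need only have almost surely finite and càdlàg paths, so that
    the definition refers to versions of them that are random elements of
    [Dspace]. *)
Definition cvg_in_distribution (W_ : nat -> T -> R -> \bar R)
    (W : T -> R -> \bar R) :=
  exists (Z_ : nat -> T -> skorokhod R) (Z : T -> skorokhod R),
  [/\ forall n, Drandom_element (Z_ n), Drandom_element Z,
      forall n, {ae P, forall w, forall t, 0 <= t -> W_ n w t = (Z_ n w t)%:E},
      {ae P, forall w, forall t, 0 <= t -> W w t = (Z w t)%:E} &
      forall F : skorokhod R -> R, {within Dspace, continuous F} ->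
        (exists C, forall x, Dspace x -> `|F x| <= C) ->
        ('E_P[F \o Z_ n] @[n --> \oo] --> 'E_P[F \o Z])%E].

Definition measurable_wrt (S : set (set T)) d' (T' : measurableType d')
    (f : T -> T') :=
  forall B, measurable B -> S (f @^-1` B).

(** [f] is a version of the conditional probability of [B] given the
    sigma-algebra [S]. *)
Definition is_cond_prob (S : set (set T)) (B : set T) (f : T -> R) :=
  measurable_wrt S f /\
  forall A, S A -> P (A `&` B) = (\int[P]_(w in A) (f w)%:E)%E.

Definition natural_filtration (Y : T -> R -> \bar R) (s : R) : set (set T) :=
  <<s [set A | exists u (B : set (\bar R)),
    [/\ 0 <= u <= s, measurable B & A = [set w | B (Y w u)]] ] >>.

Definition markovian (Y : T -> R -> \bar R) :=
  (forall t, 0 <= t -> measurable_fun setT (Y ^~ t)) /\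
  forall s t (B : set (\bar R)), 0 <= s -> s <= t -> measurable B ->
    exists2 f : T -> R,
      measurable_wrt [set A | exists2 C : set (\bar R), measurable C &
        A = [set w | C (Y w s)]] f &
      is_cond_prob (natural_filtration Y s) [set w | B (Y w t)] f.

(** The event [C] belongs to [S]; the [v j] with [j \in J] need only be
    meaningful on [C]. *)
Definition cond_independent_on (S : set (set T)) (C : set T) (J : seq int)
    (v : int -> T -> R) :=
  forall B : int -> set R, (forall j, measurable (B j)) ->
    exists f : int -> T -> R,
      (forall j, j \in J -> is_cond_prob S (C `&` v j @^-1` B j) (f j)) /\
      is_cond_prob S (C `&` [set w | forall j, j \in J -> B j (v j w)])
        (fun w => \1_C w * \prod_(j <- J) f j w).

End probability.

Section service.
Context {R : realType}.
Implicit Types (g G : R -> R).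

Record service_distribution g G : Prop := {
  density_measurable : measurable_fun setT g ;
  density_ge0 : forall x, 0 <= g x ;
  density_total : (\int[lebesgue_measure]_(x in `[0%R, +oo[) (g x)%:E = 1)%E ;
  cdfE : forall x,
    ((G x)%:E = \int[lebesgue_measure]_(y in `[0%R, x]) (g y)%:E)%E ;
  mean1 : (\int[lebesgue_measure]_(x in `[0%R, +oo[) (x * g x)%:E = 1)%E }.

Definition right_end G : \bar R :=
  ereal_sup [set x%:E | x in [set x | 0 <= x /\ G x < 1]].

Definition ages G : set R := [set x | 0 <= x /\ (x%:E < right_end G)%E].

Definition hazard g G (x : R) : R := g x / (1 - G x).

End service.

(** A measure on [ages G] is represented by a measure on [R] that vanishes
    outside [ages G]. *)

Section measures.
Context {R : realType}.
Variable G : R -> R.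
Implicit Types (xi : {measure set R -> \bar R}).

Definition pairing (f : R -> R) xi : R := \int[xi]_(x in ages G) f x.

Definition mass xi : R := pairing (cst 1) xi.

Definition sub_probability xi := xi (~` ages G) = 0%E /\ (xi (ages G) <= 1)%E.

Definition weak_cvg {I : Type} (F : set_system I)
    (xi_ : I -> {measure set R -> \bar R}) xi :=
  forall f : R -> R, {within ages G, continuous f} ->
    (exists C, forall x, ages G x -> `|f x| <= C) ->
    pairing f (xi_ i) @[i --> F] --> pairing f xi.

Definition measure_cadlag (nu : R -> {measure set R -> \bar R}) :=
  forall t, 0 <= t -> [/\ sub_probability (nu t), weak_cvg t^'+ nu (nu t) &
    0 < t -> exists2 xi, sub_probability xi & weak_cvg t^'- nu xi].

End measures.

(** A sample path of the queue. The age and the requirement of the customer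
    with label [j] are meaningful only for [- in_service0 < j]. *)
Record queue (R : realType) := Queue {
  arrivals : R -> nat ;
  in_system0 : nat ;
  in_service0 : nat ;
  age0 : int -> R ;
  requirement : int -> R ;
  entries : R -> nat }.

Section queue.
Context {R : realType}.
Variable G : R -> R.
Implicit Types (q : queue R) (N : nat).

Definition residual_arrival q (s : R) : \bar R :=
  ereal_inf [set t%:E | t in
    [set t | 0 < t /\ (arrivals q s < arrivals q (s + t)%R)%N]].

(** Used only for labels [j <= entries q t], for which the set is nonempty. *)
Definition entry_time q (j : int) : R :=
  inf [set t | 0 <= t /\ (j <= (entries q t)%:Z)].

Definition age q (j : int) (t : R) : R :=
  if j <= 0 then Num.min (age0 q j + t) (requirement q j)
  else Num.min (Num.max (t - entry_time q j) 0) (requirement q j).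

(** [label q 0 = - in_service0 q + 1]. *)
Definition label q (i : nat) : int := i.+1%:Z - (in_service0 q)%:Z.

Definition initial_age_measure q : {measure set R -> \bar R} :=
  msum (fun i => \d_(age0 q (label q i)) : {measure set R -> \bar R})
       (in_service0 q).

Definition age_measure q (t : R) : {measure set R -> \bar R} :=
  msum (fun i => if age q (label q i) t < requirement q (label q i)
                 then \d_(age q (label q i) t) : {measure set R -> \bar R}
                 else mzero)
       (in_service0 q + entries q t)%N.

Definition departures q (t : R) : nat :=
  (\sum_(i < in_service0 q + entries q t)
    (age q (label q i) t == requirement q (label q i)))%N.

Definition in_system q (t : R) : R :=
  (in_system0 q)%:R + (arrivals q t)%:R - (departures q t)%:R.

Record queue_dynamics N q : Prop := {
  arrivals0 : arrivals q 0 = 0%N ;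
  arrivals_nd : nondecreasing_path (fun t => (arrivals q t)%:R : R) ;
  arrivals_cadlag : cadlag (fun t => (arrivals q t)%:R : R) ;
  arrivals_jumps : forall t, 0 <= t ->
    ([set s | (0 < s <= t)%R /\
        ~ (residual_arrival q @ s^'- --> residual_arrival q s)]
     #= `I_(arrivals q t))%card ;
  initial_ages : forall j : int, - (in_service0 q)%:Z < j -> j <= 0 ->
    ages G (age0 q j) /\ age0 q j < requirement q j ;
  initial_non_idling : (N%:R : R) - mass G (initial_age_measure q) =
    Num.max (N%:R - (in_system0 q)%:R) 0 ;
  entries0 : entries q 0 = 0%N ;
  entries_nd : nondecreasing_path (fun t => (entries q t)%:R : R) ;
  entries_cadlag : cadlag (fun t => (entries q t)%:R : R) ;
  entriesE : forall t, 0 <= t -> (entries q t)%:R =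
    mass G (age_measure q t) - mass G (initial_age_measure q)
    + (departures q t)%:R ;
  non_idling : forall t, 0 <= t ->
    N%:R - mass G (age_measure q t) = Num.max (N%:R - in_system q t) 0 }.

Definition waiting_time q (j : nat) : \bar R :=
  (inv (fun t => (entries q t)%:R) j%:R
   - inv (fun t => (arrivals q t)%:R) j%:R)%E.

Definition sojourn_time q (j : nat) : \bar R :=
  (inv (fun t => (departures q t)%:R) j%:R
   - inv (fun t => (arrivals q t)%:R) j%:R)%E.

End queue.

Section stochastic_queue.
Context {d : measure_display} {T : measurableType d} {R : realType}.
Variables (P : probability T R) (G : R -> R).
Implicit Types Q : T -> queue R.

(** Only the ages of the customers in service at time 0 contribute. *)
Definition initial_sigma Q : set (set T) := <<s [set A |
  [\/ exists t k, 0 <= t /\ A = [set w | arrivals (Q w) t = k],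
      exists k, A = [set w | in_system0 (Q w) = k],
      exists k, A = [set w | in_service0 (Q w) = k] |
      exists (j : int) (B : set R), [/\ j <= 0, measurable B &
        A = [set w | - (in_service0 (Q w))%:Z < j /\ B (age0 (Q w) j)] ] ] ] >>.

Record queue_measurable Q : Prop := {
  arrivals_meas : forall t k, 0 <= t -> measurable [set w | arrivals (Q w) t = k] ;
  in_system0_meas : forall k, measurable [set w | in_system0 (Q w) = k] ;
  in_service0_meas : forall k, measurable [set w | in_service0 (Q w) = k] ;
  age0_meas : forall j, measurable_fun setT (fun w => age0 (Q w) j) ;
  requirement_meas : forall j, measurable_fun setT (fun w => requirement (Q w) j) ;
  entries_meas : forall t k, 0 <= t -> measurable [set w | entries (Q w) t = k] }.

Record requirement_law Q : Prop := {
  requirement_independent : forall (k : nat) (J : seq int), uniq J ->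
    (forall j, j \in J -> - k%:Z < j) ->
    cond_independent_on P (initial_sigma Q) [set w | in_service0 (Q w) = k] J
      (fun j w => requirement (Q w) j) ;
  requirement_new : forall (j : int) (y : R), 0 < j ->
    is_cond_prob P (initial_sigma Q) [set w | requirement (Q w) j <= y]
      (cst (G y)) ;
  requirement_initial : forall (j : int) (u : R), j <= 0 -> 0 <= u ->
    is_cond_prob P (initial_sigma Q)
      [set w | - (in_service0 (Q w))%:Z < j /\
               age0 (Q w) j + u < requirement (Q w) j]
      (fun w => if - (in_service0 (Q w))%:Z < j
                then (1 - G (age0 (Q w) j + u)) / (1 - G (age0 (Q w) j))
                else 0) }.

Record many_server_queue (N : nat) Q : Prop := {
  msq_measurable : queue_measurable Q ;
  msq_markovian : markovian P (fun w => residual_arrival (Q w)) ;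
  msq_law : requirement_law Q ;
  msq_dynamics : {ae P, forall w, queue_dynamics G N (Q w)} }.

Record initial_data (E : R -> R) (x0 : R) (nu0 : {measure set R -> \bar R}) :
    Prop := {
  data_E_cadlag : cadlag E ;
  data_E_nd : nondecreasing_path E ;
  data_E0 : E 0 = 0 ;
  data_x0_ge0 : 0 <= x0 ;
  data_nu0 : sub_probability G nu0 ;
  data_non_idling : 1 - mass G nu0 = Num.max (1 - x0) 0 }.

Record convergence_assumption (Q : nat -> T -> queue R) (E : T -> R -> R)
    (x0 : T -> R) (nu0 : T -> {measure set R -> \bar R}) : Prop := {
  limit_data : {ae P, forall w, initial_data (E w) (x0 w) (nu0 w)} ;
  limit_E_meas : forall t, 0 <= t -> measurable_fun setT (E ^~ t) ;
  limit_x0_meas : measurable_fun setT x0 ;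
  limit_nu0_meas : forall B : set R, measurable B ->
    measurable_fun setT (fun w => nu0 w B) ;
  limit_E_mean : forall t, 0 < t -> ('E_P[E ^~ t] < +oo)%E ;
  limit_x0_mean : ('E_P[x0] < +oo)%E ;
  arrivals_cvg : {ae P, forall w,
    (fun N => (fun t => (arrivals (Q N w) t)%:R / N%:R) : skorokhod R) @ \oo
      --> (E w : skorokhod R)} ;
  in_system0_cvg : {ae P, forall w,
    (in_system0 (Q N w))%:R / N%:R @[N --> \oo] --> x0 w} ;
  initial_age_cvg : {ae P, forall w,
    weak_cvg G \oo
      (fun N => mscale (N%:R^-1)%:nng (initial_age_measure (Q N w)))
      (nu0 w)} }.

End stochastic_queue.

Section fluid.
Context {R : realType}.
Variables (G h : R -> R).
Implicit Types (E X : R -> R) (nu : R -> {measure set R -> \bar R}).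

(** Restrictions to [ages G] x [0, oo[ of C^1 functions on the plane are exactly
    the C^1 functions on this set, with one-sided derivatives on its boundary,
    when the support is compact. *)
Record test_function (phi : R -> R -> R) : Prop := {
  test_derivable1 : forall x s, derivable (phi^~ s) x 1 ;
  test_derivable2 : forall x s, derivable (phi x) s 1 ;
  test_continuous1 : continuous (fun z : R * R => derive1 (phi^~ z.2) z.1) ;
  test_continuous2 : continuous (fun z : R * R => derive1 (phi z.1) z.2) ;
  test_support : exists m s : R, (m%:E < right_end G)%E /\
    forall y t, ages G y -> 0 <= t -> (m < y) || (s < t) -> phi y t = 0 }.

Definition departure_integral nu (t : R) : \bar R :=
  (\int[lebesgue_measure]_(s in `[0%R, t])
    \int[nu s]_(x in ages G) (h x)%:E)%E.

Definition fluid_D nu (t : R) : R := fine (departure_integral nu t).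

Definition fluid_K nu (t : R) : R :=
  mass G (nu t) - mass G (nu 0) + fluid_D nu t.

Record fluid_solution E (x0 : R) (nu0 : {measure set R -> \bar R}) X nu :
    Prop := {
  fluid_X_ge0 : forall t, 0 <= t -> 0 <= X t ;
  fluid_X_cadlag : cadlag X ;
  fluid_nu_cadlag : measure_cadlag G nu ;
  fluid_finite : forall t, 0 <= t -> (departure_integral nu t < +oo)%E ;
  fluid_age : forall t phi, 0 <= t -> test_function phi ->
    exists2 I, is_stieltjes_integral (phi 0) (fluid_K nu) t I &
    pairing G (phi^~ t) (nu t) = pairing G (phi^~ 0) nu0
      + \int[lebesgue_measure]_(s in `[0, t])
          pairing G (fun x => derive1 (phi x) s + derive1 (phi^~ s) x) (nu s)
      - \int[lebesgue_measure]_(s in `[0, t])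
          pairing G (fun x => h x * phi x s) (nu s)
      + I ;
  fluid_X : forall t, 0 <= t -> X t = x0 + E t - fluid_D nu t ;
  fluid_non_idling : forall t, 0 <= t ->
    1 - mass G (nu t) = Num.max (1 - X t) 0 }.

Definition unique_fluid_solution E (x0 : R) (nu0 : {measure set R -> \bar R})
    X nu :=
  fluid_solution E x0 nu0 X nu /\
  forall X' nu', fluid_solution E x0 nu0 X' nu' ->
    forall t, 0 <= t ->
      X' t = X t /\ forall B : set R, measurable B -> nu' t B = nu t B.

Definition fluid_waiting_time E nu (t : R) : \bar R :=
  (right_inv (fluid_K nu) (E t) - t%:E)%E.

Definition fluid_sojourn_time E nu (t : R) : \bar R :=
  (right_inv (fluid_D nu) (E t) - t%:E)%E.

End fluid.

(* Main.v *)
From HB Require Import structures.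
Require Import Defs.
From mathcomp Require Import all_boot all_order all_algebra.
From mathcomp Require Import all_classical all_reals all_analysis.
From mathcomp Require Import measurable_realfun.
From mathcomp Require Import ring lra.
Import Order.TTheory GRing.Theory Num.Theory.
Import numFieldNormedType.Exports.
Set Implicit Arguments.
Unset Strict Implicit.
Unset Printing Implicit Defensive.
Local Open Scope classical_set_scope.
Local Open Scope ring_scope.

(** Let [K^N] and [D^N] be the entries into service and the departures divided
    by [N], and [K], [D] their fluid counterparts. Both pairs solve the same
    system of two equations, up to a vanishing error for the first pair:
    - [D t = I t + \int_[0, t] g u * K (t - u)], where [I t] is the number of
      departures among the customers in service at time 0;
    - [K t = E t + (X0 - 1)^+ - (X0 + E t - D t - 1)^+], by the non-idling
      condition at the times [0] and [t].
    As the positive part is 1-Lipschitz and the convolution with the probability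
    density [g] contracts for a suitable exponential weight
    ([volterra_stability]), a small error in the equations, uniform on [[0, T]],
    gives a small distance between the solutions ([departures_entries_cvg]).

    For the queue, the equations hold by the laws of large numbers for the
    requirements. Conditional independence bounds the exponential moments of
    weighted sums of centered indicators, and the Chernoff bounds are summable
    over [N] ([weighted_lln]). This gives the almost sure limits of two numbers
    divided by [N]: of the customers with requirement at most [y] among the first [c N] to
    enter service, and of the initial customers who stay longer than [u]; for the
    latter the ages are sorted into short blocks ([initial_customers_lln]). Both
    numbers are monotone, in [c] and in [u], and the limits are continuous, so that
    the convergence is locally uniform ([polya]). The entry times are not
    independent of the requirements, but they increase with the label: the
    customers who entered about [y] units of time ago form an interval of labels,
    and the uniform law for initial segments controls the departures whatever the
    entry times are ([block_estimate]).

    For the fluid model, the first equation follows from a test function that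
    solves [phi_s + phi_x = h phi] on the relevant ages, so that transport and
    departures cancel and the Stieltjes term in [K] becomes a convolution with
    [g] ([fluid_mass_renewal]).

    Where the limit has slope at least [theta], a uniform error [r] in a path and
    in the level moves the inverse by at most [2 r / theta]
    ([real_inv_stability]). The waiting and sojourn times therefore converge
    almost surely, uniformly on bounded intervals, to continuous limits. It
    remains to choose versions that are random elements of the Skorokhod space:
    for càdlàg paths this reduces to the measurability of the coordinates
    ([Drandom_element_coordinates]), and the paths are set to a constant off a
    measurable set of full measure. Bounded convergence then gives the
    convergence in distribution. *)

(** * Growth of absolutely continuous functions *)

Section real_analysis.
Context {R : realType}.
Implicit Types (f : R -> R) (s t e T : R).
Notation leb := (@lebesgue_measure R).

Definition chain (Rl : R -> R -> Prop) (a b : R) (n : nat) (x : nat -> R) :=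
  [/\ x 0%N = a, x n = b &
      forall i, (i < n)%N -> x i < x i.+1 /\ Rl (x i) (x i.+1)].

Lemma chain_rcons Rl a b c n x : chain Rl a b n x -> b < c -> Rl b c ->
  chain Rl a c n.+1 (fun i => if (i <= n)%N then x i else c).
Proof.
move=> [x0 xn xS] bc Rbc; split=> [//||i]; first by rewrite ltnn.
rewrite ltnS leq_eqVlt => /predU1P[->|i_n].
  by rewrite eqxx ltnn xn.
by rewrite i_n orbT; exact: xS.
Qed.

(** The supremum of the points that a chain reaches from [a] is reached by a
    chain, because of the left condition, and equals [b], because of the right
    condition. *)
Lemma cousin Rl a b : a <= b ->
  (forall t, a < t -> t <= b ->
    exists2 u', u' < t & forall u, u' <= u -> a <= u -> u < t -> Rl u t) ->
  (forall t, a <= t -> t < b ->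
    exists2 v', t < v' & forall v, t < v -> v <= v' -> v <= b -> Rl t v) ->
  exists n x, chain Rl a b n x.
Proof.
move=> ab lR rR.
pose S := [set t | a <= t <= b /\ exists n x, chain Rl a t n x].
have Sa : S a by split; [rewrite lexx ab|exists 0%N, (fun=> a); split].
have ubS : has_ubound S by exists b => t [/andP[]].
have supS : has_sup S by split=> //; exists a.
set s := sup S.
have as_ : a <= s by exact: ub_le_sup.
have sb : s <= b by apply: ge_sup => [|t [/andP[]]//]; exists a.
have Ss : S s.
  split; first by rewrite as_ sb.
  move: as_; rewrite le_eqVlt => /predU1P[<-|as_]; first by case: Sa.
  have [u' u's Ru] := lR _ as_ sb.
  have [|t St] := @sup_adherent _ S (s - u') _ supS; first by rewrite subr_gt0.
  rewrite -/s opprB addrC subrK => u't.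
  have : t <= s by exact: ub_le_sup.
  rewrite le_eqVlt => /predU1P[<-|ts]; first by case: St.
  case: St => /andP[a_t _] [n [x ch]].
  exists n.+1; eexists; apply: (chain_rcons ch ts).
  by apply: Ru => //; exact: ltW.
move: sb; rewrite le_eqVlt => /predU1P[<-|sb]; first by case: Ss.
have [v' sv' Rv] := rR _ as_ sb.
have : S (Num.min v' b).
  split; first by rewrite le_min (ltW (le_lt_trans as_ sv')) ab ge_min lexx orbT.
  case: Ss => _ [n [x ch]]; exists n.+1; eexists; apply: chain_rcons ch _ _.
    by rewrite lt_min sv' sb.
  by apply: Rv; rewrite ?lt_min ?sv' ?sb// ge_min lexx ?orbT.
move=> /(ub_le_sup ubS); rewrite -/s leNgt => /negP; case.
by rewrite lt_min sv' sb.
Qed.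

Lemma chain_le Rl a b n x i j : chain Rl a b n x -> (i <= j)%N -> (j <= n)%N ->
  x i <= x j.
Proof.
move=> [_ _ xS] ij jn; rewrite -(subnKC ij); move: jn; rewrite -{1}(subnKC ij).
elim: (j - i)%N => [|k IH]; first by rewrite addn0.
rewrite addnS => ikn; apply: le_trans (IH (ltnW ikn)) _.
by have [/ltW] := xS _ ikn.
Qed.

(** The exceptional null set is covered by an open set [O] of small measure. Each
    point has short intervals on which either the increment is at least
    [(theta - e1)] times the length, by the derivative, or which lie in [O]; a
    chain of such intervals joins [s] to [t], and absolute continuity bounds the
    total variation over the links that lie in [O]. *)
Lemma abs_continuous_increase f theta s t :
  (forall T, absolutely_continuous_on f T) -> 0 <= theta ->
  {ae leb, forall t : R, 0 <= t -> derivable f t 1 /\ theta <= derive1 f t} ->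
  0 <= s -> s <= t -> theta * (t - s) <= f t - f s.
Proof.
move=> acf theta0 [Z [mZ Z0 subZ]] s0 st.
apply/ler_addgt0Pr => e e0.
pose e1 := e / (t - s + theta + 1).
have D0 : 0 < t - s + theta + 1 by rewrite -addrA ltr_wpDl ?subr_ge0// ltr_wpDl.
have e10 : 0 < e1 by rewrite divr_gt0.
have [d d0 Hd] := acf t _ e10.
pose d1 := Num.min d e1.
have d10 : 0 < d1 by rewrite lt_min d0.
have [ O [oO ZO muO]] : exists U : set R,
    [/\ open U, Z `<=` U & (leb (U `\` Z) < d1%:E)%E].
  apply: lebesgue_regularity_outer => //.
  exact: (eq_ind_r (fun r => (r < +oo)%E) (ltry 0) Z0).
have muO' : (leb O < d1%:E)%E.
  rewrite (_ : O = Z `|` (O `\` Z)); last by rewrite setDUK.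
  rewrite measureU//=.
  - by rewrite Z0 add0e.
  - by apply: measurableD => //; exact: open_measurable.
  - by rewrite setDE setICA setICr setI0.
pose good u v := (theta - e1) * (v - u) <= f v - f u.
pose Rl u v := good u v \/ `]u, v] `<=` O.
have loc z : s <= z -> exists2 r, 0 < r & forall u, s <= u -> `|u - z| < r ->
    (u <= z -> Rl u z) /\ (z <= u -> Rl z u).
  move=> sz; have z0 := le_trans s0 sz.
  have [Oz|nOz] := pselect (O z).
    have /nbhs_ballP[r /= r0 rO] : nbhs z O by exact: open_nbhs_nbhs.
    exists r => // u su ur; split=> uz; right=> y /=; rewrite in_itv/= => /andP[y1 y2];
      apply: rO; rewrite /ball /=.
      rewrite ger0_norm ?subr_ge0//; move: ur; rewrite distrC ger0_norm ?subr_ge0//.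
      by apply: le_lt_trans; rewrite lerD2l lerN2 ltW.
    rewrite distrC gtr0_norm ?subr_gt0//; move: ur; rewrite ger0_norm ?subr_ge0//.
    by apply: le_lt_trans; rewrite lerD2r.
  have [dfz thz] : derivable f z 1 /\ theta <= derive1 f z.
    by apply: contrapT => h; apply/nOz/ZO/subZ => /(_ z0).
  have : theta - e1 < derive1 f z by rewrite ltrBlDr ltr_pwDr.
  rewrite derive1E => lt1; have [r /= r0 Hr] := cvgr_gt _ dfz _ lt1.
  exists r => // u su ur.
  have Hu : u != z -> theta - e1 < (u - z)^-1 * (f u - f z).
    move=> uz; have := Hr (u - z); rewrite /= sub0r normrN => /(_ ur).
    rewrite subr_eq0 => /(_ uz).
    by rewrite /GRing.scale/= mulr1 subrK.
  split; rewrite le_eqVlt => /predU1P[uz|uz]; left; rewrite /good;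
    do ?by rewrite uz !subrr mulr0.
    have {}/Hu : u != z by rewrite lt_eqF.
    rewrite -[X in _ < X]mulrNN -invrN !opprB ltr_pdivlMl ?subr_gt0// => /ltW.
    by rewrite mulrC.
  have {}/Hu : u != z by rewrite gt_eqF.
  by rewrite ltr_pdivlMl ?subr_gt0// => /ltW; rewrite mulrC.
have [||n [x [x0 xn xS]]] := @cousin Rl s t st.
- move=> z sz zt; have [r r0 Hr] := loc z (ltW sz).
  exists (z - r / 2); first by rewrite ltrBlDr ltrDl divr_gt0.
  move=> u uz su uz'; apply: (Hr u su _).1; last exact: ltW.
  rewrite distrC gtr0_norm ?subr_gt0//; lra.
- move=> z sz zt; have [r r0 Hr] := loc z sz.
  exists (z + r / 2); first by rewrite ltrDl divr_gt0.
  move=> u zu uz ut; apply: (Hr u _ _).2; [exact: le_trans (ltW zu)| |exact: ltW].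
  by rewrite gtr0_norm ?subr_gt0//; lra.
have ch : chain Rl s t n x by split.
have xle i j := @chain_le _ _ _ _ _ i j ch.
(* [a_] makes the links outside [O] degenerate, so that absolute continuity can
   be applied to the whole chain. *)
pose bad i := `[< `]x i, x i.+1] `<=` O >].
pose a_ i := if bad i then x i else x i.+1.
have x_a i : (i < n)%N -> x i <= a_ i <= x i.+1.
  move=> i_n; have [/ltW xx _] := xS _ i_n.
  by rewrite /a_; case: ifP; rewrite ?lexx ?xx.
have sumO k : (k <= n)%N ->
    ((\sum_(i < k) (x i.+1 - a_ i))%:E <= leb (O `&` `]-oo, x k]))%E.
  elim: k => [|k IH] kn; first by rewrite big_ord0 measure_ge0.
  have mO : measurable O by exact: open_measurable.
  rewrite big_ord_recr/= EFinD; apply: (@le_trans _ _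
    (leb (O `&` `]-oo, x k] `|` (`]a_ k, x k.+1])))%E).
    rewrite measureU//=; last 2 first.
    - exact: measurableI.
    - apply/seteqP; split=> // y [/= [_]]; rewrite !in_itv/= => yk /andP[+ _].
      by move=> /(le_lt_trans (andP (x_a _ kn)).1) /(le_lt_trans yk); rewrite ltxx.
    rewrite leeD ?IH ?(ltnW kn)// lebesgue_measure_itv/= lte_fin.
    case: ltP => // h; rewrite lee_fin subr_le0//.
  apply: le_measure; rewrite ?inE//.
  - by apply: measurableU => //; exact: measurableI.
  - exact: measurableI.
  move=> y [[Oy /= yk]|/= ya].
    move: yk; rewrite in_itv/= => yk; by split=> //; rewrite in_itv/= (le_trans yk)// xle.
  move: ya; rewrite in_itv/= => /andP[y1 y2].
  split; last by rewrite /= in_itv.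
  move: y1; rewrite /a_; case: ifP => [/asboolP bk|_] y1.
    by apply: bk; rewrite /= in_itv/= y1.
  by move: (lt_le_trans y1 y2); rewrite ltxx.
have sum_d : \sum_(i < n) (x i.+1 - a_ i) < d1.
  rewrite -lte_fin; apply: le_lt_trans (sumO _ (leqnn n)) _.
  apply: le_lt_trans muO'; apply: le_measure; rewrite ?inE//.
  - by apply: measurableI => //; exact: open_measurable.
  - exact: open_measurable.
have Hd1 : \sum_(i < n) `|f (x i.+1) - f (a_ i)| < e1.
  apply: (Hd n a_ (fun i => x i.+1)).
  - move=> i i_n; have /andP[x1 x2] := x_a _ i_n; split; last split=> //.
      by rewrite (le_trans _ x1)// (le_trans s0)// -x0 xle// ltnW.
    by rewrite -xn xle.
  - by move=> i i_n; have /andP[] := x_a _ i_n.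
  - by rewrite (lt_le_trans sum_d)// ge_min lexx.
have tel (h : R -> R) : h t - h s = \sum_(i < n) (h (x i.+1) - h (x i)).
  by rewrite -x0 -xn -(@telescope_sumr _ 0 n (h \o x))// big_mkord.
rewrite (tel f) (tel id)/= mulr_sumr.
apply: (@le_trans _ _ (\sum_(i < n) (f (x i.+1) - f (x i) + e1 * (x i.+1 - x i)
   + `|f (x i.+1) - f (a_ i)| + theta * (x i.+1 - a_ i)))).
  apply: ler_sum => i _; have [/ltW xx RR] := xS i (ltn_ord i).
  have th1 : 0 <= e1 * (x i.+1 - x i) by rewrite mulr_ge0 ?subr_ge0// ltW.
  rewrite /a_; case: ifP => [_|/asboolP nb].
    by have := ler_norm (- (f (x i.+1) - f (x i))); rewrite normrN; lra.
  case: RR => // gd; rewrite !subrr normr0 mulr0 !addr0.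
  by move: gd; rewrite /good mulrBl lerBlDr.
rewrite !big_split/= -!mulr_sumr -addrA -addrA lerD2l.
rewrite -(tel id)/=.
apply: (@le_trans _ _ (e1 * (t - s) + (e1 + theta * e1))).
  rewrite lerD2l lerD ?(ltW Hd1)// ler_wpM2l// ltW// (lt_le_trans sum_d)//.
  by rewrite ge_min lexx orbT.
rewrite (_ : _ + _ = e1 * (t - s + theta + 1)); last by ring.
by rewrite /e1 divfK// gt_eqF.
Qed.
End real_analysis.

(** * Locally uniform convergence *)

Section locally_uniform.
Context {R : realType}.
Implicit Types (f : R -> R) (s t e T : R).

Definition locally_uc f := forall T e, 0 < e -> exists2 d, 0 < d &
  forall s t, 0 <= s <= T -> 0 <= t <= T -> `|s - t| < d -> `|f s - f t| <= e.

Lemma uniformly_strictly_increasing_uc f :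
  uniformly_strictly_increasing f -> locally_uc f.
Proof.
move=> [acf _] T e e0; have [d d0 Hd] := acf T e e0; exists d => // s t.
wlog st : s t / s <= t.
  move=> H sT tT; have [st|/ltW ts] := leP s t; first exact: H.
  by rewrite distrC (distrC (f s)); exact: H.
move=> /andP[s0 _] /andP[_ tT]; rewrite distrC (distrC (f s)).
rewrite ger0_norm ?subr_ge0// => std; apply: ltW.
have := Hd 1%N (fun=> s) (fun=> t); rewrite !big_ord1; exact.
Qed.

Lemma uniformly_strictly_increasing_slope f :
  uniformly_strictly_increasing f ->
  exists2 theta, 0 < theta &
    forall s t, 0 <= s -> s <= t -> theta * (t - s) <= f t - f s.
Proof.
move=> [acf [theta theta0 ae]]; exists theta => // s t s0 st.
by apply: abs_continuous_increase => //; exact: ltW.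
Qed.

(** Between two neighbouring points of a fine grid, [f_ n] stays between its
    values at these points, and [f] hardly changes. *)
Lemma polya (f_ : nat -> R -> R) f T :
  (forall n s t, 0 <= s -> s <= t -> f_ n s <= f_ n t) -> locally_uc f ->
  (forall k m : nat, f_ n (k%:R / m.+1%:R) @[n --> \oo] --> f (k%:R / m.+1%:R)) ->
  forall e, 0 < e ->
    \forall n \near \oo, forall t, 0 <= t <= T -> `|f_ n t - f t| <= e.
Proof.
move=> ndf ucf cvf e e0.
have e20 : 0 < e / 2 by rewrite divr_gt0.
have [d d0 Hd] := ucf (T + 1) _ e20.
pose m := Num.truncn (d^-1).
have md : m.+1%:R^-1 < d.
  by rewrite invf_plt ?posrE// /m truncnS_gt.
pose x (k : nat) : R := k%:R / m.+1%:R.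
have x0 k : 0 <= x k by rewrite divr_ge0.
have xS k : x k.+1 = x k + m.+1%:R^-1 by rewrite /x -addn1 natrD mulrDl mul1r.
have m1 : m.+1%:R^-1 <= 1 :> R by rewrite invf_le1// ler1n.
pose L := (Num.truncn (T * m.+1%:R)).+2.
have : \forall n \near \oo, forall k : 'I_L, `|f_ n (x k) - f (x k)| < e / 2.
  apply: filter_forall => k; rewrite /x.
  have /cvgrPdist_lt/(_ _ e20) := cvf k m.
  by apply: filterS => n; rewrite distrC.
apply: filterS => n Hn t /andP[t0 tT].
pose k := Num.truncn (t * m.+1%:R).
have tm0 : 0 <= t * m.+1%:R by rewrite mulr_ge0.
have kL : (k.+1 < L)%N.
  by rewrite !ltnS; apply: le_truncn; rewrite ler_pM2r.
have xkt : x k <= t by rewrite ler_pdivrMr// truncn_le.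
have txk : t < x k.+1 by rewrite ltr_pdivlMr// truncnS_gt.
have txk' : x k.+1 <= x k + m.+1%:R^-1 by rewrite xS.
have xkT : x k.+1 <= T + 1 by rewrite xS lerD// (le_trans xkt).
have Hk := Hn (Ordinal (ltnW kL)).
have HSk := Hn (Ordinal kL).
have fxk : `|f (x k) - f t| <= e / 2.
  apply: Hd; rewrite ?x0 ?t0/=; [lra|lra|].
  rewrite distrC ger0_norm ?subr_ge0// ltrBlDl; apply: lt_trans txk _.
  by rewrite xS ltrD2l.
have fxSk : `|f (x k.+1) - f t| <= e / 2.
  apply: Hd; rewrite ?x0 ?t0/= ?xkT//; [lra|].
  rewrite gtr0_norm ?subr_gt0// ltrBlDl; apply: le_lt_trans txk' _.
  by rewrite ler_ltD.
have f1 := ndf n _ _ (x0 k) xkt.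
have f2 := ndf n _ _ t0 (ltW txk).
rewrite /= in Hk HSk; move: Hk HSk fxk fxSk.
rewrite !ltr_norml !ler_norml; lra.
Qed.

(** A time change that moves the points of [[0, T]] by less than [1] sends some
    point of [[0, T + 1]] to each point of [[0, T]]. *)
Lemma J1_cvg_locally_uniform (x_ : nat -> skorokhod R) (x : skorokhod R) :
  locally_uc x -> x_ @ \oo --> x -> forall T e, 0 < e ->
    \forall n \near \oo, forall t, 0 <= t <= T -> `|x_ n t - x t| <= e.
Proof.
move=> ucx xx T e e0.
have e20 : 0 < e / 2 by rewrite divr_gt0.
have [d d0 Hd] := ucx (T + 1) _ e20.
pose r := Num.min (Num.min d 1) (e / 2).
have r0 : 0 < r by rewrite !lt_min d0 ltr01.
have nbx : nbhs x (J1_ball (T + 1) r x) by exists (T + 1), r; split.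
have {}xx : \forall n \near \oo, J1_ball (T + 1) r x (x_ n) by exact: (xx _ nbx).
apply: filterS xx => n [l tl Hl] t /andP[t0 tT].
have [l0 linc lsur] := tl; have [s s0 lst] := lsur _ t0.
have sT : s <= T + 1.
  rewrite leNgt; apply/negP => Ts.
  have T10 : 0 <= T + 1 by rewrite addr_ge0// (le_trans t0).
  have [|H1 _] := Hl (T + 1); first by rewrite T10 lexx.
  have := linc _ _ T10 Ts; rewrite lst.
  move: H1; rewrite ltr_norml !lt_min => /andP[+ _].
  have : r <= 1 by rewrite /r !ge_min lexx orbT.
  lra.
have [|H1 H2] := Hl s; first by rewrite s0.
have rd : r <= d by rewrite /r !ge_min lexx.
have re : r <= e / 2 by rewrite /r !ge_min lexx orbT.
have : `|x t - x s| <= e / 2.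
  apply: Hd; rewrite ?t0 ?s0//=; first by rewrite (le_trans tT)// lerDl.
  by rewrite -lst; exact: lt_le_trans rd.
move: H2; rewrite lst => H2 H3.
rewrite -(subrKA (x s)); apply: le_trans (ler_normD _ _) _.
by rewrite (splitr e) lerD// 1?distrC// distrC (le_trans (ltW H2)).
Qed.

Lemma locally_uniform_J1_cvg (x_ : nat -> skorokhod R) (x : skorokhod R) :
  (forall T e, 0 < e ->
    \forall n \near \oo, forall t, 0 <= t <= T -> `|x_ n t - x t| <= e) ->
  x_ @ \oo --> x.
Proof.
move=> H A [T [e [e0 TA]]].
have e20 : 0 < e / 2 by rewrite divr_gt0.
have := H T _ e20; apply: filterS => n Hn; apply: TA.
exists id; first exact: time_change_id.
move=> s sT; rewrite subrr normr0; split=> //=.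
by rewrite (le_lt_trans (Hn _ sT))// gtr_pMr// invf_lt1// ltr1n.
Qed.

Lemma locally_uc_cvg f t : locally_uc f -> 0 <= t ->
  f @ t^'+ --> f t /\ (0 < t -> f @ t^'- --> f t).
Proof.
move=> ucf t0; split=> [|tgt0]; apply/cvgrPdist_le => e e0;
  have [d d0 Hd] := ucf (t + 1) _ e0; near=> s; apply: Hd;
  rewrite ?t0 ?lerDl//=.
- apply/andP; split; first by apply: (le_trans t0); near: s; exact: nbhs_right_ge.
  by near: s; apply: nbhs_right_le; rewrite ltrDl.
- have ts : t <= s by near: s; exact: nbhs_right_ge.
  rewrite distrC ger0_norm ?subr_ge0// ltrBlDl; near: s; apply: nbhs_right_lt.
  by rewrite ltrDl.
- have st : s <= t by near: s; exact: nbhs_left_le.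
  apply/andP; split; first by near: s; exact: nbhs_left_ge.
  by apply: (le_trans st); rewrite lerDl.
- have st : s <= t by near: s; exact: nbhs_left_le.
  rewrite ger0_norm ?subr_ge0// ltrBlDl -ltrBlDr; near: s; apply: nbhs_left_gt.
  by rewrite ltrBlDr ltrDl.
Unshelve. all: by end_near. Qed.

Lemma locally_uc_cadlag f : locally_uc f -> cadlag f.
Proof.
move=> ucf t t0; have [fr fl] := locally_uc_cvg ucf t0; split=> // tgt0.
by apply/cvg_ex; exists (f t); exact: fl.
Qed.

End locally_uniform.

(** * Stability of the renewal equation *)

Lemma integrable_mul_bounded (R : realType) (A : set R) (f k : R -> R) (B : R) :
  measurable A -> lebesgue_measure.-integrable A (EFin \o f) ->
  measurable_fun A k -> (forall u, A u -> `|k u| <= B) ->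
  lebesgue_measure.-integrable A (EFin \o (fun u => f u * k u)).
Proof.
move=> mA fi mk kB; set leb := @lebesgue_measure R in fi *.
have mf : measurable_fun A f by have /integrableP[/measurable_EFinP] := fi.
apply: (@le_integrable _ _ R leb A mA _ (EFin \o (fun u => B * f u))) => //=.
- by apply/measurable_EFinP; exact: measurable_funM.
- move=> u Au; rewrite lee_fin !normrM mulrC ler_wpM2r//.
  by rewrite (le_trans (kB _ Au))// ler_norm.
- have := @integrableZl _ _ R leb A mA B _ fi; exact: eq_integrable.
Qed.

Section volterra.
Context {R : realType}.
Variable g : R -> R.
Notation leb := (@lebesgue_measure R).
Hypothesis mg : measurable_fun setT g.
Hypothesis g0 : forall x, 0 <= g x.
Hypothesis g1 : (\int[leb]_(x in `[0%R, +oo[) (g x)%:E = 1)%E.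

Lemma integrable_density : leb.-integrable `[0%R, +oo[ (EFin \o g).
Proof.
apply/integrableP; split.
  by apply/measurable_EFinP; exact: measurable_funS mg.
under eq_integral => x _ do rewrite /= ger0_norm//.
by rewrite g1 ltry.
Qed.

Lemma integrable_density_mul (A : set R) (k : R -> R) (B : R) : measurable A ->
  A `<=` `[0%R, +oo[ -> measurable_fun A k ->
  (forall u, A u -> `|k u| <= B) ->
  leb.-integrable A (EFin \o (fun u => g u * k u)).
Proof.
move=> mA sA mk kB; apply: integrable_mul_bounded mk kB => //.
by apply: integrableS integrable_density => //; exact: measurable_itv.
Qed.

(** [expR (- n * u)] tends to [0] for [u > 0], and the density is a dominating
    function. *)
Lemma exp_weight : exists2 n : nat, True &
  forall t, 0 <= t -> \int[leb]_(u in `[0, t]) (g u * expR (- n%:R * u)) <= 1 / 2.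
Proof.
pose f_ n u := (g u * expR (- n%:R * u))%:E.
have md : measurable (`]0%R, +oo[ : set R) by exact: measurable_itv.
have eb n (u : R) : 0 <= u -> 0 < expR (- n%:R * u) <= 1.
  by move=> u0; rewrite expR_gt0/= expR_le1 mulNr oppr_le0 mulr_ge0.
have [|||||_ _ /=] := @dominated_convergence _ _ R leb `]0%R, +oo[ md f_ (cst 0%E) (EFin \o g).
- move=> n; apply/measurable_EFinP; apply: measurable_funM.
    exact: measurable_funS mg.
  by apply: measurableT_comp => //; exact: mulrl_measurable.
- exact: measurable_cst.
- apply: aeW => u /=; rewrite in_itv/= andbT => u0.
  apply: cvg_EFin; first exact: nearW.
  rewrite -(mulr0 (g u)); apply: cvgMr.
  have := @cvg_geometric R 1 (expR (- u)).
  rewrite ger0_norm ?expR_ge0// -[X in _ < X]expR0 ltr_expR oppr_lt0 => /(_ u0).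
  apply: cvg_trans; apply: near_eq_cvg; near=> n.
  by rewrite /geometric/= mul1r -expRM_natl mulrN mulNr.
- apply: (@integrableS _ _ R leb _ _ _ _ md _ integrable_density).
    exact: measurable_itv.
  by move=> u; rewrite /= !in_itv/= !andbT => /ltW.
- apply: aeW => u n /=; rewrite in_itv/= andbT => /ltW u0.
  have /andP[e1 e2] := eb n _ u0.
  by rewrite lee_fin ger0_norm ?mulr_ge0// ?ler_piMr// ltW.
rewrite integral0 => /fine_cvgP[fin /cvgrPdist_lt/(_ (1/2))].
have h0 : (0 < 1 / 2 :> R) by [].
move=> /(_ h0) cv; have [n1 Hn] := filter_ex cv.
have [n Hn1] : exists n, fine (\int[leb]_(x in `]0%R, +oo[) f_ n x) < 1 / 2.
  exists n1; move: Hn => /=; rewrite sub0r normrN; apply: le_lt_trans.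
  exact: ler_norm.
exists n => // t t0; apply: ltW; apply: le_lt_trans Hn1.
rewrite -Rintegral_itv_obnd_cbnd; last first.
  apply: (integrable_density_mul (B := 1)); first exact: measurable_itv.
  - by move=> u; rewrite /= !in_itv/= andbT => /andP[/ltW].
  - by apply: measurableT_comp => //; exact: mulrl_measurable.
  - move=> u; rewrite /= in_itv/= => /andP[/ltW u0 _].
    by have /andP[e1 e2] := eb n _ u0; rewrite gtr0_norm.
have int0 : leb.-integrable `]0%R, +oo[ (f_ n).
  apply: (integrable_density_mul (B := 1)); first exact: measurable_itv.
  - by move=> u; rewrite /= !in_itv/= !andbT => /ltW.
  - by apply: measurableT_comp => //; exact: mulrl_measurable.
  - move=> u; rewrite /= in_itv/= andbT => /ltW u0.
    by have /andP[e1 e2] := eb n _ u0; rewrite gtr0_norm.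
rewrite /Rintegral fine_le//.
- apply: integrable_fin_num => //; apply: integrableS int0 => //.
  exact: subset_itvl.
- exact: integrable_fin_num.
- apply: ge0_subset_integral => //.
  + exact: measurable_int int0.
  + by move=> u; rewrite /= in_itv/= andbT => /ltW u0; rewrite lee_fin mulr_ge0// expR_ge0.
  + exact: subset_itvl.
Unshelve. all: by end_near. Qed.

(** With the weight [expR (- n * t)], the convolution with the density is a
    contraction of the supremum norm by the factor [1 / 2], on the whole of
    [[0, T]]. The bound [B] makes the weighted supremum finite and does not enter
    the constant. *)
Lemma volterra_stability (T : R) : exists2 c, 0 < c &
  forall (d w : R -> R) (e B : R), 0 <= e -> measurable_fun `[0%R, T] w ->
  (forall t, 0 <= t <= T -> `|w t| <= B) ->
  (forall t, 0 <= t <= T -> `|w t| <= `|d t| + e) ->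
  (forall t, 0 <= t <= T ->
    `|d t| <= e + `|\int[leb]_(u in `[0, t]) (g u * w (t - u))|) ->
  forall t, 0 <= t <= T -> `|d t| <= c * e.
Proof.
have [n _ Hn] := exp_weight.
pose c := 4 * expR (n%:R * T); exists c; first by rewrite mulr_gt0// expR_gt0.
move=> d w e B e0 mw wB wd dw t tT.
have T0 : 0 <= T by case/andP: tT => t0; exact: le_trans.
pose S := [set expR (- n%:R * s) * `|d s| | s in [set s | 0 <= s <= T]].
have B0 : 0 <= B by apply: le_trans (wB 0 _); rewrite ?lexx.
have g_le1 s : 0 <= s -> \int[leb]_(u in `[0, s]) g u <= 1.
  move=> s0; rewrite -lee_fin fineK.
    rewrite -g1; apply: ge0_subset_integral => //=.
    - by apply/measurable_EFinP; exact: measurable_funS mg.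
    - by move=> x _; rewrite lee_fin.
    - by apply: subset_itvl.
  apply: integrable_fin_num => //.
  apply: (@integrableS _ _ R leb _ _ _ _ _ _ integrable_density) => //.
  by apply: subset_itvl.
have mwt s : 0 <= s <= T -> measurable_fun `[0%R, s] (fun u => w (s - u)).
  move=> /andP[s0 sT]; apply: (measurable_comp (F := `[0%R, T])) mw _ => //.
    move=> _ [u /= + <-]; rewrite !in_itv/= => /andP[u0 us].
    by rewrite subr_ge0 us/= (le_trans _ sT)// gerBl.
  exact: measurable_funB.
have conv_le s b (k : R -> R) : 0 <= s <= T -> 0 <= b ->
    measurable_fun `[0%R, s] k -> (forall u, 0 <= u <= s -> `|k u| <= b) ->
    (forall u, 0 <= u <= s -> `|w (s - u)| <= k u) ->
    `|\int[leb]_(u in `[0, s]) (g u * w (s - u))| <=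
      \int[leb]_(u in `[0, s]) (g u * k u).
  move=> /[dup] sT /andP[s0 sT'] b0 mk kb wk.
  have ms : measurable (`[0%R, s] : set R) by [].
  have ss : `[0%R, s] `<=` (`[0%R, +oo[ : set R) by apply: subset_itvl.
  have ik : leb.-integrable `[0%R, s] (EFin \o (fun u => g u * k u)).
    by apply: (integrable_density_mul (B := b)).
  have iw : leb.-integrable `[0%R, s] (EFin \o (fun u => g u * w (s - u))).
    apply: (integrable_density_mul (B := B)) => //; first exact: mwt.
    move=> u; rewrite /= in_itv/= => /andP[u0 us]; apply: wB.
    by rewrite subr_ge0 us/= (le_trans _ sT')// gerBl.
  apply: le_trans (le_normr_Rintegral _ iw) _ => //.
  apply: le_Rintegral => //.
    exact: integrable_norm.
  move=> u; rewrite /= in_itv/= => us.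
  by rewrite normrM ger0_norm// ler_wpM2l// wk.
have gb s b : 0 <= s -> 0 <= b -> \int[leb]_(u in `[0, s]) (g u * b) <= b.
  move=> s0 b0; rewrite RintegralZr//.
    by rewrite ler_piMl// g_le1.
  apply: (@integrableS _ _ R leb _ _ _ _ _ _ integrable_density) => //.
  by apply: subset_itvl.
have ubS : ubound S (e + B).
  move=> _ [s sT <-]; have /andP[s0 _] := sT.
  rewrite -[leRHS]mul1r ler_pM ?expR_ge0//.
    by rewrite expR_le1 mulNr oppr_le0 mulr_ge0.
  apply: le_trans (dw _ sT) _; rewrite lerD2l.
  apply: le_trans (gb s B s0 B0); apply: (conv_le _ B) => //.
  - by move=> u _; rewrite ger0_norm.
  - move=> u /andP[u0 us]; apply: wB; rewrite subr_ge0 us/=.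
    by case/andP: sT => _; apply: le_trans; rewrite gerBl.
have S0 : S !=set0 by exists (expR (- n%:R * t) * `|d t|), t.
have supS : has_sup S by split=> //; exists (e + B).
set z := sup S.
have Sz s : 0 <= s <= T -> `|d s| <= expR (n%:R * s) * z.
  move=> sT; rewrite -ler_pdivrMl ?expR_gt0// -expRN -mulNr.
  by apply: ub_le_sup; [exists (e + B)|exists s].
have z0 : 0 <= z.
  by have := Sz _ tT; move=> /(le_trans (normr_ge0 _)); rewrite pmulr_rge0 ?expR_gt0.
have z_le : z <= 2 * e + z / 2.
  apply: ge_sup => // _ [s sT <-]; have /andP[s0 sT'] := sT.
  rewrite mulNr expRN ler_pdivrMl ?expR_gt0//.
  apply: le_trans (dw _ sT) _.
  pose k u := e + expR (n%:R * s) * z * expR (- n%:R * u).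
  have eb (u : R) : 0 <= u -> 0 < expR (- n%:R * u) <= 1.
    by move=> u0; rewrite expR_gt0/= expR_le1 mulNr oppr_le0 mulr_ge0.
  have mex : measurable_fun `[0%R, s] (fun u : R => expR (- n%:R * u)).
    by apply: measurableT_comp => //; exact: mulrl_measurable.
  have mk : measurable_fun `[0%R, s] k.
    by apply: measurable_funD => //; exact: measurable_funM.
  have ez : 0 <= expR (n%:R * s) * z by rewrite mulr_ge0 ?expR_ge0.
  have ke u : 0 <= u <= s -> `|k u| <= e + expR (n%:R * s) * z.
    move=> /andP[u0 us]; have /andP[e1 e2] := eb _ u0.
    by rewrite ger0_norm ?addr_ge0 ?mulr_ge0 ?(ltW e1)// lerD2l ler_piMr.
  have := @conv_le s (e + expR (n%:R * s) * z) k sT _ mk ke _.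
  rewrite addr_ge0// => /(_ isT) cl.
  have {}cl := cl _.
  apply: (@le_trans _ _ (e + \int[leb]_(u in `[0, s]) (g u * k u))).
    rewrite lerD2l; apply: cl => u /andP[u0 us].
    apply: le_trans (wd _ _) _.
      by rewrite subr_ge0 us/= (le_trans _ sT')// gerBl.
    rewrite addrC lerD2l; apply: le_trans (Sz _ _) _.
      by rewrite subr_ge0 us/= (le_trans _ sT')// gerBl.
    by rewrite mulrBr expRD mulNr mulrAC.
  have ss : `[0%R, s] `<=` (`[0%R, +oo[ : set R) by apply: subset_itvl.
  have ms : measurable (`[0%R, s] : set R) by [].
  have i1 : leb.-integrable `[0%R, s] (EFin \o (fun u => g u * e)).
    by apply: (integrable_density_mul (B := e)) => // u _; rewrite ger0_norm.
  have i2 : leb.-integrable `[0%R, s] (EFin \o (fun u => g u * expR (- n%:R * u))).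
    apply: (integrable_density_mul (B := 1)) => // u; rewrite /= in_itv/= => /andP[u0 _].
    by have /andP[e1 e2] := eb _ u0; rewrite gtr0_norm.
  rewrite (_ : \int[leb]_(u in `[0, s]) (g u * k u) =
     \int[leb]_(u in `[0, s]) (g u * e) + expR (n%:R * s) * z *
     \int[leb]_(u in `[0, s]) (g u * expR (- n%:R * u))); last first.
    rewrite -RintegralZl// -RintegralD//.
      by apply: eq_Rintegral => u _; rewrite /k; ring.
    have := @integrableZl _ _ R leb _ ms (expR (n%:R * s) * z) _ i2.
    by apply: eq_integrable.
  have := gb s e s0 e0; have := Hn s s0.
  move=> /(ler_wpM2l ez) h1 h2.
  have ex1 : 1 <= expR (n%:R * s) by rewrite -[X in X <= _]expR0 ler_expR mulr_ge0.
  move: (ler_wpM2r e0 ex1) h1 h2; move: (expR _) => E.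
  by move: (Rintegral _ _ _) => I1; move: (Rintegral _ _ _) => I2; clear; lra.
have {z_le} z4 : z <= 4 * e by lra.
have [t0 tT'] := andP tT.
apply: le_trans (Sz _ tT) _.
have -> : c * e = expR (n%:R * T) * (4 * e) by rewrite /c; ring.
by apply: ler_pM; rewrite ?expR_ge0// ler_expR ler_wpM2l.
Qed.

End volterra.

(** * The service distribution *)

Section service_distribution_facts.
Context {R : realType}.
Variables g G : R -> R.
Hypothesis hG : service_distribution g G.
Notation leb := (@lebesgue_measure R).
Implicit Types (s t e x : R).

Let mg := density_measurable hG.
Let g0 := density_ge0 hG.
Let g1 := density_total hG.

Lemma density_integrable (A : set R) : measurable A -> A `<=` `[0%R, +oo[ ->
  leb.-integrable A (EFin \o g).
Proof.
move=> mA sA; apply: (@integrableS _ _ R leb _ _ _ _ mA sA).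
  exact: measurable_itv.
exact: integrable_density mg g0 g1.
Qed.

Lemma cdf_Rintegral x : G x = \int[leb]_(y in `[0, x]) g y.
Proof. by rewrite /Rintegral -(cdfE hG). Qed.

Lemma cdf_eq0 x : x <= 0 -> G x = 0.
Proof.
rewrite cdf_Rintegral le_eqVlt => /predU1P[->|x0].
  by rewrite set_itv1 Rintegral_set1.
by rewrite set_itv_ge ?Rintegral_set0// bnd_simp -ltNge.
Qed.

Lemma cdf_ge0 x : 0 <= G x.
Proof. by rewrite cdf_Rintegral Rintegral_ge0. Qed.

Lemma cdf_le1 x : G x <= 1.
Proof.
rewrite -lee_fin (cdfE hG) -g1; apply: ge0_subset_integral => //=.
- by apply/measurable_EFinP; exact: measurable_funS mg.
- by move=> y _; rewrite lee_fin.
- by apply: subset_itvl.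
Qed.

Lemma cdf_diff s t : 0 <= s -> s <= t -> G t - G s = \int[leb]_(y in `]s, t]) g y.
Proof.
move=> s0 st; rewrite !cdf_Rintegral Rintegral_itvB ?bnd_simp//.
by apply: density_integrable => //; apply: subset_itvl.
Qed.

Lemma cdf_nd s t : s <= t -> G s <= G t.
Proof.
move=> st; have [s0|/ltW s0] := leP 0 s; last by rewrite (cdf_eq0 s0) cdf_ge0.
by rewrite -subr_ge0 cdf_diff// Rintegral_ge0.
Qed.

Lemma cdf_uniformly_continuous e : 0 < e ->
  exists2 d, 0 < d & forall s t, `|s - t| < d -> `|G s - G t| < e.
Proof.
move=> e0.
have ig : leb.-integrable setT (EFin \o (g \_ `[0%R, +oo[)).
  rewrite -restrict_EFin; apply/integrable_restrict => //=.
  by rewrite setTI; apply: density_integrable.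
have [d [d0 Hd]] := integral_normr_continuous ig e0.
exists d => // s t.
wlog st : s t / s <= t.
  move=> H; have [st|/ltW ts] := leP s t; first exact: H.
  by rewrite distrC (distrC (G s)); exact: H.
rewrite distrC (distrC (G s)) ger0_norm ?subr_ge0// => std.
rewrite ger0_norm ?subr_ge0 ?cdf_nd//.
have h s' : 0 <= s' -> s' <= t -> t - s' < d -> G t - G s' < e.
  move=> s'0 s't s'd; rewrite cdf_diff//.
  have mst : measurable (`]s', t] : set R) by [].
  have lt_d : (leb (`]s', t]%classic : set R) < d%:E)%E.
    rewrite lebesgue_measure_itv/= lte_fin.
    by case: ifP => _; rewrite ?lte_fin// -EFinD lte_fin.
  have := Hd _ mst lt_d; apply: le_lt_trans.
  rewrite le_eqVlt; apply/orP; left; apply/eqP; apply: eq_Rintegral => x.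
  rewrite inE /= in_itv/= => /andP[x1 x2]; rewrite patchE mem_set ?ger0_norm//=.
  by rewrite in_itv/= andbT ltW// (le_lt_trans s'0).
have [s0|s0] := leP 0 s; first exact: h.
rewrite (cdf_eq0 (ltW s0)) -(cdf_eq0 (lexx 0)).
have [t0|t0] := leP 0 t.
  by apply: h => //; rewrite subr0; apply: le_lt_trans std; lra.
by rewrite (cdf_eq0 (ltW t0)) (cdf_eq0 (lexx 0)) subrr.
Qed.

Lemma cdf_continuous : continuous G.
Proof.
move=> x; apply/cvgrPdist_lt => e e0.
have [d d0 Hd] := cdf_uniformly_continuous e0.
near=> y; apply: Hd; near: y; apply: cvgr_dist_lt => //; exact: cvg_id.
Unshelve. all: by end_near. Qed.

Lemma cdf_cvg1 e : 0 < e -> exists2 x, 0 <= x & 1 - e < G x.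
Proof.
move=> e0.
have : (\int[leb]_(x in `[0%R, n%:R]) (g x)%:E)%E @[n --> \oo] -->
    (\int[leb]_(x in \bigcup_n `[0%R, n%:R]%classic) (g x)%:E)%E.
  apply: ge0_nondecreasing_set_cvg_integral.
  - move=> m n mn; apply/subsetPset; apply: subset_itvl.
    by rewrite bnd_simp ler_nat.
  - by move=> n; exact: measurable_itv.
  - by move=> n; apply/measurable_EFinP; exact: measurable_funS mg.
  - by move=> n x _; rewrite lee_fin.
have -> : \bigcup_n `[0%R, n%:R]%classic = (`[0%R, +oo[%classic : set R).
  apply/seteqP; split=> [x [n _]|x]; rewrite /= !in_itv/= ?andbT; first by case/andP.
  move=> x0; exists (Num.truncn x).+1 => //=.
  by rewrite in_itv/= x0 ltW// truncnS_gt.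
rewrite g1 => /fine_cvgP[_ /cvgrPdist_lt/(_ _ e0) cv].
have [n Hn] := filter_ex cv; exists n%:R => //.
by move: Hn; rewrite /= -(cdfE hG) /= ltr_norml; lra.
Qed.

(** By continuity, [G] is [1] at the end point of its support, if that is finite. *)
Lemma agesP x : ages G x <-> 0 <= x /\ G x < 1.
Proof.
split=> [[x0]|[x0 Gx]]; last first.
  split=> //.
  have G1 : 0 < 1 - G x by rewrite subr_gt0.
  have [d d0 Hd] := cdf_uniformly_continuous G1.
  apply: (@lt_le_trans _ _ (x + d / 2)%:E).
    by rewrite lte_fin ltrDl divr_gt0.
  apply: ereal_sup_ubound; exists (x + d / 2) => //; split.
    by rewrite addr_ge0// ltW// divr_gt0.
  have := Hd (x + d / 2) x; rewrite addrAC subrr add0r gtr0_norm ?divr_gt0//.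
  rewrite gtr_pMr// invf_lt1// ltr1n => /(_ isT) /ltr_normlW; lra.
move=> /ereal_sup_gt[_ [y [y0 Gy] <-]]; rewrite lte_fin => xy; split=> //.
by apply: le_lt_trans Gy; rewrite cdf_nd// ltW.
Qed.

Lemma measurable_ages : measurable (ages G).
Proof.
rewrite (_ : ages G = `[0%R, +oo[ `&` G @^-1` `]-oo, 1[).
  apply: measurableI; first exact: measurable_itv.
  rewrite -[X in measurable X]setTI.
  by apply: continuous_measurable_fun => //; exact: cdf_continuous.
by apply/seteqP; split=> x; rewrite agesP /= !in_itv/= andbT.
Qed.

End service_distribution_facts.

(** * Random elements of the Skorokhod space *)

Section J1_grid.
Context {R : realType}.
Implicit Types (f : R -> R) (s t e T : R).

(** A one-sided limit bounds the oscillation on a short interval on its side. *)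
Lemma cadlag_partition f T e : cadlag f -> 0 <= T -> 0 < e ->
  exists n x, chain (fun u v => forall s t, u <= s < v -> u <= t < v ->
    `|f s - f t| < e) 0 T n x.
Proof.
move=> cf T0 e0; have e20 : 0 < e / 2 by rewrite divr_gt0.
have tri (a b c : R) : `|c - a| < e / 2 -> `|c - b| < e / 2 -> `|a - b| < e.
  move=> h1 h2; rewrite -(subrKA c) (splitr e).
  by apply: le_lt_trans (ler_normD _ _) _; rewrite ltrD// distrC.
apply: cousin => // t.
- move=> t0 _; have [_ /(_ t0)/cvg_ex[y fy]] := cf t (ltW t0).
  have /cvgrPdist_lt/(_ _ e20) := fy.
  rewrite near_withinE => /nbhs_ballP[r /= r0 Hr].
  exists (t - r / 2); first by rewrite ltrBlDr ltrDl divr_gt0.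
  move=> u ru _ ut s s' /andP[us st] /andP[us' st'].
  have near_y v : u <= v -> v < t -> `|y - f v| < e / 2.
    move=> uv vt; apply: Hr => //; rewrite /ball /= gtr0_norm ?subr_gt0//; lra.
  by apply: (tri _ _ y); exact: near_y.
- move=> t0 _; have [ft _] := cf t t0.
  have /cvgrPdist_lt/(_ _ e20) := ft.
  rewrite near_withinE => /nbhs_ballP[r /= r0 Hr].
  exists (t + r / 2); first by rewrite ltrDl divr_gt0.
  move=> v tv vr _ s s' /andP[ts sv] /andP[ts' sv'].
  have near_y z : t <= z -> z < v -> `|f t - f z| < e / 2.
    rewrite le_eqVlt => /predU1P[<- _|tz zv]; first by rewrite subrr normr0.
    apply: Hr => //; rewrite /ball /= ltr0_norm ?subr_lt0//; lra.
  by apply: (tri _ _ (f t)); exact: near_y.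
Qed.

(** An approximation of [f] that depends on [f] through countably many values, so
    that it inherits the measurability of the coordinates. *)
Definition grid_step (m : nat) f : R -> R :=
  fun t => f ((Num.truncn (t * m.+1%:R))%:R / m.+1%:R).

(** For [p <= c], an increasing function through [(p, c)] that lies above the
    identity only near [p]. *)
Definition hat (p c s : R) := Num.min (c + 2 * (s - p)) (c + (s - p) / 2).

(** A time change that moves each [p i.+1] to [c i.+1], when the [c i.+1] are close
    to the [p i.+1] and above them. *)
Definition hats (n : nat) (p c : nat -> R) (s : R) :=
  \big[Num.max/s]_(i < n) hat (p i.+1) (c i.+1) s.

Lemma hat_lt p c s t : s < t -> hat p c s < hat p c t.
Proof.
move=> st; rewrite /hat lt_min !gt_min; apply/andP; split; apply/orP;
  [left|right]; rewrite ltrD2l; lra.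
Qed.

Lemma hat_lip p c s t : s <= t -> hat p c t <= hat p c s + 2 * (t - s).
Proof.
move=> st; rewrite /hat; have [h|h] := lerP (c + 2 * (s - p)) (c + (s - p) / 2).
  by rewrite ge_min; apply/orP; left; lra.
by rewrite ge_min; apply/orP; right; lra.
Qed.

Lemma hats_lt n p c s t : s < t -> hats n p c s < hats n p c t.
Proof.
move=> st; apply/bigmax_ltP; split.
  exact: lt_le_trans (bigmax_ge_id _ _ _ _).
by move=> i _; apply: lt_le_trans (hat_lt _ _ st) _; exact: le_bigmax.
Qed.

Lemma hats_lip n p c s t : s <= t -> hats n p c t <= hats n p c s + 2 * (t - s).
Proof.
move=> st; apply/bigmax_leP; split.
  apply: (@le_trans _ _ (s + 2 * (t - s))); first lra.
  by rewrite lerD2r; exact: bigmax_ge_id.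
move=> i _; apply: le_trans (hat_lip _ _ st) _; rewrite lerD2r; exact: le_bigmax.
Qed.

Lemma hats_continuous n p c : continuous (hats n p c).
Proof.
move=> s; apply/cvgrPdist_le => e e0; near=> t.
have : `|s - t| <= e / 2.
  by near: t; apply: cvgr_dist_le; [exact: cvg_id|rewrite divr_gt0].
have [st|ts] := leP s t.
  have := hats_lip n p c st.
  have : hats n p c s <= hats n p c t.
    move: st; rewrite le_eqVlt => /predU1P[->//|st].
    exact/ltW/hats_lt.
  move=> h1 h2; rewrite !ler0_norm ?subr_le0//; lra.
have := hats_lip n p c (ltW ts); have := ltW (hats_lt n p c ts).
by move=> h1 h2; rewrite !ger0_norm ?subr_ge0// ?(ltW ts)//; lra.
Unshelve. all: by end_near. Qed.

Lemma hats_time_change n p c : hats n p c 0 = 0 -> time_change (hats n p c).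
Proof.
move=> h0; split=> // [s t _|t t0]; first exact: hats_lt.
have [||s] := @IVT R (hats n p c) 0 t t t0.
- exact/continuous_subspaceT/hats_continuous.
- rewrite h0 minEle maxEle (le_trans t0 (bigmax_ge_id _ _ _ _)).
  by rewrite t0 bigmax_ge_id.
by rewrite in_itv/= => /andP[s0 _] <-; exists s.
Qed.

(** The time change sends each point of a partition with small oscillations of
    [f] to the next grid point. A time [s] and the grid point below [l s] then lie
    in the same interval of the partition. *)
Lemma grid_step_cvg f : cadlag f ->
  ((grid_step^~ f : nat -> skorokhod R) @ \oo --> (f : skorokhod R)).
Proof.
move=> cf A [T0 [e [e0 TA]]].
pose T := Num.max T0 0.
have T_ge0 : 0 <= T by rewrite le_max lexx orbT.
have T1 : 0 <= T + 1 by rewrite addr_ge0.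
have [n [p [p0 pn pS]]] := cadlag_partition cf T1 e0.
have ch : chain (fun u v => forall s t, u <= s < v -> u <= t < v ->
    `|f s - f t| < e) 0 (T + 1) n p by split.
have G1 : \forall m \near \oo, m.+1%:R^-1 < e :> R.
  exact: (near_infty_natSinv_lt (PosNum e0)).
have G2 : \forall m \near \oo, forall i : 'I_n,
    2 * m.+1%:R^-1 < p i.+1 - p i.
  apply: filter_forall => i.
  have gap : 0 < (p i.+1 - p i) / 2.
    by rewrite divr_gt0// subr_gt0; have [] := pS i (ltn_ord i).
  have := @near_infty_natSinv_lt R (PosNum gap).
  by apply: filterS => m /=; rewrite ltr_pdivlMr// mulrC.
apply: (filterS2 _ _ G1 G2) => m me mgap; apply: TA.
set h := m.+1%:R^-1 : R in me mgap.
have h0 : 0 < h by rewrite invr_gt0.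
have ceil (x : R) : 0 <= x -> exists k : nat, x <= k%:R * h < x + h.
  move=> x0; have [k] : exists k : nat, x <= k%:R * h.
    exists (Num.truncn (x * m.+1%:R)).+1.
    by rewrite ler_pdivlMr// ltW// truncnS_gt.
  elim: k => [|k IH].
    rewrite mul0r => x0'; exists 0%N; rewrite mul0r x0'/=.
    by rewrite ltr_wpDl.
  have [/IH//|kx xk] := leP x (k%:R * h); exists k.+1; rewrite xk/=.
  by rewrite -addn1 natrD mulrDl mul1r ltrD2r.
have p_le i j : (i <= j)%N -> (j <= n)%N -> p i <= p j.
  by move=> ij jn; exact: chain_le ch ij jn.
have p_ge0 i : (i <= n)%N -> 0 <= p i by move=> i_n; rewrite -p0 p_le.
have /choice[a Ha] : forall i : nat, exists k : nat, (i <= n)%N ->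
    p i <= k%:R * h < p i + h.
  move=> i; have [i_n|] := leqP i n; last by exists 0%N.
  by have [k Hk] := ceil _ (p_ge0 _ i_n); exists k.
pose c i := (a i)%:R * h.
have gap i j : (i < j)%N -> (j <= n)%N -> p i + 2 * h <= p j.
  move=> ij jn; apply: (@le_trans _ _ (p i.+1)); last exact: p_le.
  by have := mgap (Ordinal (leq_trans ij jn)) => /= /ltW; lra.
pose l := hats n p c.
have hat_other i j : (i <= n)%N -> (j < n)%N -> j.+1 != i ->
    hat (p j.+1) (c j.+1) (p i) <= p i.
  move=> i_n jn ij; rewrite /hat ge_min.
  have /andP[_ cj] := Ha _ jn; rewrite -/(c j.+1) in cj.
  move: ij; rewrite neq_ltn => /orP[ji|ij]; apply/orP; [right|left].
    by have := gap _ _ ji i_n; lra.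
  by have := gap _ _ ij jn; lra.
have l0 : l 0 = 0.
  apply/le_anti; rewrite bigmax_ge_id andbT; apply/bigmax_leP; split=> // i _.
  by have := hat_other 0%N i; rewrite p0; apply.
have l_c i : (0 < i)%N -> (i <= n)%N -> l (p i) = c i.
  case: i => // i _ i_n; have /andP[ci _] := Ha _ i_n; rewrite -/(c i.+1) in ci.
  have hc : hat (p i.+1) (c i.+1) (p i.+1) = c i.+1.
    by rewrite /hat subrr mulr0 mul0r addr0 minxx.
  apply/le_anti/andP; split.
    apply/bigmax_leP; split=> // j _.
    have [->|ji] := eqVneq (j : nat) i; first by rewrite hc.
    by apply: le_trans ci; apply: hat_other => //; rewrite eqSS.
  by rewrite -[leLHS]hc; apply: (le_bigmax _ _ (Ordinal i_n)).
have l_h s : l s <= s + h.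
  apply/bigmax_leP; split; first by rewrite lerDl ltW.
  move=> i _; have /andP[_ ci] := Ha _ (ltn_ord i); rewrite -/(c i.+1) in ci.
  rewrite /hat ge_min; have [sp|ps] := leP s (p i.+1); apply/orP; [left|right]; lra.
have tl : time_change l by exact: hats_time_change.
exists l => // s /andP[s0 sT0].
have sT : s <= T by rewrite le_max sT0.
have s_l : s <= l s by exact: bigmax_ge_id.
split; first by rewrite ger0_norm ?subr_ge0//; have := l_h s; lra.
have [i i_n /andP[ps sp]] : exists2 i, (i < n)%N & p i <= s < p i.+1.
  have : s < p n by rewrite pn; lra.
  have : (n <= n)%N by [].
  elim: {1 3}n => [|k IH] kn; first by rewrite p0 ltNge s0.
  have [sk _|sk skp] := ltP s (p k); first exact: IH (ltnW kn) sk.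
  by exists k; rewrite ?sk.
rewrite distrC.
have [_ osc] := pS i i_n; apply: osc; first by rewrite ps.
have ls0 : 0 <= l s * m.+1%:R by rewrite mulr_ge0// (le_trans s0).
set q := Num.truncn _.
have q_le : q%:R * h <= l s by rewrite ler_pdivrMr// truncn_le.
apply/andP; split.
  have /andP[pa _] := Ha _ (ltnW i_n); apply: le_trans pa _.
  rewrite ler_pM2r// ler_nat truncn_ge_nat// -ler_pdivrMr//.
  have [->|i0] := posnP i.
    have -> : (a 0)%N = 0%N.
      have /andP[_] := Ha 0%N (leq0n _); rewrite p0 add0r gtr_pMl// -[1]/(1%:R).
      by rewrite ltr_nat ltnS leqn0 => /eqP.
    by rewrite mul0r (le_trans s0).
  rewrite -/(c i) -l_c// ?(ltnW i_n)//.
  move: ps; rewrite le_eqVlt => /predU1P[->//|ps]; exact/ltW/hats_lt.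
have /andP[_ ca] := Ha _ i_n.
have : q%:R * h < c i.+1.
  by rewrite (le_lt_trans q_le)// -l_c//; exact: hats_lt.
rewrite ltr_pM2r// ltr_nat => qa.
have : q.+1%:R * h <= (a i.+1)%:R * h by rewrite ler_pM2r// ler_nat.
rewrite -addn1 natrD mulrDl mul1r => /le_lt_trans/(_ ca).
by rewrite ltrD2r.
Qed.

Lemma time_change_inv (l : R -> R) : time_change l ->
  exists2 k, time_change k & forall t, 0 <= t -> 0 <= k t /\ l (k t) = t.
Proof.
move=> tl; have [l0 linc lsur] := tl.
have /choice[k Hk] : forall t, exists s, 0 <= t -> 0 <= s /\ l s = t.
  move=> t; have [/lsur[s s0 st]|_] := leP 0 t; last by exists 0.
  by exists s.
have inj s t : 0 <= s -> 0 <= t -> l s = l t -> s = t.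
  move=> s0 t0 st; apply/eqP; rewrite eq_le !leNgt; apply/andP.
  by split; apply/negP => /linc => /(_ ltac:(done)); rewrite st ltxx.
exists k => //; split=> [|s t s0 st|t t0].
- have [k0 lk0] := Hk 0 (lexx 0); apply: inj => //; last by rewrite lk0 l0.
- have [ks lks] := Hk _ s0; have [kt lkt] := Hk _ (le_trans s0 (ltW st)).
  rewrite ltNge; apply/negP; rewrite le_eqVlt => /predU1P[e|/(linc _ _ kt)].
    by move: st; rewrite -lks -lkt e ltxx.
  by rewrite lks lkt ltNge (ltW st).
- have lt0 := time_change_ge0 tl t0; exists (l t) => //.
  by have [kt lkt] := Hk _ lt0; exact: inj.
Qed.

(** The inverse time change may exceed [T], but by less than [1]. *)
Lemma J1_ball_sym T e (x y : skorokhod R) : 0 <= T -> e <= 1 ->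
  J1_ball (T + 1) e x y -> J1_ball T e y x.
Proof.
move=> T0 e1 [l tl H]; have [k tk Hk] := time_change_inv tl.
have [l0 linc lsur] := tl.
exists k => // s /andP[s0 sT]; have [k0 lk] := Hk _ s0.
have kT : k s <= T + 1.
  rewrite leNgt; apply/negP => Tk.
  have T10 : 0 <= T + 1 by rewrite addr_ge0.
  have [|H1 _] := H (T + 1); first by rewrite T10 lexx.
  by have := linc _ _ T10 Tk; rewrite lk; move: H1; rewrite ltr_norml; lra.
have [|H1 H2] := H (k s); first by rewrite k0.
by rewrite lk in H1 H2; rewrite distrC (distrC (x _)).
Qed.

(** The interiors of these sets exhaust an open [U], and a limit of points of one
    of them lies in [U]. Together these facts express [U x] through sequences that
    converge to [x]. *)
Definition J1_inner (U : set (skorokhod R)) (m : nat) :=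
  [set x | J1_ball m%:R m.+1%:R^-1 x `<=` U].

Lemma J1_inner_exhaust (U : set (skorokhod R)) x : open U -> U x ->
  exists m, (J1_inner U m)° x.
Proof.
rewrite openE => /[apply] -[T [e [e0 TU]]].
pose M := Num.max (Num.max (T + e / 2) 0) (e / 2)^-1.
pose m := Num.truncn M.
have e20 : 0 < e / 2 by rewrite divr_gt0.
have Mm : M < m.+1%:R by exact: truncnS_gt.
exists m.+1; exists T, (e / 2); split=> // y xy z yz; apply: TU.
apply: (J1_ball_trans xy); apply: J1_ballS yz.
  apply/ltW; apply: le_lt_trans Mm; by rewrite !le_max lexx.
rewrite invf_ple ?posrE//; apply: (@le_trans _ _ m.+1%:R).
  by apply/ltW; apply: le_lt_trans Mm; rewrite !le_max lexx !orbT.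
by rewrite ler_nat.
Qed.

Lemma J1_inner_closed (U : set (skorokhod R)) m (x_ : nat -> skorokhod R) x :
  x_ @ \oo --> x -> (\forall n \near \oo, J1_inner U m (x_ n)) -> U x.
Proof.
move=> xx Um.
have nb : nbhs x (J1_ball (m%:R + 1) m.+1%:R^-1 x).
  by exists (m%:R + 1), m.+1%:R^-1; split.
have {}xx : \forall n \near \oo, J1_ball (m%:R + 1) m.+1%:R^-1 x (x_ n).
  exact: (xx _ nb).
have [n [Un xn]] := filter_ex (filterI Um xx).
by apply: Un; apply: J1_ball_sym xn => //; rewrite invf_le1// ler1n.
Qed.

End J1_grid.

Section random_elements.
Context {d : measure_display} {T : measurableType d} {R : realType}.
Variable P : probability T R.
Implicit Types (Z : T -> skorokhod R).

(** The grid step functions depend continuously on countably many coordinates,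
    for the product topology, and countably many rational boxes exhaust the
    preimage of an open set. *)
Lemma grid_step_measurable Z m (U : set (skorokhod R)) :
  (forall t, 0 <= t -> measurable_fun setT (fun w => (Z w : R -> R) t)) ->
  open U -> measurable [set w | U (grid_step m (Z w))].
Proof.
move=> mZ oU.
pose a w k := (Z w : R -> R) (k%:R / m.+1%:R).
pose Phi (b : nat -> R) : skorokhod R := fun t => b (Num.truncn (t * m.+1%:R)).
pose box (q : seq rat) (j : nat) : set (nat -> R) :=
  [set b | forall k, (k < size q)%N -> `|b k - ratr q`_k| < j.+1%:R^-1].
pose F n := if @unpickle (seq rat * nat)%type n is Some (q, j) then
  if `[< forall b, box q j b -> U (Phi b) >] then [set w | box q j (a w)]
  else set0 else set0.
rewrite (_ : [set w | _] = \bigcup_n F n); last first.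
  apply/seteqP; split=> [w Uw|w [n _]]; last first.
    by rewrite /F; case: unpickle => // -[q j]; case: ifP => // /asboolP H /= /H.
  have : nbhs (Phi (a w)) U by exact: open_nbhs_nbhs.
  move=> [T0 [e [e0 TU]]].
  pose j := Num.truncn (2 / e); pose K := (Num.truncn (T0 * m.+1%:R)).+1.
  have j0 : 0 < j.+1%:R^-1 :> R by rewrite invr_gt0.
  have je : 2 * j.+1%:R^-1 < e.
    by rewrite ltr_pdivrMr// -ltr_pdivrMl// mulrC truncnS_gt.
  have /choice[q Hq] : forall k, exists q : rat, `|a w k - ratr q| < j.+1%:R^-1.
    move=> k; have lt_k : a w k - j.+1%:R^-1 < a w k + j.+1%:R^-1.
      by rewrite ltrD2l; apply: lt_trans j0; rewrite oppr_lt0.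
    have [q] := rat_in_itvoo lt_k; rewrite in_itv/= => /andP[q1 q2]; exists q.
    by rewrite ltr_distlC q1.
  exists (pickle (mkseq q K, j)); first exact: I.
  rewrite /F pickleK ifT.
    by move=> k; rewrite size_mkseq => kK; rewrite nth_mkseq.
  apply/asboolP => b Hb; apply: TU; exists id; first exact: time_change_id.
  move=> s /andP[s0 sT]; rewrite subrr normr0; split=> //=.
  rewrite /Phi; set k := Num.truncn _.
  have kK : (k < K)%N by rewrite ltnS le_truncn// ler_pM2r.
  have := Hb k; rewrite size_mkseq => /(_ kK); rewrite nth_mkseq// => h1; have h2 := Hq k.
  rewrite -(subrKA (ratr (q k))); apply: le_lt_trans (ler_normD _ _) _.
  by rewrite (distrC _ (a w k)); apply: lt_trans je; rewrite mulr2n mulrDl mul1r ltrD.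
apply: bigcup_measurable => n _; rewrite /F.
case: unpickle => [[q j]|]; last exact: measurable0.
case: ifP => _; last exact: measurable0.
rewrite (_ : [set w | _] = \bigcap_(k in `I_(size q))
    [set w | `|a w k - ratr q`_k| < j.+1%:R^-1]); last first.
  by apply/seteqP; split=> w Hw k kq; exact: Hw.
apply: fin_bigcap_measurable => //.
move=> k _; rewrite (_ : [set w | _] =
   (fun w => `|a w k - ratr q`_k|) @^-1` `]-oo, j.+1%:R^-1[); last first.
  by apply/seteqP; split=> w /=; rewrite in_itv.
have mf : measurable_fun setT (fun w => `|a w k - ratr q`_k|).
  apply: measurableT_comp => //; apply: measurable_funB => //.
  by apply: mZ; rewrite divr_ge0.
by rewrite -[X in measurable X]setTI; exact: (mf measurableT _ (measurable_itv _)).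
Qed.

(** [Z w] lies in [U] if and only if, for some [m], the grid step functions of
    [Z w] are eventually in the interior of [J1_inner U m]. *)
Lemma Drandom_element_coordinates Z : (forall w, cadlag (Z w)) ->
  (forall t, 0 <= t -> measurable_fun setT (fun w => (Z w : R -> R) t)) ->
  Drandom_element Z.
Proof.
move=> cZ mZ; split=> // U oU.
rewrite (_ : _ @^-1` _ = \bigcup_m \bigcup_k \bigcap_(n >= k)
    [set w | (J1_inner U m)° (grid_step n (Z w))]); last first.
  apply/seteqP; split=> [w /= Uw|w [m _ [k _ H]]].
    have [m Um] := J1_inner_exhaust oU Uw; exists m => //.
    have nb : nbhs (Z w) ((J1_inner U m)°).
      by apply: open_nbhs_nbhs; split=> //; exact: open_interior.
    have [k _ Hk] := grid_step_cvg (cZ w) nb; exists k => // n /= kn; exact: Hk.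
  apply: (@J1_inner_closed _ U m (grid_step^~ (Z w))).
    exact: grid_step_cvg.
  exists k => // n /= kn; have := H n kn; exact: interior_subset.
apply: bigcupT_measurable => m; apply: bigcupT_measurable => k.
apply: bigcap_measurable; first by exists k => /=.
by move=> n _; apply: grid_step_measurable => //; exact: open_interior.
Qed.

Lemma measurable_J1_functional Z (F : skorokhod R -> R) : Drandom_element Z ->
  {within Dspace, continuous F} -> measurable_fun setT (F \o Z).
Proof.
move=> [DZ mZ] cF.
apply: (measurability _ (@RGenOpens.measurableE R)) => _ [_ [a [b ->]] <-].
rewrite setTI.
have oF : open (F @^-1` `]a, b[ : set (subspace Dspace)).
  by apply: open_comp; [move=> x _; exact: cF|exact: interval_open].
have [V oV VD] := (open_subspaceP _ _).1 oF.
rewrite comp_preimage (_ : Z @^-1` _ = Z @^-1` V); first exact: mZ.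
apply/seteqP; split=> w /= Hw.
  have : (V `&` Dspace) (Z w) by rewrite VD; split.
  by case.
by have : (V `&` Dspace) (Z w) by []; rewrite VD => -[].
Qed.

Lemma J1_cvg_expectation (Z_ : nat -> T -> skorokhod R) Z
    (F : skorokhod R -> R) :
  (forall n, Drandom_element (Z_ n)) -> Drandom_element Z ->
  {ae P, forall w, (Z_^~ w) @ \oo --> Z w} ->
  {within Dspace, continuous F} ->
  (exists C, forall x, Dspace x -> `|F x| <= C) ->
  ('E_P[F \o Z_ n] @[n --> \oo] --> 'E_P[F \o Z])%E.
Proof.
move=> DZ_ DZ cvZ cF [C FC].
rewrite unlock.
have [|||||_ _ /=] := @dominated_convergence _ _ R P setT measurableT
  (fun n w => ((F \o Z_ n) w)%:E) (fun w => ((F \o Z) w)%:E) (cst C%:E).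
- by move=> n; apply/measurable_EFinP; exact: measurable_J1_functional.
- by apply/measurable_EFinP; exact: measurable_J1_functional.
- apply: filterS cvZ => w cvw _; apply: cvg_EFin; first exact: nearW.
  have /subspace_continuousP cF' := cF; have cFw := cF' _ (DZ.1 w).
  apply: (@cvg_comp _ _ _ (Z_^~ w) F _ (within Dspace (nbhs (Z w)))) => //.
  move=> A nbA; have [N _ HN] := cvw _ nbA; exists N => // n Nn.
  by apply: (HN n Nn); exact: (DZ_ n).1.
- exact: finite_measure_integrable_cst.
- by apply: aeW => w n _ /=; rewrite lee_fin FC//; exact: (DZ_ n).1.
by [].
Qed.

End random_elements.

(** * Conditional independence and exponential moments *)

Section bounded_measurable.
Context {d : measure_display} {T : measurableType d} {R : realType}.
Implicit Types f g : T -> R.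

Definition bmeas f := measurable_fun setT f /\ exists C, forall w, `|f w| <= C.

Lemma bmeas_cst (r : R) : bmeas (cst r).
Proof. by split; [exact: measurable_cst|exists `|r|]. Qed.

Lemma bmeasD f g : bmeas f -> bmeas g -> bmeas (fun w => f w + g w).
Proof.
move=> [mf [C Cf]] [mg [D Dg]]; split; first exact: measurable_funD.
by exists (C + D) => w; rewrite (le_trans (ler_normD _ _))// lerD.
Qed.

Lemma bmeasM f g : bmeas f -> bmeas g -> bmeas (fun w => f w * g w).
Proof.
move=> [mf [C Cf]] [mg [D Dg]]; split; first exact: measurable_funM.
by exists (C * D) => w; rewrite normrM ler_pM.
Qed.

Lemma bmeas_prod I (s : seq I) (f : I -> T -> R) :
  (forall i, bmeas (f i)) -> bmeas (fun w => \prod_(i <- s) f i w).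
Proof.
move=> bf; elim: s => [|i s IH].
  rewrite (_ : (fun _ => _) = cst 1); first exact: bmeas_cst.
  by apply/funext => w; rewrite big_nil.
rewrite (_ : (fun _ => _) = fun w => f i w * \prod_(j <- s) f j w).
  exact: bmeasM.
by apply/funext => w; rewrite big_cons.
Qed.

Lemma bmeas_sum I (s : seq I) (f : I -> T -> R) :
  (forall i, bmeas (f i)) -> bmeas (fun w => \sum_(i <- s) f i w).
Proof.
move=> bf; elim: s => [|i s IH].
  rewrite (_ : (fun _ => _) = cst 0); first exact: bmeas_cst.
  by apply/funext => w; rewrite big_nil.
rewrite (_ : (fun _ => _) = fun w => f i w + \sum_(j <- s) f j w).
  exact: bmeasD.
by apply/funext => w; rewrite big_cons.
Qed.

Lemma bmeas_indic (A : set T) : measurable A -> bmeas (\1_A).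
Proof.
move=> mA; split; first exact: measurable_indic.
by exists 1 => w; rewrite indicE; case: (w \in A); rewrite ?normr1 ?normr0.
Qed.

Lemma bmeas_expR f : bmeas f -> bmeas (fun w => expR (f w)).
Proof.
move=> [mf [C Cf]]; split; first exact: measurableT_comp.
exists (expR C) => w; rewrite ger0_norm ?expR_ge0// ler_expR.
by rewrite (le_trans (ler_norm _)).
Qed.

End bounded_measurable.

Section tower.
Context {d : measure_display} {T : measurableType d} {R : realType}.
Variable P : probability T R.
Variable G0 : set (set T).
Hypothesis mG0 : G0 `<=` measurable.
Local Notation gS := (g_sigma_algebraType G0).
Local Notation S := (<<s G0>>).

Lemma sub_sigma_measurable : S `<=` @measurable d T.
Proof. exact: smallest_sub (@sigma_algebra_measurable _ T) mG0. Qed.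

Lemma sub_sigma_measurable_fun (f : gS -> R) : measurable_fun setT f ->
  measurable_fun (setT : set T) f.
Proof.
move=> mf _ Y mY; have := mf measurableT Y mY.
exact: sub_sigma_measurable.
Qed.

Lemma sub_sigma_bmeas (f : gS -> R) : bmeas f -> bmeas (f : T -> R).
Proof. by move=> [mf bf]; split=> //; exact: sub_sigma_measurable_fun. Qed.

Lemma measurable_wrtP (f : T -> R) :
  measurable_wrt S f <-> measurable_fun (setT : set gS) f.
Proof.
split=> mf; first by move=> _ Y mY; rewrite setTI; exact: mf.
by move=> B mB; have := mf measurableT B mB; rewrite setTI.
Qed.

Lemma bmeas_integrable (A : set T) (f : T -> R) : measurable A -> bmeas f ->
  P.-integrable A (EFin \o f).
Proof.
move=> mA [mf [C Cf]]; apply: measurable_bounded_integrable => //.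
- by rewrite (le_lt_trans (probability_le1 _ mA)) ?ltry.
- exact: measurable_funS mf.
- exists C; split; first exact: num_real.
  by move=> x Cx y _ /=; rewrite (le_trans (Cf y))// ltW.
Qed.

Lemma mean_indic (A : set T) : measurable A ->
  \int[P]_w \1_A w = fine (P A).
Proof. by move=> mA; rewrite /Rintegral integral_indic// setIT. Qed.

Lemma Rintegral_indic (A : set T) (f : T -> R) : measurable A ->
  \int[P]_(w in A) f w = \int[P]_w (f w * \1_A w).
Proof.
move=> mA; rewrite Rintegral_mkcond; apply: eq_Rintegral => w _.
by rewrite patchE indicE; case: (w \in A); rewrite ?mulr1 ?mulr0.
Qed.

(** Rounding [Y + C] down to the multiples of [1 / m], where [C] bounds [Y], turns
    [Y] into a combination of indicators of sets of the sub-sigma-algebra. *)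
Lemma tower (u v : T -> R) (Y : gS -> R) : bmeas u -> bmeas v ->
  (forall A, S A -> \int[P]_(w in A) u w = \int[P]_(w in A) v w) ->
  bmeas Y -> \int[P]_w (Y w * u w) = \int[P]_w (Y w * v w).
Proof.
move=> bu bv uv bY.
pose z w := u w - v w.
have bz : bmeas z.
  rewrite (_ : z = fun w => u w + cst (-1) w * v w); last first.
    by apply/funext => w; rewrite /z /cst mulN1r.
  by apply: bmeasD => //; apply: bmeasM => //; exact: bmeas_cst.
have z0 A : S A -> \int[P]_w (z w * \1_A w) = 0.
  move=> SA; have mA := sub_sigma_measurable SA.
  rewrite -Rintegral_indic// RintegralB//; try exact: bmeas_integrable.
  by rewrite (uv _ SA) subrr.
suff: \int[P]_w (Y w * z w) = 0.
  move=> Yz; apply/eqP; rewrite -subr_eq0 -RintegralB//; first last.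
  - by apply: bmeas_integrable => //; apply: bmeasM => //; exact: sub_sigma_bmeas.
  - by apply: bmeas_integrable => //; apply: bmeasM => //; exact: sub_sigma_bmeas.
  apply/eqP; rewrite -[RHS]Yz; apply: eq_Rintegral => w _.
  by rewrite /z mulrBr.
have [mY [C CY]] := bY; have [mz [D Dz]] := bz.
have C0 : 0 <= C by apply: le_trans (CY point).
have D0 : 0 <= D by apply: le_trans (Dz point).
apply/eqP; rewrite -normr_eq0; apply/eqP/le_anti; rewrite normr_ge0 andbT.
apply/ler_addgt0Pr => e e0; rewrite add0r.
pose m := Num.truncn (D / e); pose K := (Num.truncn (2 * C * m.+1%:R)).+1.
pose A k := [set w | Num.truncn ((Y w + C) * m.+1%:R) = k].
have YC w : 0 <= Y w + C by have := CY w; rewrite ler_norml; lra.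
have SA k : S (A k).
  rewrite (_ : A k = Y @^-1` `[k%:R / m.+1%:R - C, k.+1%:R / m.+1%:R - C[).
    by have := mY measurableT _ (measurable_itv `[k%:R / m.+1%:R - C, k.+1%:R / m.+1%:R - C[); rewrite setTI.
  apply/seteqP; split=> w; rewrite /A /= in_itv/= lerBlDr ltrBrDr.
    by move/eqP; rewrite truncn_eq ?mulr_ge0// ler_pdivrMr// ltr_pdivlMr.
  by move=> h; apply/eqP; rewrite truncn_eq ?mulr_ge0// -ler_pdivrMr// -ltr_pdivlMr.
pose Ym w := \sum_(k <- iota 0 K) (k%:R / m.+1%:R - C) * \1_(A k) w.
have YmE w : Ym w = (Num.truncn ((Y w + C) * m.+1%:R))%:R / m.+1%:R - C.
  set t := Num.truncn _.
  have tK : t \in iota 0 K.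
    rewrite mem_iota add0n ltnS le_truncn// ler_pM2r//.
    by have := CY w; rewrite ler_norml; lra.
  rewrite /Ym (bigD1_seq t tK (iota_uniq _ _)) indicE mem_set// mulr1.
  rewrite big1; first exact: addr0.
  by move=> k kt; rewrite indicE memNset ?mulr0// => Ak; move: kt; rewrite /= -[k]Ak eqxx.
have Ym_close w : `|Y w - Ym w| <= m.+1%:R^-1.
  rewrite YmE; set t := Num.truncn _.
  have /andP[t1 t2] := truncn_itv (mulr_ge0 (YC w) (ler0n R m.+1)).
  rewrite -/t in t1 t2.
  have h1 : t%:R / m.+1%:R <= Y w + C by rewrite ler_pdivrMr.
  have h2 : Y w + C < t%:R / m.+1%:R + m.+1%:R^-1.
    by rewrite -{2}[m.+1%:R^-1]mul1r -mulrDl natr1 ltr_pdivlMr.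
  rewrite ler_norml; apply/andP; split; last first.
    by rewrite lerBlDr addrA; apply: ltW; rewrite ltrBrDr addrC.
  by apply: (@le_trans _ _ 0); rewrite ?oppr_le0// subr_ge0 lerBlDr.
have bYm : bmeas (Ym : T -> R).
  apply: bmeas_sum => k; apply: bmeasM; first exact: bmeas_cst.
  by apply: bmeas_indic; exact: sub_sigma_measurable.
have Ymz : \int[P]_w (Ym w * z w) = 0.
  rewrite (_ : (fun w => Ym w * z w) = fun w =>
     \sum_(k <- iota 0 K) (k%:R / m.+1%:R - C) * (z w * \1_(A k) w)); last first.
    apply/funext => w; rewrite /Ym mulr_suml; apply: eq_bigr => k _.
    by rewrite -mulrA (mulrC (z w)).
  elim: (iota 0 K) => [|k s IH].
    under eq_Rintegral do rewrite big_nil.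
    by rewrite Rintegral_cst// mul0r.
  have bk j : bmeas (fun w => z w * \1_(A j) w).
    by apply: bmeasM => //; apply: bmeas_indic; exact: sub_sigma_measurable.
  under eq_Rintegral do rewrite big_cons.
  rewrite RintegralD//; first last.
  - apply: bmeas_integrable => //; apply: bmeas_sum => j.
    by apply: bmeasM => //; exact: bmeas_cst.
  - by apply: bmeas_integrable => //; apply: bmeasM => //; exact: bmeas_cst.
  rewrite IH addr0 RintegralZl//; last exact: bmeas_integrable.
  by rewrite z0// mulr0.
have -> : \int[P]_w (Y w * z w) = \int[P]_w ((Y w - Ym w) * z w).
  rewrite -[LHS]subr0 -[X in _ - X]Ymz -RintegralB//.
  - by apply: eq_Rintegral => w _; rewrite mulrBl.
  - by apply: bmeas_integrable => //; apply: bmeasM => //; exact: sub_sigma_bmeas.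
  - by apply: bmeas_integrable => //; exact: bmeasM.
have bYYm : bmeas (fun w : T => (Y w - Ym w) * z w).
  apply: bmeasM => //; rewrite (_ : (fun _ => _) = fun w => Y w + cst (-1) w * Ym w).
    apply: bmeasD; first exact: sub_sigma_bmeas.
    by apply: bmeasM => //; exact: bmeas_cst.
  by apply/funext => w; rewrite /cst mulN1r.
apply: le_trans (le_normr_Rintegral _ (bmeas_integrable _ bYYm)) _ => //.
apply: (@le_trans _ _ (\int[P]_(w in setT) (m.+1%:R^-1 * D))).
  apply: le_Rintegral => //.
  - by apply: integrable_norm; exact: bmeas_integrable.
  - by apply: bmeas_integrable => //; exact: bmeas_cst.
  - by move=> w _; rewrite normrM ler_pM.
rewrite Rintegral_cst// [X in _ * fine X](_ : _ = 1%E); last exact: probability_setT.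
rewrite mulr1 mulrC ler_pdivrMr//.
by rewrite -ler_pdivrMl// mulrC ltW// truncnS_gt.
Qed.

(** The set where [A0] holds and [f1 > f2] belongs to the sub-sigma-algebra. The
    versions [f1] and [f2] are arbitrary, so that the comparison of the integrals
    is made on the parts [D n] of this set where they are bounded. *)
Lemma cond_prob_le (A0 B1 B2 : set T) (f1 f2 : T -> R) :
  measurable B1 -> measurable B2 -> S A0 -> A0 `&` B1 `<=` B2 ->
  is_cond_prob P S B1 f1 -> is_cond_prob P S B2 f2 ->
  {ae P, forall w, A0 w -> f1 w <= f2 w}.
Proof.
move=> mB1 mB2 SA0 AB [/measurable_wrtP mf1 H1] [/measurable_wrtP mf2 H2].
pose D n : set gS := A0 `&` ((fun w => f1 w - f2 w) @^-1` `[n.+1%:R^-1, +oo[ `&`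
  (f1 @^-1` `[- n%:R, n%:R] `&` f2 @^-1` `[- n%:R, n%:R])).
have SD n : S (D n).
  have mA0 : measurable (A0 : set gS) by [].
  have p1 : measurable ((fun w => f1 w - f2 w) @^-1` `[n.+1%:R^-1, +oo[ : set gS).
    have mf : measurable_fun (setT : set gS) (fun w => f1 w - f2 w).
      exact: measurable_funB.
    rewrite -[X in measurable X]setTI; exact: (mf measurableT _ (measurable_itv _)).
  have p2 : measurable (f1 @^-1` `[- n%:R, n%:R] : set gS).
    by rewrite -[X in measurable X]setTI; exact: (mf1 measurableT _ (measurable_itv _)).
  have p3 : measurable (f2 @^-1` `[- n%:R, n%:R] : set gS).
    by rewrite -[X in measurable X]setTI; exact: (mf2 measurableT _ (measurable_itv _)).
  have : measurable (D n) by do 3 (apply: measurableI => //).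
  by [].
have D0 n : P (D n) = 0%E.
  have mD := sub_sigma_measurable (SD n).
  have intD (f : gS -> R) : measurable_fun setT f ->
      (forall w, D n w -> `|f w| <= n%:R) -> P.-integrable (D n) (EFin \o f).
    move=> mf fn; apply: measurable_bounded_integrable => //.
    - by rewrite (le_lt_trans (probability_le1 _ mD)) ?ltry.
    - exact: measurable_funS (sub_sigma_measurable_fun mf).
    - exists n%:R; split; first exact: num_real.
      by move=> x nx y Dy /=; rewrite (le_trans (fn _ Dy))// ltW.
  have i1 : P.-integrable (D n) (EFin \o f1).
    by apply: intD => // w [_ [_ [+ _]]]; rewrite /= in_itv/= ler_norml.
  have i2 : P.-integrable (D n) (EFin \o f2).
    by apply: intD => // w [_ [_ [_ +]]]; rewrite /= in_itv/= ler_norml.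
  have ic : P.-integrable (D n) (EFin \o cst (n.+1%:R^-1 : R)).
    by apply: bmeas_integrable => //; exact: bmeas_cst.
  have : \int[P]_(w in D n) (f2 w + cst n.+1%:R^-1 w) <= \int[P]_(w in D n) f1 w.
    apply: le_Rintegral => //.
      by have := integrableD mD i2 ic; exact: eq_integrable.
    by move=> w [_ [+ _]]; rewrite /= in_itv/= andbT lerBrDr addrC.
  rewrite RintegralD// Rintegral_cst//.
  have : \int[P]_(w in D n) f1 w <= \int[P]_(w in D n) f2 w.
    rewrite /Rintegral fine_le ?integrable_fin_num//.
    rewrite -(H1 _ (SD n)) -(H2 _ (SD n)); apply: le_measure; rewrite ?inE.
    - exact: measurableI.
    - exact: measurableI.
    - by move=> w [Dw B1w]; split=> //; apply: AB; split=> //; case: Dw.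
  move=> le1 le2; have : n.+1%:R^-1 * fine (P (D n)) <= 0.
    by have := le_trans le2 le1; rewrite gerDl.
  rewrite pmulr_rle0 ?invr_gt0// => PD.
  have PDf : P (D n) \is a fin_num by exact: fin_num_measure.
  apply/eqP; rewrite eq_le measure_ge0 andbT -(fineK PDf) lee_fin//.
apply: (@negligibleS _ _ _ P (\bigcup_n D n)); last first.
  apply: negligible_bigcup => n; exists (D n); split=> //; last exact: D0.
  exact: sub_sigma_measurable.
move=> w /= /not_implyP[A0w /negP]; rewrite -ltNge => f21.
have f0 : 0 < f1 w - f2 w by rewrite subr_gt0.
pose M := Num.max (f1 w - f2 w)^-1 (Num.max `|f1 w| `|f2 w|).
exists (Num.truncn M).+1 => //.
have Mn : M < (Num.truncn M).+1%:R by exact: truncnS_gt.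
have h1 : `|f1 w| <= (Num.truncn M).+1%:R.
  by apply: ltW; apply: le_lt_trans Mn; rewrite !le_max lexx orbT.
have h2 : `|f2 w| <= (Num.truncn M).+1%:R.
  by apply: ltW; apply: le_lt_trans Mn; rewrite !le_max lexx !orbT.
split=> //; split=> /=; last by rewrite !in_itv/= -!ler_norml.
rewrite in_itv/= andbT invf_ple ?posrE//.
apply: (@le_trans _ _ (Num.truncn M).+1%:R); last by rewrite ler_nat.
by apply: ltW; apply: le_lt_trans Mn; rewrite le_max lexx.
Qed.

Lemma cond_prob_set0 : is_cond_prob P S set0 (cst 0).
Proof.
split; first by apply/measurable_wrtP; exact: measurable_cst.
by move=> A SA; rewrite setI0 measure0 integral0_eq.
Qed.

Lemma cond_prob_setT : is_cond_prob P S setT (cst 1).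
Proof.
split; first by apply/measurable_wrtP; exact: measurable_cst.
move=> A SA; rewrite setIT -[LHS]mul1e -integral_cst//.
exact: sub_sigma_measurable.
Qed.

Lemma cond_prob_restrict (C B : set T) f : S C ->
  is_cond_prob P S B f -> is_cond_prob P S (C `&` B) (fun w => \1_C w * f w).
Proof.
move=> SC [/measurable_wrtP mf Hf].
have mC : measurable (C : set gS) by [].
split.
  by apply/measurable_wrtP; apply: measurable_funM => //; exact: measurable_indic.
move=> A SA; have SAC : S (A `&` C).
  have : measurable ((A : set gS) `&` C) by exact: measurableI.
  by [].
rewrite setIA Hf// integral_mkcondr; apply: eq_integral => w _.
rewrite patchE indicE; case: (w \in C); rewrite ?mul1r//.
by rewrite mul0r.
Qed.

Definition clip (x : R) := Num.max 0 (Num.min x 1).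

Lemma clip_itv x : 0 <= clip x <= 1.
Proof. by rewrite /clip le_max lexx/= ge_max ler01 ge_min lexx orbT. Qed.

Lemma clip_id x : 0 <= x -> x <= 1 -> clip x = x.
Proof. by move=> x0 x1; rewrite /clip (min_idPl x1) (max_idPr x0). Qed.

Lemma cond_prob_ae_eq (B : set T) (f f' : T -> R) : measurable B ->
  is_cond_prob P S B f -> measurable_wrt S f' ->
  {ae P, forall w, f w = f' w} -> is_cond_prob P S B f'.
Proof.
move=> mB [/measurable_wrtP mf Hf] /measurable_wrtP mf' ff'; split.
  exact/measurable_wrtP.
move=> A SA; rewrite Hf//; apply: ae_eq_integral.
- exact: sub_sigma_measurable.
- apply/measurable_EFinP; apply: measurable_funS (sub_sigma_measurable_fun mf) => //.
- apply/measurable_EFinP; apply: measurable_funS (sub_sigma_measurable_fun mf') => //.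
- by apply: filterS ff' => w -> _.
Qed.

(** The version takes its values in [[0, 1]] everywhere, as the exponential
    bounds require. *)
Lemma cond_prob_clip (B : set T) f : measurable B -> is_cond_prob P S B f ->
  is_cond_prob P S B (clip \o f).
Proof.
move=> mB cf; apply: (cond_prob_ae_eq mB cf).
  have [/measurable_wrtP mf _] := cf; apply/measurable_wrtP.
  apply: measurable_maxr; first exact: measurable_cst.
  by apply: measurable_minr => //; exact: measurable_cst.
have ST : S setT by have : measurable (setT : set gS) by exact: measurableT.
have f0 := @cond_prob_le setT set0 B _ _ measurable0 mB ST
  ltac:(by rewrite setI0) cond_prob_set0 cf.
have f1 := @cond_prob_le setT B setT _ _ mB measurableT ST
  ltac:(by []) cf cond_prob_setT.
by apply: filterS2 f0 f1 => w /(_ I) w0 /(_ I) w1; rewrite /= clip_id.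
Qed.

End tower.

Section exponential_bound.
Context {R : realType}.

Lemma expR_quadratic (x : R) : x <= 1 / 2 -> expR x <= 1 + x + 2 * x ^+ 2.
Proof.
move=> x2; have x1 : 0 < 1 - x by lra.
have := expR_ge1Dx (- x); rewrite expRN => h.
have e0 := expR_gt0 x.
have : (1 - x) * expR x <= 1 by rewrite -ler_pdivlMr// mul1r.
rewrite mulrC -ler_pdivlMr// => /le_trans; apply.
rewrite ler_pdivrMr//.
have -> : (1 + x + 2 * x ^+ 2) * (1 - x) = 1 + x ^+ 2 * (1 - 2 * x) by ring.
by rewrite lerDl mulr_ge0 ?sqr_ge0//; lra.
Qed.

Lemma bernoulli_mgf (l b p : R) : `|l| <= 1 / 2 -> 0 <= b <= 1 -> 0 <= p <= 1 ->
  (1 - p) * expR (- (l * b * p)) + p * expR (l * b * (1 - p)) <=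
    expR (2 * l ^+ 2).
Proof.
move=> l2 /andP[b0 b1] /andP[p0 p1].
have lb : `|l * b| <= 1 / 2.
  by rewrite normrM (ger0_norm b0); apply: le_trans l2; rewrite ler_piMr.
have small q : 0 <= q -> q <= 1 -> `|l * b * q| <= 1 / 2.
  by move=> q0 q1; rewrite normrM (ger0_norm q0); apply: le_trans lb; rewrite ler_piMr.
have e1 : expR (- (l * b * p)) <= 1 + - (l * b * p) + 2 * (- (l * b * p)) ^+ 2.
  apply: expR_quadratic; have := small _ p0 p1; rewrite ler_norml; lra.
have q0 : 0 <= 1 - p by rewrite subr_ge0.
have e2 : expR (l * b * (1 - p)) <=
    1 + l * b * (1 - p) + 2 * (l * b * (1 - p)) ^+ 2.
  apply: expR_quadratic.
  by have := small (1 - p) q0 ltac:(lra); rewrite ler_norml; lra.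
apply: le_trans (expR_ge1Dx _).
apply: le_trans (lerD (ler_wpM2l q0 e1) (ler_wpM2l p0 e2)) _.
have -> : (1 - p) * (1 + - (l * b * p) + 2 * (- (l * b * p)) ^+ 2) +
   p * (1 + l * b * (1 - p) + 2 * (l * b * (1 - p)) ^+ 2) =
   1 + 2 * l ^+ 2 * (b ^+ 2 * (p * (1 - p))) by ring.
have l20 : 0 <= 2 * l ^+ 2 by rewrite pmulr_rge0 ?sqr_ge0.
rewrite lerD2l -[leRHS]mulr1 ler_wpM2l//.
apply: mulr_ile1; [exact: sqr_ge0|exact: mulr_ge0|by rewrite expr_le1|].
by apply: mulr_ile1 => //; lra.
Qed.

End exponential_bound.

Section cond_independent_sums.
Context {d : measure_display} {T : measurableType d} {R : realType}.
Variable P : probability T R.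
Variable G0 : set (set T).
Hypothesis mG0 : G0 `<=` measurable.
Local Notation gS := (g_sigma_algebraType G0).
Local Notation S := (<<s G0>>).
Variables (C : set T) (valid : int -> bool) (v : int -> T -> R).
Variables (B : int -> set R) (f : int -> T -> R).
Hypothesis SC : S C.
Hypothesis mB : forall j, measurable (B j).
Hypothesis mv : forall j, measurable_fun setT (v j).
Hypothesis indep : forall L, uniq L -> (forall j, j \in L -> valid j) ->
  cond_independent_on P S C L v.
Hypothesis fitv : forall j w, 0 <= f j w <= 1.
Hypothesis condf : forall j, valid j ->
  is_cond_prob P S (C `&` v j @^-1` B j) (f j).

Let I j w : R := \1_(v j @^-1` B j) w.

Let mC : measurable C. Proof. exact: sub_sigma_measurable SC. Qed.

Let mI j : measurable (v j @^-1` B j).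
Proof. by rewrite -[X in measurable X]setTI; exact: mv. Qed.

Let bI j : bmeas (I j). Proof. exact: bmeas_indic. Qed.

Let bfS j : valid j -> bmeas (f j : gS -> R).
Proof.
move=> vj; have [/measurable_wrtP mf _] := condf vj; split=> //; exists 1 => w.
by have /andP[f0 f1] := fitv j w; rewrite ger0_norm.
Qed.

(** [f j] is a conditional probability for the valid labels only; the replacement
    is measurable for all labels. *)
Let f' j := if valid j then f j else cst 0.

Let bf' j : bmeas (f' j : gS -> R).
Proof. by rewrite /f'; case: ifP => [/bfS|_]; [|exact: bmeas_cst]. Qed.

(** The versions that the conditional independence provides agree almost surely
    with the given ones. *)
Lemma cond_independent_prod L A : uniq L -> (forall j, j \in L -> valid j) ->
  S A -> \int[P]_(w in A) (\1_C w * \prod_(j <- L) I j w) =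
         \int[P]_(w in A) (\1_C w * \prod_(j <- L) f' j w).
Proof.
move=> uL vL SA; have mA : measurable A by exact: sub_sigma_measurable SA.
have [f2 [cf2 [_ Hf2]]] := indep uL vL mB.
have mcap : measurable [set w | forall j, j \in L -> B j (v j w)].
  elim: (L) => [|j s IH].
    by rewrite (_ : [set _ | _] = setT)//; apply/seteqP.
  rewrite (_ : [set _ | _] = (v j @^-1` B j) `&`
      [set w | forall j, j \in s -> B j (v j w)]); first exact: measurableI.
  apply/seteqP; split=> [w H|w [H1 H2] i].
    split; first by apply: H; rewrite mem_head.
    by move=> i si; apply: H; rewrite inE si orbT.
  by rewrite inE => /predU1P[->|/H2].
have f2E : {ae P, forall w, \prod_(j <- L) f2 j w = \prod_(j <- L) f' j w}.
  have ae j : j \in L -> {ae P, forall w, f2 j w = f' j w}.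
    move=> jL; have vj := vL j jL; rewrite /f' vj.
    have ST : S setT by have : measurable (setT : set gS) by exact: measurableT.
    have mCB : measurable (C `&` v j @^-1` B j) by exact: measurableI.
    have h1 := @cond_prob_le _ _ _ P _ mG0 setT _ _ _ _ mCB mCB ST
      (@subIsetr _ _ _) (cf2 j jL) (condf vj).
    have h2 := @cond_prob_le _ _ _ P _ mG0 setT _ _ _ _ mCB mCB ST
      (@subIsetr _ _ _) (condf vj) (cf2 j jL).
    by apply: filterS2 h1 h2 => w /(_ Logic.I) a /(_ Logic.I) b; apply/le_anti/andP.
  elim: (L) ae => [|j s IH] ae.
    by apply: aeW => w; rewrite !big_nil.
  have aej := ae j (mem_head _ _).
  have {}IH := IH (fun i si => ae i (mem_behead (s := j :: s) si)).
  by apply: filterS2 aej IH => w e1 e2; rewrite !big_cons e1 e2.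
have -> : \int[P]_(w in A) (\1_C w * \prod_(j <- L) f' j w) =
          fine (\int[P]_(w in A) (\1_C w * \prod_(j <- L) f2 j w)%:E)%E.
  rewrite /Rintegral; congr fine; apply: ae_eq_integral => //.
  - apply/measurable_EFinP; apply: (measurable_funS (E := setT)) => //.
    apply: measurable_funM; first exact: measurable_indic.
    by have [] := bmeas_prod L (fun j => sub_sigma_bmeas mG0 (bf' j)).
  - apply/measurable_EFinP; apply: (measurable_funS (E := setT)) => //.
    apply: measurable_funM; first exact: measurable_indic.
    have : forall j, j \in L -> measurable_fun (setT : set T) (f2 j).
      move=> j jL; have [/measurable_wrtP mf2 _] := cf2 j jL.
      exact: sub_sigma_measurable_fun mf2.
    elim: (L) => [|j s IH] mf2.
      rewrite (_ : (fun _ => _) = cst 1); first exact: measurable_cst.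
      by apply/funext => w; rewrite big_nil.
    rewrite (_ : (fun _ => _) = fun w => f2 j w * \prod_(j <- s) f2 j w).
      apply: measurable_funM; first by apply: mf2; rewrite mem_head.
      by apply: IH => i si; apply: mf2; rewrite inE si orbT.
    by apply/funext => w; rewrite big_cons.
  - by apply: filterS f2E => w -> _.
rewrite -(Hf2 A SA) Rintegral_indic//.
rewrite -mean_indic; last by do 2 (apply: measurableI => //).
apply: eq_Rintegral => w _; rewrite !indicE 2!in_setI -2!mulnb 2!natrM mulrC.
congr (_ * (_ * _)).
  elim: (L) => [|j s IH]; first by rewrite big_nil mem_set.
  rewrite big_cons IH /I indicE -natrM mulnb; congr ((_ : bool)%:R).
  apply/idP/idP.
    move=> /andP[/set_mem h1 /set_mem h2]; apply/mem_set => i.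
    by rewrite inE => /predU1P[->|/h2].
  move=> /set_mem H; apply/andP; split; apply/mem_set.
    by apply: H; rewrite mem_head.
  by move=> i si; apply: H; rewrite inE si orbT.
Qed.

Let bfT j : bmeas (f' j : T -> R). Proof. exact: (sub_sigma_bmeas mG0 (bf' j)). Qed.
Let bC : bmeas (\1_C : T -> R). Proof. exact: bmeas_indic. Qed.

(** The second product is expanded one factor at a time: [L1] collects the labels
    for which the indicator has been chosen. *)
Lemma cond_independent_affine L2 L1 (c e : int -> gS -> R) (Y : gS -> R) :
  uniq (L1 ++ L2) -> (forall j, j \in L1 ++ L2 -> valid j) ->
  (forall j, bmeas (c j)) -> (forall j, bmeas (e j)) -> bmeas Y ->
  \int[P]_w (Y w * (\1_C w * (\prod_(j <- L1) I j w *
    \prod_(j <- L2) (c j w + e j w * I j w)))) =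
  \int[P]_w (Y w * (\1_C w * (\prod_(j <- L1) f' j w *
    \prod_(j <- L2) (c j w + e j w * f' j w)))).
Proof.
move=> + + bc be; elim: L2 L1 Y => [|j L2 IH] L1 Y uL vL bY.
  rewrite cats0 in uL vL.
  rewrite (_ : (fun w => _) = fun w => Y w * (\1_C w * \prod_(j <- L1) I j w)).
    rewrite [in RHS](_ : (fun w => _) =
        fun w => Y w * (\1_C w * \prod_(j <- L1) f' j w)).
      apply: (@tower _ _ _ P _ mG0) => //.
      - by apply: bmeasM => //; apply: bmeas_prod.
      - by apply: bmeasM => //; exact: (bmeas_prod L1 bfT).
      - by move=> A SA; exact: cond_independent_prod.
    by apply/funext => w; rewrite big_nil mulr1.
  by apply/funext => w; rewrite big_nil mulr1.
have bcT i : bmeas (c i : T -> R) by exact: (sub_sigma_bmeas mG0 (bc i)).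
have beT i : bmeas (e i : T -> R) by exact: (sub_sigma_bmeas mG0 (be i)).
have bYT : bmeas (Y : T -> R) by exact: (sub_sigma_bmeas mG0 bY).
have bterm (F : int -> T -> R) L : (forall i, bmeas (F i)) ->
    bmeas (fun w : T => \prod_(i <- L) (c i w + e i w * F i w)).
  by move=> bF; apply: bmeas_prod => i; apply: bmeasD => //; exact: bmeasM.
have split_ (F : int -> T -> R) : (forall i, bmeas (F i)) ->
   \int[P]_w (Y w * (\1_C w * (\prod_(i <- L1) F i w *
      \prod_(i <- j :: L2) (c i w + e i w * F i w)))) =
   \int[P]_w ((Y w * c j w) * (\1_C w * (\prod_(i <- L1) F i w *
      \prod_(i <- L2) (c i w + e i w * F i w)))) +
   \int[P]_w ((Y w * e j w) * (\1_C w * (\prod_(i <- j :: L1) F i w *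
      \prod_(i <- L2) (c i w + e i w * F i w)))).
  move=> bF; rewrite -RintegralD//.
  - by apply: eq_Rintegral => w _; rewrite !big_cons; ring.
  - apply: bmeas_integrable => //; apply: bmeasM; first exact: bmeasM.
    by apply: bmeasM => //; apply: bmeasM; [exact: bmeas_prod|exact: bterm].
  - apply: bmeas_integrable => //; apply: bmeasM; first exact: bmeasM.
    by apply: bmeasM => //; apply: bmeasM; [exact: bmeas_prod|exact: bterm].
have uL' : uniq ((j :: L1) ++ L2) by rewrite /= -(uniq_catCA [:: j]) in uL *.
have vL' i : i \in (j :: L1) ++ L2 -> valid i.
  move=> iL; apply: vL; move: iL; rewrite /= !(inE, mem_cat).
  by case: (i == j); rewrite ?orbT.
have uL1 : uniq (L1 ++ L2) by move: uL'; rewrite /= => /andP[].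
have vL1 i : i \in L1 ++ L2 -> valid i.
  by move=> iL; apply: vL'; rewrite /= inE iL orbT.
rewrite !split_//; congr (_ + _).
  by apply: IH => //; exact: bmeasM.
by apply: IH => //; exact: bmeasM.
Qed.

(** The exponential of a multiple of an indicator is an affine function of it, so
    that the mean is obtained by [cond_independent_affine] and bounded factor by
    factor by [bernoulli_mgf]. *)
Lemma cond_independent_mgf L (b : int -> gS -> R) (l : R) :
  uniq L -> (forall j, j \in L -> valid j) -> (forall j, bmeas (b j)) ->
  (forall j w, 0 <= b j w <= 1) -> `|l| <= 1 / 2 ->
  \int[P]_w (\1_C w * expR (l * \sum_(j <- L) b j w * (I j w - f' j w))) <=
    expR (2 * l ^+ 2 * (size L)%:R) * fine (P C).
Proof.
move=> uL vL bb bitv l2.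
pose c j (w : gS) := expR (- (l * b j w * f' j w)).
pose e j (w : gS) := expR (l * b j w * (1 - f' j w)) - c j w.
have f'itv j w : 0 <= f' j w <= 1.
  by rewrite /f'; case: ifP => // _; rewrite /cst lexx ler01.
have bm1 (h : gS -> R) : bmeas h -> bmeas (fun w => - h w).
  move=> bh; rewrite (_ : (fun _ => _) = fun w => cst (-1) w * h w).
    by apply: bmeasM => //; exact: bmeas_cst.
  by apply/funext => w; rewrite mulN1r.
have blb j : bmeas (fun w : gS => l * b j w).
  by apply: (bmeasM (f := cst l)) => //; exact: bmeas_cst.
have bc j : bmeas (c j).
  by apply: bmeas_expR; apply: bm1; exact: bmeasM.
have be j : bmeas (e j).
  apply: bmeasD; last exact: bm1.
  apply: bmeas_expR; apply: bmeasM => //.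
  by apply: (bmeasD (f := cst 1)); [exact: bmeas_cst|exact: bm1].
have -> : \int[P]_w (\1_C w * expR (l * \sum_(j <- L) b j w * (I j w - f' j w))) =
  \int[P]_w (cst 1 w * (\1_C w * (\prod_(j <- [::]) I j w *
     \prod_(j <- L) (c j w + e j w * I j w)))).
  apply: eq_Rintegral => w _; rewrite big_nil !mul1r mulr_sumr expR_sum.
  congr (_ * _); apply: eq_bigr => j _; rewrite /e /c /I indicE.
  case: (w \in _).
    by rewrite mulr1 [RHS]addrC subrK mulrA.
  by rewrite mulr0 addr0 sub0r mulrN mulrN mulrA.
rewrite cond_independent_affine//; last exact: bmeas_cst.
have mgf j w : 0 <= c j w + e j w * f' j w <= expR (2 * l ^+ 2).
  have := bernoulli_mgf l2 (bitv j w) (f'itv j w).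
  have -> : (1 - f' j w) * expR (- (l * b j w * f' j w)) +
    f' j w * expR (l * b j w * (1 - f' j w)) = c j w + e j w * f' j w.
    by rewrite /e /c; ring.
  move=> /[dup] m1 ->; rewrite andbT.
  have /andP[f0 f1] := f'itv j w.
  have -> : c j w + e j w * f' j w = (1 - f' j w) * c j w +
      f' j w * expR (l * b j w * (1 - f' j w)) by rewrite /e; ring.
  by rewrite addr_ge0// mulr_ge0 ?expR_ge0// subr_ge0.
rewrite -(mean_indic P mC) -RintegralZl//; last exact: bmeas_integrable.
apply: le_Rintegral => //.
- apply: bmeas_integrable => //; apply: bmeasM; first exact: bmeas_cst.
  apply: bmeasM => //; apply: bmeasM; first exact: bmeas_prod.
  apply: bmeas_prod => j; apply: bmeasD; first exact: (sub_sigma_bmeas mG0 (bc j)).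
  by apply: bmeasM => //; exact: (sub_sigma_bmeas mG0 (be j)).
- by apply: bmeas_integrable => //; apply: (bmeasM (f := cst _)) => //; exact: bmeas_cst.
move=> w _; rewrite big_nil !mul1r mulrC ler_wpM2r//.
rewrite expRM_natr.
elim: (L) => [|j s IH]; first by rewrite big_nil expr0.
rewrite big_cons /= exprS; have /andP[m0 m1] := mgf j w.
apply: ler_pM => //; apply: prodr_ge0 => i _.
by have /andP[] := mgf i w.
Qed.

Lemma cond_independent_tail L (b : int -> gS -> R) (l t : R) :
  uniq L -> (forall j, j \in L -> valid j) -> (forall j, bmeas (b j)) ->
  (forall j w, 0 <= b j w <= 1) -> `|l| <= 1 / 2 ->
  fine (P (C `&` [set w | t <= l * \sum_(j <- L) b j w * (I j w - f' j w)])) <=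
    expR (2 * l ^+ 2 * (size L)%:R - t) * fine (P C).
Proof.
move=> uL vL bb bitv l2.
have bS : bmeas (fun w : T => l * \sum_(j <- L) b j w * (I j w - f' j w)).
  apply: (bmeasM (f := cst l)); first exact: bmeas_cst.
  apply: bmeas_sum => j; apply: bmeasM; first exact: (sub_sigma_bmeas mG0 (bb j)).
  rewrite (_ : (fun _ => _) = fun w => I j w + cst (-1) w * f' j w).
    by apply: bmeasD => //; apply: bmeasM => //; exact: bmeas_cst.
  by apply/funext => w; rewrite mulN1r.
set Sm := (fun w => l * _) in bS *.
have mt : measurable [set w | t <= Sm w].
  have [mS _] := bS.
  rewrite (_ : [set _ | _] = Sm @^-1` `[t, +oo[).
    by rewrite -[X in measurable X]setTI; exact: mS.
  by apply/seteqP; split=> w; rewrite /= in_itv/= andbT.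
rewrite expRD mulrAC.
apply: le_trans (ler_wpM2r (expR_ge0 _) (cond_independent_mgf uL vL bb bitv l2)).
rewrite -mean_indic; last exact: measurableI.
have be : bmeas (fun w => \1_C w * expR (Sm w)).
  by apply: bmeasM => //; exact: bmeas_expR.
rewrite -RintegralZr//; last exact: bmeas_integrable.
apply: le_Rintegral => //.
- by apply: bmeas_integrable => //; apply: bmeas_indic; exact: measurableI.
- by apply: bmeas_integrable => //; apply: bmeasM => //; exact: bmeas_cst.
move=> w _; rewrite !indicE in_setI; case: (w \in C) => /=.
  rewrite mul1r; have [/set_mem/= tS|_] := boolP (w \in _).
    by rewrite -expRD -[X in X <= _]expR0 ler_expR subr_ge0.
  by rewrite mulr_ge0 ?expR_ge0.
by rewrite !mul0r.
Qed.

(** The Chernoff bound for both signs of the parameter. *)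
Lemma cond_independent_deviation L (b : int -> gS -> R) (l a : R) :
  uniq L -> (forall j, j \in L -> valid j) -> (forall j, bmeas (b j)) ->
  (forall j w, 0 <= b j w <= 1) -> 0 < l -> l <= 1 / 2 ->
  measurable (C `&` [set w | a <= `|\sum_(j <- L) b j w * (I j w - f j w)|]) /\
  fine (P (C `&` [set w | a <= `|\sum_(j <- L) b j w * (I j w - f j w)|])) <=
    2 * expR (2 * l ^+ 2 * (size L)%:R - l * a) * fine (P C).
Proof.
move=> uL vL bb bitv l0 l2.
have sumE w : \sum_(j <- L) b j w * (I j w - f j w) =
    \sum_(j <- L) b j w * (I j w - f' j w).
  by apply: eq_big_seq => j jL; rewrite /f' vL.
set A := [set w | _].
have AE : A = [set w | l * a <= l * \sum_(j <- L) b j w * (I j w - f' j w)] `|`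
   [set w | l * a <= - l * \sum_(j <- L) b j w * (I j w - f' j w)].
  apply/seteqP; split=> w; rewrite /A /= sumE mulNr -mulrN !ler_pM2l// ler_normr.
    by move=> /orP.
  by move=> /orP.
have bS (m : R) : bmeas (fun w : T => m * \sum_(j <- L) b j w * (I j w - f' j w)).
  apply: (bmeasM (f := cst m)); first exact: bmeas_cst.
  apply: bmeas_sum => j; apply: bmeasM; first exact: (sub_sigma_bmeas mG0 (bb j)).
  rewrite (_ : (fun _ => _) = fun w => I j w + cst (-1) w * f' j w).
    by apply: bmeasD => //; apply: bmeasM => //; exact: bmeas_cst.
  by apply/funext => w; rewrite mulN1r.
have mt (m : R) : measurable
    [set w : T | l * a <= m * \sum_(j <- L) b j w * (I j w - f' j w)].
  have [mS _] := bS m.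
  rewrite (_ : [set _ | _] =
     (fun w => m * \sum_(j <- L) b j w * (I j w - f' j w)) @^-1` `[l * a, +oo[).
    by rewrite -[X in measurable X]setTI; exact: mS.
  by apply/seteqP; split=> w; rewrite /= in_itv/= andbT.
split; first by rewrite AE; apply: measurableI => //; exact: measurableU.
have l2' : `|l| <= 1 / 2 by rewrite gtr0_norm.
have lN2 : `|- l| <= 1 / 2 by rewrite normrN.
have t1 := cond_independent_tail (l * a) uL vL bb bitv l2'.
have t2 := cond_independent_tail (l * a) uL vL bb bitv lN2.
rewrite sqrrN in t2.
rewrite mulr2n mulrDl mul1r mulrDl; apply: le_trans (lerD t1 t2).
rewrite -fineD ?fin_num_measure//; try exact: measurableI.
apply: fine_le.
- by apply: fin_num_measure; rewrite AE; apply: measurableI => //; exact: measurableU.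
- by rewrite fin_numD !fin_num_measure//; exact: measurableI.
rewrite AE setIUr; apply: measureU2; exact: measurableI.
Qed.

End cond_independent_sums.

(** * Laws of large numbers for the service requirements *)

Section geometric.
Context {R : realType}.

Lemma nneseries_geometric_lty (a q : R) : 0 <= a -> 0 < q -> q < 1 ->
  (\sum_(n <oo) (a * q ^+ n)%:E < +oo)%E.
Proof.
move=> a0 q0 q1; apply: (@le_lt_trans _ _ (a * (1 - q)^-1)%:E); last exact: ltry.
apply: lime_le.
  by apply: is_cvg_nneseries => n _ _; rewrite lee_fin mulr_ge0// exprn_ge0// ltW.
apply: nearW => n; rewrite sumEFin lee_fin.
by have := @geometric_le_lim R n a q a0 q0; rewrite ger0_norm ?(ltW q0)//; apply.
Qed.

End geometric.

Section queue_sigma.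
Context {d : measure_display} {T : measurableType d} {R : realType}.
Implicit Types Q : T -> queue R.

Definition initial_events Q : set (set T) := [set A |
  [\/ exists t k, 0 <= t /\ A = [set w | arrivals (Q w) t = k],
      exists k, A = [set w | in_system0 (Q w) = k],
      exists k, A = [set w | in_service0 (Q w) = k] |
      exists (j : int) (B : set R), [/\ j <= 0, measurable B &
        A = [set w | - (in_service0 (Q w))%:Z < j /\ B (age0 (Q w) j)] ] ] ].

Lemma measurable_lt_label Q (j : int) : queue_measurable Q ->
  measurable [set w | - (in_service0 (Q w))%:Z < j].
Proof.
move=> mQ; rewrite (_ : [set _ | _] =
  \bigcup_(k in [set k : nat | - k%:Z < j]) [set w | in_service0 (Q w) = k]).
  by apply: bigcup_measurable => k _; exact: in_service0_meas.
apply/seteqP; split=> [w H|w [k kj /= wk]]; first by exists (in_service0 (Q w)).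
by rewrite wk.
Qed.

Lemma initial_events_measurable Q : queue_measurable Q ->
  initial_events Q `<=` measurable.
Proof.
move=> mQ A [[t [k [t0 ->]]]|[k ->]|[k ->]|[j [B [j0 mB ->]]]].
- exact: arrivals_meas.
- exact: in_system0_meas.
- exact: in_service0_meas.
- rewrite (_ : [set _ | _] = [set w | - (in_service0 (Q w))%:Z < j] `&`
    (fun w => age0 (Q w) j) @^-1` B)//.
  apply: measurableI; first exact: measurable_lt_label.
  by rewrite -[X in measurable X]setTI; apply: age0_meas.
Qed.

Lemma initial_sigma_in_service Q k :
  initial_sigma Q [set w | in_service0 (Q w) = k].
Proof. by apply: sub_gen_smallest; apply: Or43; exists k. Qed.

Lemma initial_sigma_age Q (j : int) (B : set R) : j <= 0 -> measurable B ->
  initial_sigma Q [set w | - (in_service0 (Q w))%:Z < j /\ B (age0 (Q w) j)].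
Proof. by move=> j0 mB; apply: sub_gen_smallest; apply: Or44; exists j, B. Qed.

End queue_sigma.

Section law_of_large_numbers.
Context {d : measure_display} {T : measurableType d} {R : realType}.
Variables (P : probability T R) (G : R -> R) (Q : nat -> T -> queue R).
Hypothesis hQ : forall N, (0 < N)%N -> many_server_queue P G N (Q N).
Hypothesis service0_le : {ae P, forall w, forall N, (0 < N)%N ->
  (in_service0 (Q N w) <= N)%N}.

Let C N k : set T := [set w | in_service0 (Q N w) = k].

(** The exponential bounds are summable over [N]; the lemma of Borel and Cantelli
    applies whatever the joint law of the systems is. The bounds hold on the
    events that fix the number of customers in service at time 0, over which they
    are added. *)
Lemma weighted_lln (B : set R) (J : nat -> nat -> seq int) (c : R)
    (b : nat -> int -> T -> R) (f : nat -> nat -> int -> T -> R) :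
  measurable B -> 0 < c ->
  (forall N k, uniq (J N k)) ->
  (forall N k j, j \in J N k -> - k%:Z < j) ->
  (forall N k, (k <= N)%N -> (size (J N k))%:R <= c * N%:R) ->
  (forall N j, (0 < N)%N -> measurable_wrt (initial_sigma (Q N)) (b N j)) ->
  (forall N j w, 0 <= b N j w <= 1) ->
  (forall N k j w, 0 <= f N k j w <= 1) ->
  (forall N k j, (0 < N)%N -> j \in J N k ->
    is_cond_prob P (initial_sigma (Q N))
      (C N k `&` (fun w => requirement (Q N w) j) @^-1` B) (f N k j)) ->
  {ae P, forall w, (N%:R^-1 * \sum_(j <- J N (in_service0 (Q N w)))
    b N j w * (\1_B (requirement (Q N w) j) - f N (in_service0 (Q N w)) j w))
    @[N --> \oo] --> (0 : R)}.
Proof.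
move=> mB c0 uJ vJ sJ mb bitv fitv cf.
pose D N k w := \sum_(j <- J N k)
  b N j w * (\1_((fun w => requirement (Q N w) j) @^-1` B) w - f N k j w).
have DE N k w : D N k w = \sum_(j <- J N k)
    b N j w * (\1_B (requirement (Q N w) j) - f N k j w).
  by apply: eq_bigr => j _; rewrite !indicE.
suff H (m : nat) : {ae P, forall w, \forall N \near \oo,
    `|D N (in_service0 (Q N w)) w| <= m.+1%:R^-1 * N%:R}.
  have := ae_foralln H; apply: filterS => w {}H.
  apply/cvgrPdist_lt => e e0; near=> N; rewrite sub0r normrN -DE.
  have N0 : 0 < N%:R :> R by rewrite ltr0n; near: N; exact: nbhs_infty_gt.
  rewrite normrM gtr0_norm ?invr_gt0// mulrC ltr_pdivrMr//.
  apply: (@le_lt_trans _ _ ((Num.truncn e^-1).+1%:R^-1 * N%:R)).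
    by near: N; exact: H.
  by rewrite ltr_pM2r// invf_plt ?posrE// truncnS_gt.
pose eps : R := m.+1%:R^-1.
have eps0 : 0 < eps by rewrite invr_gt0.
(* With this [l], the exponent [2 l^2 c N - l eps N] is at most
   [- l eps N / 2]. *)
pose l := Num.min (1 / 2) (eps / (4 * c)).
have l0 : 0 < l by rewrite lt_min divr_gt0//= divr_gt0// mulr_gt0.
have l2 : l <= 1 / 2 by rewrite ge_min lexx.
have lc : 4 * c * l <= eps.
  by rewrite mulrC -ler_pdivlMr ?mulr_gt0// ge_min lexx orbT.
pose bad N k := C N k `&` [set w | eps * N%:R <= `|D N k w|].
pose F n := \big[setU/set0]_(k < n.+2) bad n.+1 k.
pose q := expR (- (l * eps / 2)).
have badP n k : (k < n.+2)%N -> measurable (bad n.+1 k) /\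
    fine (P (bad n.+1 k)) <= 2 * q ^+ n.+1 * fine (P (C n.+1 k)).
  move=> kn; have [mQ _ [ri _ _] _] := hQ (ltn0Sn n).
  have mG0 := initial_events_measurable mQ.
  have bS j : bmeas (b n.+1 j : g_sigma_algebraType (initial_events (Q n.+1)) -> R).
    split; last by exists 1 => w; have /andP[b0 b1] := bitv n.+1 j w; rewrite ger0_norm.
    by apply/measurable_wrtP; exact: mb.
  have [] := @cond_independent_deviation _ _ _ P _ mG0 (C n.+1 k)
    (fun j => j \in J n.+1 k) (fun j w => requirement (Q n.+1 w) j) (fun=> B)
    (f n.+1 k) (@initial_sigma_in_service _ _ _ (Q n.+1) k) (fun=> mB)
    (requirement_meas mQ) _ (fitv n.+1 k) (fun j => @cf n.+1 k j (ltn0Sn n))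
    (J n.+1 k) (b n.+1) l (eps * n.+1%:R) (uJ _ _) (fun _ jJ => jJ) bS (bitv n.+1) l0 l2.
    by move=> L uL vL; apply: ri => // j /vL/vJ.
  move=> mbad Pbad; split=> //; apply: le_trans Pbad _.
  rewrite ler_wpM2r ?fine_ge0 ?measure_ge0// ler_pM2l// /q -expRM_natr ler_expR.
  have sz : (size (J n.+1 k))%:R <= c * n.+1%:R by apply: sJ; rewrite -ltnS.
  have l20 : 0 <= 2 * l ^+ 2 by rewrite pmulr_rge0 ?sqr_ge0.
  have h1 := ler_wpM2l l20 sz.
  apply: le_trans (lerB h1 (lexx _)) _.
  have -> : 2 * l ^+ 2 * (c * n.+1%:R) - l * (eps * n.+1%:R) =
    (l * (4 * c * l) / 2 - l * eps) * n.+1%:R by field.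
  rewrite -mulNr ler_wpM2r//.
  have := ler_wpM2l (ltW l0) lc; lra.
have mF n : measurable (F n).
  by apply: bigsetU_measurable => k _; have [] := badP n k (ltn_ord k).
have q0 : 0 < q by exact: expR_gt0.
have q1 : q < 1.
  by rewrite -[X in _ < X]expR0 ltr_expR oppr_lt0 divr_gt0// mulr_gt0.
have PF n : (P (F n) <= (2 * q * q ^+ n)%:E)%E.
  apply: le_trans (Boole_inequality _ _) _.
    by move=> k kn; have [] := badP n k kn.
  have mCk k : measurable (C n.+1 k).
    by have [mQ _ _ _] := hQ (ltn0Sn n); exact: in_service0_meas.
  apply: (@le_trans _ _ (\sum_(k < n.+2) (2 * q ^+ n.+1)%:E * P (C n.+1 k))%E).
    apply: lee_sum => k _; have [mbad Pbad] := badP n k (ltn_ord k).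
    by rewrite -(fineK (fin_num_measure P _ mbad))
      -(fineK (fin_num_measure P _ (mCk k))) -EFinM lee_fin.
  rewrite -ge0_sume_distrr//.
  rewrite -mulrA -exprS -[leRHS]mule1 lee_wpmul2l//.
    by rewrite lee_fin mulr_ge0// exprn_ge0// ltW.
  rewrite -measure_bigsetU_ord//.
    apply: probability_le1; apply: bigsetU_measurable => k _; exact: mCk.
  move=> i j _ _ [w [wi wj]]; apply: val_inj.
  by move: wi wj; rewrite /C /= => <- <-.
have sumF : (\sum_(n <oo) P (F n) < +oo)%E.
  apply: le_lt_trans (nneseries_geometric_lty _ q0 q1).
    apply: lee_nneseries => [n _ _|n _]; [exact: measure_ge0|exact: PF].
  by rewrite mulr_ge0// ltW.
have limF := lim_sup_set_cvg0 mF sumF.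
have aeF : {ae P, forall w, ~ lim_sup_set F w}.
  exists (lim_sup_set F); split=> //.
    by apply: bigcap_measurable => // n _; apply: bigcup_measurable.
  by move=> w /= /contrapT.
apply: filterS2 service0_le aeF => w n0N nF.
have [n Hn] : exists n, forall i, (n <= i)%N -> ~ F i w.
  apply: contrapT => h; apply: nF => n _; apply: contrapT => h2.
  by apply: h; exists n => i ni Fi; apply: h2; exists i.
exists n.+1 => // -[|N] //= nN.
rewrite leNgt; apply/negP => bad1; apply: (Hn N nN).
have kN : (in_service0 (Q N.+1 w) < N.+2)%N by rewrite ltnS n0N.
rewrite /F -bigcup_mkord; exists (in_service0 (Q N.+1 w)) => //.
by split=> //=; exact: ltW.
Unshelve. all: by end_near. Qed.

End law_of_large_numbers.

Section customers.
Context {d : measure_display} {T : measurableType d} {R : realType}.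
Variables (P : probability T R) (g G : R -> R) (Q : nat -> T -> queue R).
Hypothesis hG : service_distribution g G.
Hypothesis hQ : forall N, (0 < N)%N -> many_server_queue P G N (Q N).
Hypothesis service0_le : {ae P, forall w, forall N, (0 < N)%N ->
  (in_service0 (Q N w) <= N)%N}.

Definition count_new (q : queue R) (y : R) (n : nat) : nat :=
  (\sum_(i < n) (requirement q i.+1%:Z <= y)%R)%N.

Lemma cvg_divn (i m : nat) :
  ((i * N) %/ m.+1)%:R / N%:R @[N --> \oo] --> (i%:R / m.+1%:R : R).
Proof.
apply/cvgrPdist_lt => e e0; near=> N.
have N0 : 0 < N%:R :> R by rewrite ltr0n; near: N; exact: nbhs_infty_gt.
have Ne : N%:R^-1 < e.
  rewrite invf_plt ?posrE//; near: N; exact: nbhs_infty_gtr.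
set n := (_ %/ _)%N.
have h1 : n%:R * m.+1%:R <= i%:R * N%:R :> R.
  by rewrite -!natrM ler_nat leq_divM.
have h2 : i%:R * N%:R < (n%:R + 1) * m.+1%:R :> R.
  by rewrite natr1 -!natrM ltr_nat -ltn_divLR.
rewrite ltr_distlC; apply/andP; split.
  rewrite ltrBlDr; apply: (@lt_trans _ _ (n%:R / N%:R + N%:R^-1)); last first.
    by rewrite ltrD2l.
  rewrite -{2}[N%:R^-1]mul1r -mulrDl ltr_pdivlMr// mulrAC ltr_pdivrMr//.
apply: (@le_lt_trans _ _ (i%:R / m.+1%:R)); last by rewrite ltrDl.
by rewrite ler_pdivrMr// mulrAC ler_pdivlMr.
Unshelve. all: by end_near. Qed.

Lemma new_customers_lln : {ae P, forall w, forall (i m k l : nat),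
  (count_new (Q N w) (k%:R / l.+1%:R) ((i * N) %/ m.+1))%:R / N%:R @[N --> \oo]
    --> i%:R / m.+1%:R * G (k%:R / l.+1%:R)}.
Proof.
apply: ae_foralln => i; apply: ae_foralln => m; apply: ae_foralln => k.
apply: ae_foralln => l; set y : R := k%:R / l.+1%:R.
pose n N := ((i * N) %/ m.+1)%N.
pose J (N _ : nat) := [seq i.+1%:Z | i <- iota 0 (n N)].
have Gy : 0 <= G y <= 1 by rewrite (cdf_ge0 hG) (cdf_le1 hG).
have := @weighted_lln _ _ _ P G Q hQ service0_le `]-oo, y]%classic J
  (i%:R + 1) (fun _ _ => cst 1) (fun N k _ w => \1_[set w | in_service0 (Q N w) = k] w * G y).
have mB : measurable (`]-oo, y]%classic : set R) by [].
have c0 : 0 < i%:R + 1 :> R by rewrite ltr_wpDl.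
have uJ N j : uniq (J N j).
  by rewrite map_inj_uniq ?iota_uniq// => a b [].
have vJ N j (x : int) : x \in J N j -> - j%:Z < x.
  move=> /mapP[a _ ->]; exact: (@le_lt_trans _ _ 0).
have sJ N j : (j <= N)%N -> (size (J N j))%:R <= (i%:R + 1) * N%:R :> R.
  move=> _; rewrite size_map size_iota.
  apply: (@le_trans _ _ (i * N)%:R); first by rewrite ler_nat leq_div.
  by rewrite natrM ler_wpM2r// lerDl.
have mb N (j : int) : (0 < N)%N ->
    measurable_wrt (initial_sigma (Q N)) (cst 1 : T -> R).
  by move=> _; apply/measurable_wrtP; exact: measurable_cst.
have bitv (N : nat) (j : int) (w : T) : 0 <= (cst 1 w : R) <= 1.
  by rewrite /cst ler01 lexx.
have fitv (N k0 : nat) (j : int) (w : T) :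
    0 <= \1_[set w | in_service0 (Q N w) = k0] w * G y <= 1.
  by rewrite indicE; case: (w \in _); rewrite ?mul1r ?mul0r ?lexx ?ler01.
move=> /(_ mB c0 uJ vJ sJ mb bitv fitv) H.
have cf N k0 j : (0 < N)%N -> j \in J N k0 ->
    is_cond_prob P (initial_sigma (Q N))
    ([set w | in_service0 (Q N w) = k0] `&`
     (fun w => requirement (Q N w) j) @^-1` `]-oo, y])
    (fun w => \1_[set w | in_service0 (Q N w) = k0] w * G y).
  move=> N0 /mapP[a _ ->]; have [mQ _ [_ rn _] _] := hQ N0.
  have mG0 := initial_events_measurable mQ.
  have -> : (fun w => requirement (Q N w) a.+1%:Z) @^-1` `]-oo, y] =
      [set w | requirement (Q N w) a.+1%:Z <= y].
    by apply/seteqP; split=> w; rewrite /= in_itv.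
  exact: (@cond_prob_restrict _ _ _ P (initial_events (Q N)) _ _ _
    (@initial_sigma_in_service _ _ _ (Q N) k0) (rn a.+1%:Z y isT)).
have {H cf} := H cf; apply: filterS => w Hw.
have {Hw} Hw : N%:R^-1 * ((count_new (Q N w) y (n N))%:R - (n N)%:R * G y)
    @[N --> \oo] --> (0 : R).
  apply: cvg_trans Hw; apply: near_eq_cvg; near=> N; congr (_ * _).
  rewrite big_map -[n N]subn0 -/(index_iota _ _) big_mkord /count_new subn0.
  rewrite natr_sum mulr_natl -[X in _ *+ X]card_ord -sumr_const -sumrB.
  apply: eq_bigr => a _; rewrite mul1r !indicE.
  rewrite [X in _ - (nat_of_bool X)%:R * _](_ : _ = true); last exact/mem_set.
  rewrite mul1r; congr (_ - _); congr ((_ : bool)%:R).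
  by apply/idP/idP => [/set_mem|h]; rewrite /= ?in_itv//; apply/mem_set; rewrite /= in_itv.
have h2 : ((i * N) %/ m.+1)%:R / N%:R * G y @[N --> \oo] -->
    i%:R / m.+1%:R * G y.
  by apply: cvgM; [exact: cvg_divn|exact: cvg_cst].
have h3 : N%:R^-1 * ((count_new (Q N w) y (n N))%:R - (n N)%:R * G y) +
    ((i * N) %/ m.+1)%:R / N%:R * G y @[N --> \oo] --> i%:R / m.+1%:R * G y.
  by rewrite -[X in _ --> X]add0r; exact: cvgD.
apply: cvg_trans h3; apply: near_eq_cvg; near=> N; rewrite /n /=; ring.
Unshelve. all: by end_near. Qed.
End customers.

(** * Survival of the customers in service *)

Section pairing.
Context {R : realType}.
Variables g G : R -> R.
Hypothesis hG : service_distribution g G.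
Implicit Types (xi : {measure set R -> \bar R}) (f : R -> R).

Let mages : measurable (ages G). Proof. exact: measurable_ages hG. Qed.

Lemma within_ages_measurable f : {within ages G, continuous f} ->
  measurable_fun (ages G) f.
Proof. exact: subspace_continuous_measurable_fun. Qed.

Section bounded.
Variables (xi : {measure set R -> \bar R}) (C : R).
Hypothesis sub : sub_probability G xi.

Lemma pairing_integrable f : measurable_fun (ages G) f ->
  (forall x, ages G x -> `|f x| <= C) -> xi.-integrable (ages G) (EFin \o f).
Proof.
move=> mf fC; apply: measurable_bounded_integrable => //.
  by case: sub => _ /le_lt_trans; apply; exact: ltry.
by exists C; split; [exact: num_real|move=> x Cx y /fC /le_trans; apply; exact: ltW].
Qed.

Lemma pairing_cvg (f_ : nat -> R -> R) f :
  (forall n, measurable_fun (ages G) (f_ n)) -> measurable_fun (ages G) f ->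
  (forall n x, ages G x -> `|f_ n x| <= C) ->
  (forall x, ages G x -> f_ n x @[n --> \oo] --> f x) ->
  pairing G (f_ n) xi @[n --> \oo] --> pairing G f xi.
Proof.
move=> mf_ mf f_C f_f.
have [|||||iff _ cv] := @dominated_convergence _ _ R xi (ages G) mages
  (fun n x => (f_ n x)%:E) (EFin \o f) (cst C%:E).
- by move=> n; exact/measurable_EFinP.
- exact/measurable_EFinP.
- by apply: aeW => x agx; apply: cvg_EFin; [exact: nearW|exact: f_f].
- apply: (pairing_integrable (f := cst C)) => // x agx; rewrite ger0_norm//.
  exact: le_trans (normr_ge0 _) (f_C 0%N x agx).
- by apply: aeW => x n agx; rewrite lee_fin f_C.
have /fine_cvgP[] : (\int[xi]_(x in ages G) (f_ n x)%:E)%E @[n --> \oo] -->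
    (fine (\int[xi]_(x in ages G) (f x)%:E)%E)%:E.
  by rewrite fineK//; exact: integrable_fin_num.
by [].
Qed.

End bounded.

Lemma pairing_dirac_sum f (N n : nat) (a : nat -> R) :
  measurable_fun (ages G) f -> (forall x, ages G x -> 0 <= f x) ->
  (forall i, (i < n)%N -> ages G (a i)) ->
  pairing G f (mscale (N%:R^-1)%:nng
     (msum (fun i => \d_(a i) : {measure set R -> \bar R}) n)) =
  N%:R^-1 * \sum_(i < n) f (a i).
Proof.
move=> mf f0 ai.
have mfE : measurable_fun (ages G) (fun x => (f x)%:E) by exact/measurable_EFinP.
have f0E x : ages G x -> (0 <= (f x)%:E)%E by move=> agx; rewrite lee_fin f0.
rewrite /pairing /Rintegral ge0_integral_mscale// ge0_integral_measure_sum//.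
rewrite (eq_bigr (fun i : 'I_n => (f (a i))%:E)).
  by rewrite sumEFin -EFinM.
move=> i _; rewrite integral_dirac//.
by rewrite diracE mem_set ?mul1e//; exact: ai.
Qed.

(** The probability that a customer of age [x] stays in service for another
    [u] units of time. *)
Definition survival (u x : R) := (1 - G (x + u)) / (1 - G x).

Definition mean_survival (u : R) xi := pairing G (survival u) xi.

Lemma survival_itv u x : 0 <= u -> ages G x -> 0 <= survival u x <= 1.
Proof.
move=> u0 /(agesP hG)[x0 Gx]; rewrite /survival.
have G1 : 0 < 1 - G x by rewrite subr_gt0.
rewrite divr_ge0 ?subr_ge0 ?(cdf_le1 hG)// ?(ltW Gx)//=.
by rewrite ler_pdivrMr// mul1r lerD2l lerN2 (cdf_nd hG)// lerDl.
Qed.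

Lemma survival_norm u x : 0 <= u -> ages G x -> `|survival u x| <= 1.
Proof. by move=> u0 /(survival_itv u0)/andP[s0 s1]; rewrite ger0_norm. Qed.

Lemma survival_continuous u : {within ages G, continuous (survival u)}.
Proof.
apply/subspace_continuousP => x /(agesP hG)[x0 Gx].
apply: cvg_within_filter; rewrite /survival.
apply: cvgM.
  apply: cvgB; first exact: cvg_cst.
  apply: (@cvg_comp _ _ _ (fun y => y + u) G _ (nbhs (x + u))).
    by apply: cvgD; [exact: cvg_id|exact: cvg_cst].
  exact: (cdf_continuous hG).
apply: cvgV; first by rewrite gt_eqF// subr_gt0.
by apply: cvgB; [exact: cvg_cst|exact: (cdf_continuous hG)].
Qed.

Lemma measurable_survival u : measurable_fun (ages G) (survival u).
Proof. by apply: within_ages_measurable; exact: survival_continuous. Qed.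

(** The ages where [1 - G] is small carry little mass, as they decrease to the
    empty set; on the other ages the quotient is uniformly continuous. *)
Lemma mean_survival_uc xi e : sub_probability G xi -> 0 < e ->
  exists2 d, 0 < d & forall u v, 0 <= u -> 0 <= v -> `|u - v| < d ->
    `|mean_survival u xi - mean_survival v xi| <= e.
Proof.
move=> sub e0; have e20 : 0 < e / 2 by rewrite divr_gt0.
pose thin n : set R := [set x | 1 - G x < n.+1%:R^-1].
have mthin n : measurable (thin n).
  rewrite (_ : thin n = G @^-1` `]1 - n.+1%:R^-1, +oo[).
    rewrite -[X in measurable X]setTI.
    by apply: continuous_measurable_fun => //; exact: (cdf_continuous hG).
  by apply/seteqP; split=> x; rewrite /thin /= in_itv/= andbT ltrBlDr ltrBlDr addrC.
have : pairing G \1_(thin n) xi @[n --> \oo] --> pairing G (cst 0) xi.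
  apply: (@pairing_cvg xi 1 sub) => //.
  - by move=> n x _; rewrite indicE; case: (_ \in _); rewrite ?normr1 ?normr0.
  - move=> x /(agesP hG)[x0 Gx].
    have G1 : 0 < 1 - G x by rewrite subr_gt0.
    apply: cvg_near_cst; near=> n.
    rewrite indicE memNset//= /thin /=; apply/negP; rewrite -leNgt.
    apply/ltW; near: n; exact: (near_infty_natSinv_lt (PosNum G1)).
rewrite /pairing [X in _ --> X](_ : _ = 0); last by rewrite Rintegral_cst// mul0r.
move=> /cvgrPdist_lt/(_ _ e20) cv; have [n] := filter_ex cv.
rewrite sub0r normrN => Hn.
have e2n0 : 0 < e / 2 / n.+1%:R by rewrite divr_gt0.
have [d d0 Hd] := cdf_uniformly_continuous hG e2n0.
exists d => // u v u0 v0 uv; rewrite /mean_survival /pairing.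
have iu : xi.-integrable (ages G) (EFin \o survival u).
  apply: (@pairing_integrable xi 1 sub); first exact: measurable_survival.
  by move=> x; exact: survival_norm.
have iv : xi.-integrable (ages G) (EFin \o survival v).
  apply: (@pairing_integrable xi 1 sub); first exact: measurable_survival.
  by move=> x; exact: survival_norm.
have it : xi.-integrable (ages G) (EFin \o \1_(thin n)).
  apply: (@pairing_integrable xi 1 sub).
    by apply: (measurable_funS (E := setT)) => //; exact: measurable_indic.
  by move=> x _; rewrite indicE; case: (_ \in _); rewrite ?normr1 ?normr0.
have ic : xi.-integrable (ages G) (EFin \o cst (e / 2)).
  apply: (@pairing_integrable xi (e / 2) sub) => // x _.
  by rewrite /cst gtr0_norm.
rewrite -RintegralB//.
have iuv : xi.-integrable (ages G) (EFin \o (fun x => survival u x - survival v x)).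
  by have := integrableB mages iu iv; exact: eq_integrable.
apply: le_trans (le_normr_Rintegral mages iuv) _.
apply: (@le_trans _ _ (\int[xi]_(x in ages G) (\1_(thin n) x + cst (e / 2) x))).
  apply: le_Rintegral => //.
  - exact: integrable_norm.
  - by have := integrableD mages it ic; exact: eq_integrable.
  move=> x agx; have [x0 Gx] := (agesP hG x).1 agx.
  have G1 : 0 < 1 - G x by rewrite subr_gt0.
  rewrite indicE; have [_|] := boolP (x \in thin n).
    apply: (@le_trans _ _ 1); last by rewrite lerDl ltW.
    have /andP[a0 a1] := survival_itv u0 agx.
    have /andP[b0 b1] := survival_itv v0 agx.
    by rewrite ler_norml; lra.
  rewrite notin_setE /thin /= => /negP; rewrite -leNgt => nG.
  rewrite add0r /survival -mulrBl normrM [X in _ * X]gtr0_norm ?invr_gt0//.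
  rewrite ler_pdivrMr//; apply: (@le_trans _ _ (e / 2 / n.+1%:R)); last first.
    by rewrite ler_wpM2l// ltW.
  have := Hd (x + v) (x + u); rewrite opprD addrACA subrr add0r distrC => /(_ uv).
  move=> /ltW; apply: le_trans.
  by rewrite (_ : 1 - G (x + u) - (1 - G (x + v)) = G (x + v) - G (x + u))//; ring.
rewrite RintegralD// Rintegral_cst//.
have mu1 : fine (xi (ages G)) <= 1.
  have [_ le1] := sub; rewrite -lee_fin fineK//.
  by rewrite ge0_fin_numE// (le_lt_trans le1)// ltry.
have := ltW (ltr_normlW Hn); rewrite /pairing => h1.
have := ler_wpM2l (ltW e20) mu1; rewrite mulr1 => h2.
by rewrite [leRHS](splitr e); exact: lerD.
Unshelve. all: by end_near. Qed.

End pairing.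

(** * Law of large numbers for the initial customers *)

Section age_blocks.
Context {R : realType}.

Definition age_block (k l : nat) : set R :=
  `[k%:R / l.+1%:R, k.+1%:R / l.+1%:R[%classic.

Lemma age_block_truncn l (x : R) : 0 <= x ->
  age_block (Num.truncn (x * l.+1%:R)) l x.
Proof.
move=> x0; have xl : 0 <= x * l.+1%:R by rewrite mulr_ge0.
have /andP[h1 h2] := truncn_itv xl.
by rewrite /age_block /= in_itv/= ler_pdivrMr// h1 ltr_pdivlMr.
Qed.

Lemma age_block_inj k l (x : R) : 0 <= x -> age_block k l x ->
  k = Num.truncn (x * l.+1%:R).
Proof.
move=> x0; rewrite /age_block /= in_itv/= => /andP[h1 h2]; apply/eqP.
by rewrite eq_sym truncn_eq ?mulr_ge0// -ler_pdivrMr// h1/= -ltr_pdivlMr.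
Qed.

Lemma age_block_sum (l L : nat) (c : nat -> R) (x : R) : 0 <= x ->
  \sum_(k < l.+1 * L) \1_(age_block k l) x * c k =
    if x < L%:R then c (Num.truncn (x * l.+1%:R)) else 0.
Proof.
move=> x0; set t := Num.truncn _.
have tL : (t < l.+1 * L)%N = (x < L%:R).
  by rewrite truncn_lt_nat ?mulr_ge0// mulnC natrM ltr_pM2r.
case: ifPn => [xL|]; last first.
  rewrite -tL -leqNgt => Lt; rewrite big1// => k _.
  rewrite indicE memNset ?mul0r// => /(age_block_inj x0) kt.
  by have := ltn_ord k; rewrite ltnNge kt Lt.
rewrite -tL in xL; rewrite (bigD1 (Ordinal xL))//= indicE mem_set ?mul1r; last first.
  exact: age_block_truncn.
rewrite big1 ?addr0// => k kt; rewrite indicE memNset ?mul0r// => /(age_block_inj x0) ke.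
by move: kt; rewrite -val_eqE /= ke eqxx.
Qed.

Variables (g G : R -> R).
Hypothesis hG : service_distribution g G.

(** Here [F k b l N r] stands for the conditional probability that [v N r] exceeds
    [(k + b) / l.+1 + u]. For an age [a] in the block [k], the event [a + u < v] lies
    between those for [b = true] and [b = false], and these probabilities lie
    between the survival probabilities for [u + 1 / l.+1] and [u - 1 / l.+1]. The
    mesh tends to [0] by [mean_survival_uc], and the function [phi] bounds the
    number of the ages beyond the last block. *)
Lemma remaining_limit (nu : {measure set R -> \bar R}) (n : nat -> nat)
    (a v : nat -> nat -> R) (F : nat -> bool -> nat -> nat -> nat -> R) (u : R) :
  sub_probability G nu -> 0 <= u ->
  (forall N r, (0 < N)%N -> (r < n N)%N -> ages G (a N r) /\ a N r < v N r) ->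
  (forall f : R -> R, {within ages G, continuous f} ->
    (exists C, forall x, ages G x -> `|f x| <= C) ->
    (forall x, ages G x -> 0 <= f x) ->
    N%:R^-1 * \sum_(r < n N) f (a N r) @[N --> \oo] --> pairing G f nu) ->
  (forall k (b : bool) l, N%:R^-1 * \sum_(r < n N) \1_(age_block k l) (a N r) *
    (((k + b)%:R / l.+1%:R + u < v N r)%R%:R - F k b l N r) @[N --> \oo] --> (0 : R)) ->
  (forall k l N r, (0 < N)%N -> (r < n N)%N -> age_block k l (a N r) ->
    survival G (u + l.+1%:R^-1) (a N r) <= F k true l N r) ->
  (forall k l N r, (0 < N)%N -> (r < n N)%N -> age_block k l (a N r) ->
    l.+1%:R^-1 <= u -> F k false l N r <= survival G (u - l.+1%:R^-1) (a N r)) ->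
  N%:R^-1 * \sum_(r < n N) (a N r + u < v N r)%R%:R @[N --> \oo] -->
    mean_survival G u nu.
Proof.
move=> sub u_ge0 Hav weak lln ge le.
have weak_survival t : 0 <= t ->
    N%:R^-1 * \sum_(r < n N) survival G t (a N r) @[N --> \oo] -->
    mean_survival G t nu.
  move=> t0; apply: weak; first exact: (survival_continuous hG).
    by exists 1 => x; exact: (survival_norm hG).
  by move=> x /(survival_itv hG t0)/andP[].
have [u0|u0] := eqVneq u 0.
  rewrite u0; apply: cvg_trans (weak_survival 0 (lexx 0)).
  apply: near_eq_cvg; near=> N; congr (_ * _); apply: eq_bigr => r _.
  have N0 : (0 < N)%N by near: N; exact: nbhs_infty_gt.
  have [/(agesP hG)[_ Ga] av] := Hav N r N0 (ltn_ord r).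
  by rewrite addr0 av /survival addr0 divff// gt_eqF// subr_gt0.
have {u0} u_gt0 : 0 < u by rewrite lt_neqAle eq_sym u0.
apply/cvgrPdist_le => e e0; pose e1 := e / 6.
have e10 : 0 < e1 by rewrite divr_gt0.
pose phi (L : nat) (x : R) := Num.min 1 (Num.max 0 (x - L%:R)).
have phi_itv L x : 0 <= phi L x <= 1.
  by rewrite /phi le_min ler01 le_max lexx/= ge_min lexx.
have phi_c L : {within ages G, continuous (phi L)}.
  apply: continuous_subspaceT => x.
  have cx : (fun y : R => y - L%:R) @ x --> x - L%:R.
    by apply: cvgB; [exact: cvg_id|exact: cvg_cst].
  have c0 : (fun=> 0 : R) @ x --> (0 : R) by exact: cvg_cst.
  have c1 : (fun=> 1 : R) @ x --> (1 : R) by exact: cvg_cst.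
  have h0 := @continuous_max R R (cst 0) (fun y => y - L%:R) x c0 cx.
  exact: (@continuous_min R R (cst 1) _ x c1 h0).
have phi_norm L x : `|phi L x| <= 1 by have /andP[p0 p1] := phi_itv L x; rewrite ger0_norm.
have : pairing G (phi L) nu @[L --> \oo] --> pairing G (cst 0) nu.
  apply: (pairing_cvg hG sub) => //.
  - by move=> L; apply: (within_ages_measurable hG); exact: phi_c.
  - by move=> x _; apply: cvg_near_cst; near=> L;
      rewrite /phi (max_idPl _) ?(min_idPr _)// subr_le0; near: L; exact: nbhs_infty_ger.
rewrite {2}/pairing [X in _ --> X](_ : _ = 0); last first.
  by rewrite Rintegral_cst ?mul0r//; exact: measurable_ages hG.
move=> /cvgrPdist_lt/(_ _ e10) cvL; have [L] := filter_ex cvL.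
rewrite sub0r normrN => /ltr_normlW phiL.
have [d d0 Hd] := mean_survival_uc hG sub e10.
pose l := Num.truncn (Num.max d^-1 u^-1).
pose dl : R := l.+1%:R^-1.
have lM : Num.max d^-1 u^-1 < l.+1%:R by exact: truncnS_gt.
have dl0 : 0 < dl by rewrite invr_gt0.
have dld : dl < d.
  by rewrite /dl invf_plt ?posrE//; apply: le_lt_trans lM; rewrite le_max lexx.
have dlu : dl <= u.
  rewrite /dl invf_ple ?posrE//; apply/ltW; apply: le_lt_trans lM.
  by rewrite le_max lexx orbT.
have ud0 : 0 <= u - dl by rewrite subr_ge0.
have S1 : `|mean_survival G u nu - mean_survival G (u + dl) nu| <= e1.
  apply: Hd => //; first by rewrite addr_ge0// ltW.
  by rewrite opprD addrA subrr sub0r normrN gtr0_norm.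
have S2 : `|mean_survival G u nu - mean_survival G (u - dl) nu| <= e1.
  by apply: Hd => //; rewrite opprB addrC subrK gtr0_norm.
pose nb := (l.+1 * L.+1)%N.
pose Z (b : bool) N : R := N%:R^-1 * \sum_(r < n N) \sum_(k < nb) \1_(age_block k l) (a N r) *
    (((k + b)%:R / l.+1%:R + u < v N r)%R%:R - F k b l N r).
have Z0 (b : bool) : Z b N @[N --> \oo] --> (0 : R).
  have : \sum_(k < nb) (N%:R^-1 * \sum_(r < n N) \1_(age_block k l) (a N r) *
    (((k + b)%:R / l.+1%:R + u < v N r)%R%:R - F k b l N r)) @[N --> \oo] -->
    \sum_(k < nb) (0 : R).
    by apply: cvg_big => //; exact: add_continuous.
  rewrite big1//; apply: cvg_trans; apply: near_eq_cvg; near=> N.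
  by rewrite /Z exchange_big/= mulr_sumr.
have cphi : N%:R^-1 * \sum_(r < n N) phi L (a N r) @[N --> \oo] --> pairing G (phi L) nu.
  apply: weak; first exact: phi_c.
    by exists 1 => x _; exact: phi_norm.
  by move=> x _; have /andP[] := phi_itv L x.
have ud1 : 0 <= u + dl by rewrite addr_ge0// ltW.
have /cvgrPdist_le/(_ _ e10) near_true := Z0 true.
have /cvgrPdist_le/(_ _ e10) near_false := Z0 false.
have /cvgrPdist_le/(_ _ e10) near_plus := weak_survival _ ud1.
have /cvgrPdist_le/(_ _ e10) near_minus := weak_survival _ ud0.
have /cvgrPdist_le/(_ _ e10) near_phi := cphi.
near=> N.
have N0 : (0 < N)%N by near: N; exact: nbhs_infty_gt.
have NV0 : 0 <= N%:R^-1 :> R by rewrite invr_ge0.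
have zt : `|0 - Z true N| <= e1.
  by near: N; exact: near_true.
have zf : `|0 - Z false N| <= e1.
  by near: N; exact: near_false.
have sp : `|mean_survival G (u + dl) nu -
    N%:R^-1 * \sum_(r < n N) survival G (u + dl) (a N r)| <= e1.
  by near: N; exact: near_plus.
have sm : `|mean_survival G (u - dl) nu -
    N%:R^-1 * \sum_(r < n N) survival G (u - dl) (a N r)| <= e1.
  by near: N; exact: near_minus.
have ph : `|pairing G (phi L) nu - N%:R^-1 * \sum_(r < n N) phi L (a N r)| <= e1.
  by near: N; exact: near_phi.
have phi1 x : L.+1%:R <= x -> phi L x = 1.
  move=> Lx; apply/min_idPl; rewrite le_max; apply/orP; right.
  by rewrite lerBrDr addrC natr1.
set s := N%:R^-1 * _.
have lower : Z true N + N%:R^-1 * (\sum_(r < n N) survival G (u + dl) (a N r)) -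
    N%:R^-1 * (\sum_(r < n N) phi L (a N r)) <= s.
  rewrite /Z /s -mulrDr -mulrBr ler_wpM2l// -big_split -sumrB/=.
  apply: ler_sum => r _; have [agr av] := Hav N r N0 (ltn_ord r).
  have [ar0 _] := (agesP hG _).1 agr.
  have /andP[p0 p1] := phi_itv L (a N r).
  have /andP[s0 s1] := survival_itv hG ud1 agr.
  rewrite (age_block_sum l L.+1 (fun k => ((k + true)%:R / l.+1%:R + u < v N r)%R%:R -
    F k true l N r) ar0).
  case: ltP => [aL|/phi1 ->]; last by rewrite add0r (@le_trans _ _ 0)// subr_le0.
  set t := Num.truncn _; have bt := age_block_truncn l ar0.
  have := ge _ _ _ _ N0 (ltn_ord r) bt; rewrite -/t -/dl => geF.
  have : ((t + true)%:R / l.+1%:R + u < v N r)%R%:R <= (a N r + u < v N r)%R%:R :> R.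
    rewrite ler_nat; case: ltP => // yv; rewrite (le_lt_trans _ yv)//.
    move: bt; rewrite /age_block /= in_itv/= => /andP[_ ax].
    by rewrite lerD2r addn1 ltW.
  move=> h; lra.
have upper : s <= Z false N + N%:R^-1 * (\sum_(r < n N) survival G (u - dl) (a N r)) +
    N%:R^-1 * (\sum_(r < n N) phi L (a N r)).
  rewrite /Z /s -!mulrDr ler_wpM2l// -!big_split/=.
  apply: ler_sum => r _; have [agr av] := Hav N r N0 (ltn_ord r).
  have [ar0 _] := (agesP hG _).1 agr.
  have /andP[p0 p1] := phi_itv L (a N r).
  have /andP[s0 s1] := survival_itv hG ud0 agr.
  rewrite (age_block_sum l L.+1 (fun k => ((k + false)%:R / l.+1%:R + u < v N r)%R%:R -
    F k false l N r) ar0).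
  case: (ltP (a N r) L.+1%:R) => [aL|/phi1 ->]; last first.
    by rewrite add0r; apply: (@le_trans _ _ 1); [case: (_ < _)|rewrite lerDr].
  set t := Num.truncn _; have bt := age_block_truncn l ar0.
  have := le _ _ _ _ N0 (ltn_ord r) bt dlu; rewrite -/t -/dl => leF.
  have : (a N r + u < v N r)%R%:R <= ((t + false)%:R / l.+1%:R + u < v N r)%R%:R :> R.
    rewrite ler_nat; case: (ltP (a N r + u)) => // yv; rewrite (le_lt_trans _ yv)//.
    move: bt; rewrite /age_block /= in_itv/= => /andP[ax _].
    by rewrite lerD2r addn0.
  move=> h; lra.
move: zt zf sp sm ph S1 S2; rewrite !ler_norml /e1.
move: lower upper phiL; rewrite /e1.
move: (N%:R^-1 * _) (N%:R^-1 * _) (N%:R^-1 * _) (Z _ _) (Z _ _).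
move: (pairing _ _ _) (mean_survival _ _ _) (mean_survival _ _ _) (mean_survival _ _ _).
move=> p m1 m2 m3 q1 q2 q3 z1 z2; clear; lra.
Unshelve. all: by end_near. Qed.

End age_blocks.

Section initial_customers.
Context {d : measure_display} {T : measurableType d} {R : realType}.
Variables (P : probability T R) (g G : R -> R) (Q : nat -> T -> queue R).
Hypothesis hG : service_distribution g G.
Hypothesis hQ : forall N, (0 < N)%N -> many_server_queue P G N (Q N).
Hypothesis service0_le : {ae P, forall w, forall N, (0 < N)%N ->
  (in_service0 (Q N w) <= N)%N}.

Definition count_remaining (q : queue R) (u : R) : nat :=
  (\sum_(i < in_service0 q)
    (age0 q (label q i) + u < requirement q (label q i))%R)%N.

Let C N k : set T := [set w | in_service0 (Q N w) = k].

Let labels0 (k : nat) : seq int := [seq i.+1%:Z - k%:Z | i <- iota 0 k].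

Let labels0_gt k j : j \in labels0 k -> - k%:Z < j.
Proof. by move=> /mapP[i _ ->]; rewrite ltrDr. Qed.

Let labels0_le k j : j \in labels0 k -> j <= 0.
Proof.
by move=> /mapP[i]; rewrite mem_iota add0n /= => ik ->; rewrite subr_le0 lez_nat.
Qed.

Let labels0_uniq k : uniq (labels0 k).
Proof. by rewrite map_inj_uniq ?iota_uniq// => a b /addIr[]. Qed.

Local Notation block := age_block.

Let in_block N j k l : set T :=
  [set w | - (in_service0 (Q N w))%:Z < j /\ block k l (age0 (Q N w) j)].

Let longer N j y : set T := (fun w => requirement (Q N w) j) @^-1` `]y, +oo[%classic.

Lemma cond_prob_longer N k y : (0 < N)%N -> exists f : int -> T -> R,
  (forall j w, 0 <= f j w <= 1) /\
  forall j, j \in labels0 k ->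
    is_cond_prob P (initial_sigma (Q N)) (C N k `&` longer N j y) (f j).
Proof.
move=> N0; have [mQ _ [ri _ _] _] := hQ N0.
have mG0 := initial_events_measurable mQ.
have mB : measurable (`]y, +oo[%classic : set R) by [].
have [f [cf _]] := ri k (labels0 k) (labels0_uniq k) (@labels0_gt k) _ (fun=> mB).
exists (fun j => clip \o f j); split=> [j w|j jk]; first exact: clip_itv.
apply: (@cond_prob_clip _ _ _ P (initial_events (Q N))) => //; last exact: cf.
apply: measurableI; first exact: in_service0_meas.
by rewrite -[X in measurable X]setTI; apply: requirement_meas.
Qed.

Section comparison.
Variables (N k : nat) (y : R) (f : int -> T -> R) (j : int) (kb l : nat) (u : R).
Hypothesis N0 : (0 < N)%N.
Hypothesis jk : j \in labels0 k.
Hypothesis u0 : 0 <= u.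
Hypothesis cf : is_cond_prob P (initial_sigma (Q N)) (C N k `&` longer N j y) (f j).

Let mQ : queue_measurable (Q N). Proof. by have [] := hQ N0. Qed.
Let mG0 := initial_events_measurable mQ.

Let A0 : set T := C N k `&` in_block N j kb l.

Let SA0 : initial_sigma (Q N) A0.
Proof.
have S1 : measurable (C N k : set (g_sigma_algebraType (initial_events (Q N)))).
  exact: (@initial_sigma_in_service _ _ _ (Q N) k).
have S2 : measurable (in_block N j kb l : set (g_sigma_algebraType (initial_events (Q N)))).
  by apply: initial_sigma_age; [exact: labels0_le jk|exact: measurable_itv].
have : measurable ((C N k : set (g_sigma_algebraType (initial_events (Q N)))) `&`
  in_block N j kb l) by exact: measurableI.
by [].
Qed.

Let mB : measurable (C N k `&` longer N j y).
Proof.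
apply: measurableI; first exact: in_service0_meas.
by rewrite -[X in measurable X]setTI; apply: requirement_meas.
Qed.

Let remains : set T := [set w | - (in_service0 (Q N w))%:Z < j /\
  age0 (Q N w) j + u < requirement (Q N w) j].

Let mremains : measurable remains.
Proof.
have -> : remains = [set w | - (in_service0 (Q N w))%:Z < j] `&`
    (fun w => requirement (Q N w) j - (age0 (Q N w) j + u)) @^-1` `]0, +oo[.
  by apply/seteqP; split=> w; rewrite /= in_itv/= andbT subr_gt0.
apply: measurableI; first exact: measurable_lt_label.
rewrite -[X in measurable X]setTI; apply: measurable_funB => //.
  exact: requirement_meas.
by apply: measurable_funD => //; exact: age0_meas.
Qed.

Let cond_remains : is_cond_prob P (initial_sigma (Q N)) remains
  (fun w => if - (in_service0 (Q N w))%:Z < j then survival G u (age0 (Q N w) j)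
            else 0).
Proof. by have [_ _ [_ _ ri] _] := hQ N0; apply: ri (labels0_le jk) u0. Qed.

(** A requirement beyond a fixed level [y] is compared, on an age block, with a
    service that lasts for more than [u] units of time: the conditional
    independence is stated for the former events, the conditional law for the
    latter. *)
Lemma block_survival_le : kb.+1%:R / l.+1%:R + u <= y ->
  {ae P, forall w, A0 w -> f j w <= survival G u (age0 (Q N w) j)}.
Proof.
move=> xy; have sub : A0 `&` (C N k `&` longer N j y) `<=` remains.
  move=> w [[_ [nj]]]; rewrite /block /= in_itv/= => /andP[_ ax] [_].
  rewrite /longer /= in_itv/= andbT => yv; split=> //.
  by apply: le_lt_trans yv; apply: le_trans xy; rewrite lerD2r ltW.
have := cond_prob_le mG0 mB mremains SA0 sub cf cond_remains.
by apply: filterS => w H A0w; have := H A0w; case: A0w => _ [-> _].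
Qed.

Lemma block_survival_ge : y <= kb%:R / l.+1%:R + u ->
  {ae P, forall w, A0 w -> survival G u (age0 (Q N w) j) <= f j w}.
Proof.
move=> xy; have sub : A0 `&` remains `<=` C N k `&` longer N j y.
  move=> w [[Cw [nj]]]; rewrite /block /= in_itv/= => /andP[ax _] [_ av].
  split=> //; rewrite /longer /= in_itv/= andbT.
  by apply: le_lt_trans av; apply: le_trans xy _; rewrite lerD2r.
have := cond_prob_le mG0 mremains mB SA0 sub cond_remains cf.
by apply: filterS => w H A0w; have := H A0w; case: A0w => _ [-> _].
Qed.

End comparison.

Lemma block_lln (kb l : nat) (y : R) : exists f : nat -> nat -> int -> T -> R,
  (forall N k j, (0 < N)%N -> j \in labels0 k ->
    is_cond_prob P (initial_sigma (Q N)) (C N k `&` longer N j y) (f N k j)) /\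
  {ae P, forall w, (N%:R^-1 * \sum_(j <- labels0 (in_service0 (Q N w)))
    \1_(block kb l) (age0 (Q N w) j) *
      (\1_(`]y, +oo[%classic) (requirement (Q N w) j) -
       f N (in_service0 (Q N w)) j w)) @[N --> \oo] --> (0 : R)}.
Proof.
have /choice[f0 Hf0] : forall N, exists f : nat -> int -> T -> R, forall k,
    (forall j w, 0 <= f k j w <= 1) /\ forall j, (0 < N)%N -> j \in labels0 k ->
    is_cond_prob P (initial_sigma (Q N)) (C N k `&` longer N j y) (f k j).
  case=> [|N]; first by exists (fun _ _ => cst 0) => k; split=> // j w;
    rewrite /cst lexx ler01.
  have /choice[f Hf] := fun k => @cond_prob_longer N.+1 k y (ltn0Sn N).
  by exists f => k; have [f1 f2] := Hf k; split=> // j _; exact: f2.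
exists f0; split=> [N k j N0 jk|]; first by have [_] := Hf0 N k; apply.
pose b N (j : int) : T -> R := if j <= 0 then \1_(in_block N j kb l) else cst 0.
have H := @weighted_lln _ _ _ P G Q hQ service0_le `]y, +oo[%classic
  (fun=> labels0) 1 b f0.
have mB : measurable (`]y, +oo[%classic : set R) by [].
have sJ N k : (k <= N)%N -> (size (labels0 k))%:R <= 1 * N%:R :> R.
  by move=> kN; rewrite size_map size_iota mul1r ler_nat.
have mb N j : (0 < N)%N -> measurable_wrt (initial_sigma (Q N)) (b N j).
  move=> N0; apply/measurable_wrtP; rewrite /b; case: ifP => [j0|_].
    apply: measurable_indic; apply: initial_sigma_age => //.
    exact: measurable_itv.
  exact: measurable_cst.
have bitv N j w : 0 <= b N j w <= 1.
  rewrite /b; case: ifP => _; last by rewrite /cst lexx ler01.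
  by rewrite indicE; case: (_ \in _); rewrite ?lexx ?ler01.
have fitv N k j w : 0 <= f0 N k j w <= 1 by have [] := Hf0 N k.
have cf N k j : (0 < N)%N -> j \in labels0 k ->
    is_cond_prob P (initial_sigma (Q N)) (C N k `&` longer N j y) (f0 N k j).
  by move=> N0 jk; have [_] := Hf0 N k; apply.
have {H} := H mB ltr01 (fun=> labels0_uniq) (fun _ k j => @labels0_gt k j) sJ mb
  bitv fitv cf.
apply: filterS => w; apply: cvg_trans; apply: near_eq_cvg; near=> N.
congr (_ * _); apply: eq_big_seq => j jk; congr (_ * _).
rewrite /b (labels0_le jk) !indicE; congr ((_ : bool)%:R).
have nj := labels0_gt jk.
by apply/idP/idP => /set_mem h; apply/mem_set => //; case: h.
Unshelve. all: by end_near. Qed.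

Lemma age0_label_sum (q : queue R) (h : int -> R) :
  \sum_(j <- labels0 (in_service0 q)) h j = \sum_(i < in_service0 q) h (label q i).
Proof.
by rewrite big_map -{1}[in_service0 q]subn0 -/(index_iota 0 _) big_mkord.
Qed.

Lemma initial_customers_lln (nu0 : T -> {measure set R -> \bar R}) :
  {ae P, forall w, sub_probability G (nu0 w)} ->
  {ae P, forall w, weak_cvg G \oo
    (fun N => mscale (N%:R^-1)%:nng (initial_age_measure (Q N w))) (nu0 w)} ->
  {ae P, forall w, forall N i, (0 < N)%N -> (i < in_service0 (Q N w))%N ->
    ages G (age0 (Q N w) (label (Q N w) i)) /\
    age0 (Q N w) (label (Q N w) i) < requirement (Q N w) (label (Q N w) i)} ->
  {ae P, forall w, forall i m : nat,
    (count_remaining (Q N w) (i%:R / m.+1%:R))%:R / N%:R @[N --> \oo] -->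
    mean_survival G (i%:R / m.+1%:R) (nu0 w)}.
Proof.
move=> sub weak ini; apply: ae_foralln => i; apply: ae_foralln => m.
set u : R := i%:R / m.+1%:R.
have u0 : 0 <= u by rewrite divr_ge0.
pose y (k : nat) (b : bool) (l : nat) : R := (k + b)%:R / l.+1%:R + u.
have /choice[F HF] := fun p : nat * nat * nat =>
  @block_lln p.1.1 p.2 (y p.1.1 (odd p.1.2) p.2).
have lln : {ae P, forall w, forall k b l, (N%:R^-1 *
    \sum_(j <- labels0 (in_service0 (Q N w)))
    \1_(age_block k l) (age0 (Q N w) j) *
      (\1_(`]y k (odd b) l, +oo[%classic) (requirement (Q N w) j) -
       F (k, b, l) N (in_service0 (Q N w)) j w)) @[N --> \oo] --> (0 : R)}.
  apply: ae_foralln => k; apply: ae_foralln => b; apply: ae_foralln => l.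
  by have [_] := HF (k, b, l).
have ge : {ae P, forall w, forall k l N r, (0 < N)%N ->
    (r < in_service0 (Q N w))%N ->
    age_block k l (age0 (Q N w) (label (Q N w) r)) ->
    survival G (u + l.+1%:R^-1) (age0 (Q N w) (label (Q N w) r)) <=
      F (k, 1%N, l) N (in_service0 (Q N w)) (label (Q N w) r) w}.
  apply: ae_foralln => k; apply: ae_foralln => l; apply: ae_foralln => N.
  apply: ae_foralln => r; have [->|N0] := posnP N; first by apply: aeW.
  have : {ae P, forall w, forall n : nat, (r < n)%N -> forall j, j = r.+1%:Z - n%:Z ->
      C N n w /\ in_block N j k l w -> survival G (u + l.+1%:R^-1) (age0 (Q N w) j) <=
      F (k, 1%N, l) N n j w}.
    apply: ae_foralln => n; have [nr|rn] := leqP n r.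
      by apply: aeW.
    have jn : r.+1%:Z - n%:Z \in labels0 n.
      by apply/mapP; exists r => //; rewrite mem_iota.
    have [cf _] := HF (k, 1%N, l).
    have yk : y k true l <= k%:R / l.+1%:R + (u + l.+1%:R^-1).
      by rewrite /y addn1 -natr1 mulrDl mul1r -addrA (addrC u).
    have ul0 : 0 <= u + l.+1%:R^-1 by rewrite addr_ge0.
    have := block_survival_ge N0 jn ul0 (cf N n _ N0 jn) yk.
    by apply: filterS => w H _ j -> [Cw bw]; exact: H.
  apply: filterS => w H _ rn bw; apply: (H _ rn _ erefl); split=> //; split=> //.
  by rewrite /label ltrDr.
have le : {ae P, forall w, forall k l N r, (0 < N)%N ->
    (r < in_service0 (Q N w))%N ->
    age_block k l (age0 (Q N w) (label (Q N w) r)) -> l.+1%:R^-1 <= u ->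
    F (k, 0%N, l) N (in_service0 (Q N w)) (label (Q N w) r) w <=
    survival G (u - l.+1%:R^-1) (age0 (Q N w) (label (Q N w) r))}.
  apply: ae_foralln => k; apply: ae_foralln => l; apply: ae_foralln => N.
  apply: ae_foralln => r; have [->|N0] := posnP N; first by apply: aeW.
  have : {ae P, forall w, forall n : nat, (r < n)%N -> forall j, j = r.+1%:Z - n%:Z ->
      C N n w /\ in_block N j k l w -> l.+1%:R^-1 <= u ->
      F (k, 0%N, l) N n j w <= survival G (u - l.+1%:R^-1) (age0 (Q N w) j)}.
    apply: ae_foralln => n; have [nr|rn] := leqP n r.
      by apply: aeW.
    have [lu|lu] := leP l.+1%:R^-1 u; last by apply: aeW => w _ j _ _.
    have jn : r.+1%:Z - n%:Z \in labels0 n.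
      by apply/mapP; exists r => //; rewrite mem_iota.
    have [cf _] := HF (k, 0%N, l).
    have yk : k.+1%:R / l.+1%:R + (u - l.+1%:R^-1) <= y k false l.
      rewrite /y addn0 -natr1 mulrDl mul1r le_eqVlt; apply/orP; left; apply/eqP; ring.
    have ul0 : 0 <= u - l.+1%:R^-1 by rewrite subr_ge0.
    have := block_survival_le N0 jn ul0 (cf N n _ N0 jn) yk.
    by apply: filterS => w H _ j -> [Cw bw] _; exact: H.
  apply: filterS => w H _ rn bw; apply: (H _ rn _ erefl); split=> //; split=> //.
  by rewrite /label ltrDr.
apply: filterS3 (filterI sub weak) (filterI ini lln) (filterI ge le).
move=> w [subw weakw] [iniw llnw] [gew lew].
have := @remaining_limit _ g G hG (nu0 w) (fun N => in_service0 (Q N w))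
  (fun N r => age0 (Q N w) (label (Q N w) r))
  (fun N r => requirement (Q N w) (label (Q N w) r))
  (fun k b l N r => F (k, nat_of_bool b, l) N (in_service0 (Q N w)) (label (Q N w) r) w)
  u subw u0 (fun N r N0 rn => iniw N r N0 rn) _ _ gew lew.
move=> H; have {}H := H _ _.
apply: cvg_trans (H _ _).
- apply: near_eq_cvg; near=> N; rewrite mulrC natr_sum; congr (_ * _).
- move=> f cf [c fc] f0; have {weakw} := weakw f cf (ex_intro _ c fc).
  apply: cvg_trans; apply: near_eq_cvg; near=> N.
  have N0 : (0 < N)%N by near: N; exact: nbhs_infty_gt.
  rewrite /initial_age_measure (pairing_dirac_sum hG)//.
    exact: (within_ages_measurable hG).
  by move=> r rn; have [] := iniw N r N0 rn.
- move=> k b l; have := llnw k (nat_of_bool b) l.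
  apply: cvg_trans; apply: near_eq_cvg; near=> N.
  rewrite age0_label_sum; congr (_ * _); apply: eq_bigr => r _.
  congr (_ * (_ - _)); rewrite indicE oddb; congr ((_ : bool)%:R).
  by apply/idP/idP => [/set_mem|h]; [|apply/mem_set]; rewrite /= in_itv/= andbT.
Unshelve. all: by end_near. Qed.

End initial_customers.

(** * Primitives and Stieltjes convolutions *)

Section primitives.
Context {R : realType}.
Notation leb := (@lebesgue_measure R).
Implicit Types (f F : R -> R) (a b x : R).

Lemma continuous_itv_integrable f a b : continuous f ->
  leb.-integrable `[a, b] (EFin \o f).
Proof.
move=> cf; apply: continuous_compact_integrable; first exact: segment_compact.
exact: continuous_subspaceT.
Qed.

Lemma derive_continuous F f : (forall x, is_derive x 1 F (f x)) -> continuous F.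
Proof.
move=> dF x; apply: differentiable_continuous; apply/derivable1_diffP.
by have [] := dF x.
Qed.

Lemma increment_integral F f a b : a <= b -> continuous f ->
  (forall x, is_derive x 1 F (f x)) ->
  \int[leb]_(x in `[a, b]) f x = F b - F a.
Proof.
rewrite le_eqVlt => /predU1P[->|ab] cf dF.
  by rewrite set_itv1 Rintegral_set1 subrr.
have cF := derive_continuous dF.
rewrite /Rintegral (continuous_FTC2 ab (F := F)) //.
- exact: continuous_subspaceT.
- split; first by move=> x _; have [] := dF x.
    exact: cvg_at_right_filter (cF a).
  exact: cvg_at_left_filter (cF b).
- by move=> x _; rewrite derive1E; exact: derive_val.
Qed.

(** Near [x], the primitive from [0] differs by a constant from the primitive from
    a point to the left of both [0] and [x]. *)
Lemma continuous_primitive f : continuous f ->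
  exists2 F, F 0 = 0 & forall x, is_derive x 1 F (f x).
Proof.
move=> cf; pose J a b := \int[leb]_(y in `[a, b]) f y.
have JB a b c : a <= b -> b <= c -> J a c - J a b = J b c.
  move=> ab bc; rewrite /J Rintegral_itvB ?bnd_simp//; last first.
    exact: continuous_itv_integrable.
  rewrite Rintegral_itv_obnd_cbnd//.
  apply: (@integrableS _ _ R leb _ _ _ _ _ _ (continuous_itv_integrable b c cf)) => //.
  exact: subset_itv_oc_cc.
pose F x := if 0 <= x then J 0 x else - J x 0.
exists F => [|x]; first by rewrite /F lexx /J set_itv1 Rintegral_set1.
pose a := Num.min x 0 - 1.
have ax : a < x by rewrite /a ltrBlDr gt_min ltrDl ltr01.
have a0 : a < 0 by rewrite /a ltrBlDr gt_min ltrDl ltr01 orbT.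
have [dJ J'] : derivable (J a) x 1 /\ derive1 (J a) x = f x.
  apply: (@continuous_FTC1_closed _ f a x (x + 1)) => //; first by rewrite ltrDl.
    exact: continuous_itv_integrable.
  exact: cf.
have FE : \forall y \near x, J a y - J a 0 = F y.
  near=> y.
  have ay : a < y by near: y; exact: lt_nbhsr.
  rewrite /F; case: ifPn => y0; first by rewrite JB// ltW.
  by rewrite -(JB a y 0) ?opprB ?(ltW ay)// ltW// ltNge.
have dJx : is_derive x 1 (J a) (f x) by rewrite -J' derive1E; exact: DeriveDef.
have := is_deriveB dJx (is_derive_cst (J a 0) x 1); rewrite subr0.
exact: (@near_eq_is_derive R R^o R^o (fun y => J a y - J a 0) F x 1 _ FE).
Unshelve. all: by end_near. Qed.

End primitives.

Section stieltjes.
Context {R : realType}.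
Notation leb := (@lebesgue_measure R).

Lemma stieltjes_ocitv (F : cumulative R R) a b : a <= b ->
  lebesgue_stieltjes_measure F `]a, b] = (F b - F a)%:E.
Proof.
move=> ab; rewrite /lebesgue_stieltjes_measure /measure_extension.
rewrite measurable_mu_extE/=; last exact: is_ocitv.
by rewrite wlength_itv_bnd.
Qed.

(** Integration by parts, as an application of the Tonelli theorem to
    [Phi (t - s) = Phi 0 - \int_[0, t - s] k]. *)
Lemma stieltjes_convolution (F : cumulative R R) (Phi k : R -> R) (t : R) :
  0 <= t -> continuous k -> (forall x, 0 <= k x) ->
  (forall x : R, is_derive x 1 Phi (- k x)) ->
  \int[lebesgue_stieltjes_measure F]_(s in `]0, t]) Phi (t - s) =
  Phi 0 * (F t - F 0) - \int[leb]_(u in `[0, t]) (k u * (F (t - u) - F 0)).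
Proof.
move=> t0 ck k0 dPhi; set mu := lebesgue_stieltjes_measure F.
pose I s := Phi 0 - Phi (t - s).
pose f (z : measurableTypeR R * measurableTypeR R) : \bar R :=
  (k z.2 * (\1_(`]0%R, t]%classic) z.1 * \1_(`[0%R, t]%classic) z.2 *
   \1_(`]-oo, t]%classic) (z.1 + z.2)))%:E.
have f0 z : (0 <= f z)%E by rewrite lee_fin !mulr_ge0.
have mf : measurable_fun setT f.
  apply/measurable_EFinP; apply: measurable_funM.
    exact: measurableT_comp (continuous_measurable_fun ck) (measurable_snd).
  apply: measurable_funM; first apply: measurable_funM.
  - by apply: measurableT_comp => //; exact: measurable_indic.
  - by apply: measurableT_comp => //; exact: measurable_indic.
  - apply: measurableT_comp; first exact: measurable_indic.
    by apply: measurable_funD; [exact: measurable_fst|exact: measurable_snd].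
have ci a b := continuous_itv_integrable a b ck.
have IE s : s <= t -> (I s)%:E = (\int[leb]_(u in `[0%R, (t - s)%R]) (k u)%:E)%E.
  move=> st; have dNPhi (x : R) : is_derive x 1 (- Phi) (k x).
    by rewrite -[k x]opprK; exact: is_deriveN.
  have := increment_integral (_ : 0 <= t - s) ck dNPhi.
  rewrite subr_ge0 => /(_ st); rewrite !fctE opprK [X in _ = X]addrC => IE.
  by rewrite /I -IE /Rintegral fineK//; exact: integrable_fin_num (ci _ _).
have := fubini_tonelli (m1 := mu) (m2 := leb) f mf f0.
have -> : (\int[mu]_s \int[leb]_u f (s, u) = \int[mu]_(s in `]0%R, t]) (I s)%:E)%E.
  rewrite [RHS]integral_mkcond; apply: eq_integral => s _.
  rewrite patchE; case: ifPn => [/set_mem|ns]; last first.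
    rewrite integral0_eq// => u _; rewrite /f /= [X in k u * (X * _ * _)]indicE.
    by rewrite (negbTE ns) !mul0r mulr0.
  rewrite /= in_itv/= => /andP[s0 st]; rewrite IE// [RHS]integral_mkcond.
  apply: eq_integral => u _; rewrite patchE /f /= !indicE mem_set ?mul1r; last first.
    by rewrite /= in_itv/= s0.
  case: ifPn => [/set_mem|].
    rewrite /= in_itv/= => /andP[u0 uts].
    have us : s + u <= t by lra.
    rewrite !mem_set ?mulr1//= in_itv/= ?u0//=.
    by lra.
  rewrite notin_setE /= in_itv/= => /negP; rewrite negb_and -!ltNge => h.
  have [ut|nut] := boolP (u \in _); last by rewrite mul0r mulr0.
  rewrite mul1r; have [sut|] := boolP (s + u \in _); last by rewrite mulr0.
  move: h; move/set_mem: ut; move/set_mem: sut; rewrite /= !in_itv/= => sut /andP[u0 _].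
  by rewrite ltNge u0 /= ltNge lerBrDl sut.
have -> : (\int[leb]_u \int[mu]_s f (s, u) =
    \int[leb]_(u in `[0%R, t]) (k u * (F (t - u)%R - F 0))%R%:E)%E.
  rewrite [RHS]integral_mkcond; apply: eq_integral => u _.
  rewrite patchE; case: ifPn => [/set_mem|nu]; last first.
    rewrite integral0_eq// => s _; rewrite /f /= [X in k u * (_ * X * _)]indicE.
    by rewrite (negbTE nu) mulr0 mul0r mulr0.
  rewrite /= in_itv/= => /andP[u0 ut].
  transitivity (\int[mu]_s ((k u)%:E * (\1_(`]0%R, (t - u)%R]%classic) s)%:E))%E.
    apply: eq_integral => s _; rewrite /f /= -EFinM; congr ((_ * _)%:E).
    rewrite [X in _ * X * _]indicE mem_set ?mulr1; last by rewrite /= in_itv/= u0.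
    rewrite !indicE -natrM mulnb; congr ((nat_of_bool _)%:R).
    apply/andP/idP => [[/set_mem + /set_mem]|/set_mem].
      rewrite /= !in_itv/= => /andP[s0 st] sut; apply/mem_set.
      by rewrite /= in_itv/= s0/= lerBrDr.
    rewrite /= in_itv/= => /andP[s0 st]; split; apply/mem_set; rewrite /= in_itv/=.
      by rewrite s0 (le_trans st)// gerBl.
    by rewrite -lerBrDr.
  rewrite ge0_integralZl// ?lee_fin//; last first.
    by apply/measurable_EFinP; exact: measurable_indic.
  rewrite integral_indic// setIT EFinM; congr (_ * _)%E.
  by apply: stieltjes_ocitv; rewrite subr_ge0.
move=> tonelli.
have m0t : (mu `]0%R, t]%classic < +oo)%E by rewrite /mu stieltjes_ocitv// ltry.
have cPhi := derive_continuous dPhi.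
have mPhi : measurable_fun `]0, t] (fun s => Phi (t - s)).
  apply: measurable_funTS; apply: measurableT_comp.
    exact: continuous_measurable_fun.
  by apply: measurable_funB.
have Phi_nd x y : x <= y -> Phi y <= Phi x.
  move=> xy; have dNPhi (z : R) : is_derive z 1 (- Phi) (k z).
    by rewrite -[k z]opprK; exact: is_deriveN.
  have := increment_integral xy ck dNPhi; rewrite !fctE opprK addrC => h.
  by rewrite -subr_ge0 -h; apply: Rintegral_ge0.
have iPhi : mu.-integrable `]0, t] (EFin \o (fun s => Phi (t - s))).
  apply: measurable_bounded_integrable => //.
  exists (`|Phi 0| + `|Phi t|); split; first exact: num_real.
  move=> C PC s; rewrite /= in_itv/= => /andP[s0 st].
  have h1 : Phi (t - s) <= Phi 0 by apply: Phi_nd; lra.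
  have h2 : Phi t <= Phi (t - s) by apply: Phi_nd; lra.
  apply: le_trans (ltW PC); rewrite ler_norml; have := ler_norm (Phi 0).
  have := ler_norm (- Phi t); rewrite normrN.
  have := normr_ge0 (Phi 0); have := normr_ge0 (Phi t); lra.
have ic : mu.-integrable `]0, t] (EFin \o cst (Phi 0)).
  apply: measurable_bounded_integrable => //.
  exists `|Phi 0|; split; first exact: num_real.
  by move=> C PC s _; exact: ltW.
have mI : measurable (`]0, t]%classic : set (measurableTypeR R)) by [].
have cE : \int[mu]_(s in `]0, t]) cst (Phi 0) s = Phi 0 * (F t - F 0).
  rewrite (Rintegral_cst _ mI); congr (_ * _).
  exact: (congr1 fine (stieltjes_ocitv F t0)).
have IE' : \int[mu]_(s in `]0, t]) I s = Phi 0 * (F t - F 0) -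
    \int[mu]_(s in `]0, t]) Phi (t - s).
  by rewrite -cE; exact: RintegralB mI ic iPhi.
suff : \int[mu]_(s in `]0, t]) I s =
    \int[leb]_(u in `[0, t]) (k u * (F (t - u) - F 0)).
  by move=> <-; rewrite IE' opprB addrC subrK.
by rewrite /Rintegral tonelli.
Qed.

End stieltjes.

(** * Test functions for the fluid equation *)

Section smooth_functions.
Context {R : realType}.
Notation leb := (@lebesgue_measure R).
Implicit Types (x : R).

Lemma Rintegral_eq0 (f : R -> R) (A : set R) :
  {in A, forall x, f x = 0} -> \int[leb]_(x in A) f x = 0.
Proof.
move=> f0; rewrite /Rintegral integral0_eq// => x Ax.
by rewrite f0//; exact/mem_set.
Qed.

Lemma is_derive_prod (f g : R -> R) x df dg :
  is_derive x 1 f df -> is_derive x 1 g dg ->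
  is_derive x 1 (fun y => f y * g y) (df * g x + f x * dg).
Proof.
move=> Df Dg; apply: (is_derive_eq (is_deriveM Df Dg)).
by rewrite addrC; congr (_ + _); rewrite /GRing.scale/= mulrC.
Qed.

Lemma is_derive_exp (L : R -> R) x l :
  is_derive x 1 L l -> is_derive x 1 (fun y => expR (L y)) (l * expR (L x)).
Proof. by rewrite mulrC => DL; exact: (is_derive1_comp (is_derive_expR _) DL). Qed.

Lemma is_derive_affine (f : R -> R) (e b x df : R) :
  is_derive (e * x + b) 1 f df -> is_derive x 1 (fun y => f (e * y + b)) (df * e).
Proof.
move=> Df; apply: (is_derive1_comp (g := fun y => e * y + b) Df).
apply: (is_derive_eq (is_deriveD (is_deriveM (is_derive_cst e x 1)
  (is_derive_id x 1)) (is_derive_cst b x 1))).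
by rewrite addr0 scaler0 addr0 /GRing.scale/= mulr1.
Qed.

Lemma cvg_max0 (f : R -> R) x : f @ x --> f x ->
  (fun y => Num.max 0 (f y)) @ x --> Num.max 0 (f x).
Proof.
move=> cf; have c0 : (fun=> 0 : R) @ x --> (0 : R) by exact: cvg_cst.
exact: (@continuous_max R R (cst 0) f x c0 cf).
Qed.

Lemma cvg_min_cst (m x : R) : (fun y => Num.min y m) @ x --> Num.min x m.
Proof.
have cm : (fun=> m : R) @ x --> (m : R) by exact: cvg_cst.
exact: (@continuous_min R R id (cst m) x cvg_id cm).
Qed.

Lemma nonincreasing_primitive (c k : R -> R) : continuous k ->
  (forall x, 0 <= k x) -> (forall x, is_derive x 1 c (- k x)) ->
  forall x y, x <= y -> c y <= c x.
Proof.
move=> ck k0 dc x y xy; have dNc (z : R) : is_derive z 1 (- c) (k z).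
  by rewrite -[k z]opprK; exact: is_deriveN.
have := increment_integral xy ck dNc; rewrite !fctE opprK addrC => h.
by rewrite -subr_ge0 -h; apply: Rintegral_ge0.
Qed.

(** The derivative is a negative multiple of [max 0 ((x - a) (b - x))], normalized
    by its integral. *)
Lemma cutoff (a b : R) : a < b -> exists c k : R -> R,
  [/\ continuous k, (forall x, is_derive x 1 c (- k x)),
      (forall x, x <= a -> c x = 1 /\ k x = 0),
      (forall x, b <= x -> c x = 0 /\ k x = 0) &
      forall x, 0 <= k x /\ 0 <= c x <= 1].
Proof.
move=> ab; suff [c [k [ck k0 dc ca cb]]] : exists c k : R -> R,
    [/\ continuous k, (forall x, 0 <= k x), (forall x, is_derive x 1 c (- k x)),
    (forall x, x <= a -> c x = 1 /\ k x = 0) &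
    forall x, b <= x -> c x = 0 /\ k x = 0].
  exists c, k; split=> // x; split=> //; have c_ni := nonincreasing_primitive ck k0 dc.
  apply/andP; split.
    have [/cb[-> _]//|/ltW xb] := leP b x.
    by have := c_ni _ _ xb; have [-> _] := cb b (lexx b).
  have [/ca[-> _]//|/ltW ax] := leP x a.
  by have := c_ni _ _ ax; have [-> _] := ca a (lexx a).
have ba0 : 0 < b - a by rewrite subr_gt0.
have ba1 : b - a != 0 by rewrite gt_eqF.
pose k x := Num.max 0 (6 / (b - a) ^+ 3 * ((x - a) * (b - x))).
have c6 : 0 < 6 / (b - a) ^+ 3 by rewrite divr_gt0// exprn_gt0.
have k_out x : x <= a \/ b <= x -> k x = 0.
  by move=> h; apply/max_idPl; rewrite pmulr_rle0//; nra.
have ck : continuous k.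
  move=> x; apply: cvg_max0; apply: cvgM; first exact: cvg_cst.
  by apply: cvgM; apply: cvgB; (exact: cvg_cst || exact: cvg_id).
have k0 x : 0 <= k x by rewrite le_max lexx.
have [P P0 dP] := continuous_primitive ck.
(* The primitive of [k'] below, normalized to have the increment [1]. *)
pose q x := (3 * (b - a) * (x - a) ^+ 2 - 2 * (x - a) ^+ 3) / (b - a) ^+ 3.
have Pab : P b - P a = 1.
  rewrite -(increment_integral (ltW ab) ck dP).
  pose k' x := 6 / (b - a) ^+ 3 * ((x - a) * (b - x)).
  have ck' : continuous k'.
    move=> x; apply: cvgM; first exact: cvg_cst.
    by apply: cvgM; apply: cvgB; (exact: cvg_cst || exact: cvg_id).
  have dq (x : R) : is_derive x 1 q (k' x).
    by apply: is_derive_eq; rewrite /k' /GRing.scale/=; field.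
  transitivity (\int[leb]_(x in `[a, b]) k' x).
    apply: eq_Rintegral => x; rewrite inE /= in_itv/= => /andP[ax xb].
    by apply/max_idPr; rewrite mulr_ge0 ?(ltW c6)// mulr_ge0// subr_ge0.
  by rewrite (increment_integral (ltW ab) ck' dq) /q; field.
exists (fun x => 1 - (P x - P a)), k; split=> //.
- move=> x; apply: (is_derive_eq (is_deriveB (is_derive_cst (1 : R) x 1)
    (is_deriveB (dP x) (is_derive_cst (P a) x 1)))).
  by rewrite subr0 sub0r.
- move=> x xa; split; last by apply: k_out; left.
  rewrite (_ : P x - P a = 0) ?subr0//; apply/eqP; rewrite -oppr_eq0 opprB.
  rewrite -(increment_integral xa ck dP); apply/eqP; apply: Rintegral_eq0 => y.
  by rewrite inE /= in_itv/= => /andP[_ ya]; apply: k_out; left.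
- move=> x bx; split; last by apply: k_out; right.
  have -> : 1 - (P x - P a) = - (P x - P b) by rewrite -Pab; ring.
  apply/eqP; rewrite oppr_eq0.
  rewrite -(increment_integral bx ck dP); apply/eqP; apply: Rintegral_eq0 => y.
  by rewrite inE /= in_itv/= => /andP[by_ _]; apply: k_out; right.
Qed.

End smooth_functions.

Section product_test_function.
Context {R : realType}.
Variables (G A a B k chi kappa : R -> R) (t : R).
Hypotheses (ca : continuous a) (ck : continuous k) (ckappa : continuous kappa).
Hypothesis dA : forall x : R, is_derive x 1 A (a x).
Hypothesis dB : forall x : R, is_derive x 1 B (- k x).
Hypothesis dchi : forall x : R, is_derive x 1 chi (- kappa x).

(** Along a characteristic, where [y - s] is constant, only [A] and the cutoff
    [chi] vary. If [A' = h A] and [chi = 1], this function solves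
    [phi_s + phi_y = h phi]. *)
Definition product_test (y s : R) := A y * B (y + t - s) * chi s.

Let cA := derive_continuous dA.
Let cB := derive_continuous dB.
Let cchi := derive_continuous dchi.

Let D1 y s := (a y * B (y + t - s) - A y * k (y + t - s)) * chi s.
Let D2 y s := A y * (k (y + t - s) * chi s - B (y + t - s) * kappa s).

Let is_derive_1 (y s : R) : is_derive y 1 (product_test^~ s) (D1 y s).
Proof.
have dB1 : is_derive y 1 (fun y => B (y + t - s)) (- k (y + t - s)).
  have := @is_derive_affine _ B 1 (t - s) y (- k (y + t - s)).
  rewrite mul1r addrA => /(_ (dB _)); rewrite mulr1.
  by under eq_fun do rewrite mul1r addrA.
apply: (is_derive_eq (is_derive_prod (is_derive_prod (dA y) dB1)
  (is_derive_cst (chi s) y 1))).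
by rewrite mulr0 addr0 mulrN.
Qed.

Let is_derive_2 (y s : R) : is_derive s 1 (product_test y) (D2 y s).
Proof.
have dB2 : is_derive s 1 (fun s => B (y + t - s)) (k (y + t - s)).
  have := @is_derive_affine _ B (-1) (y + t) s (- k (y + t - s)).
  rewrite mulN1r addrC => /(_ (dB _)); rewrite mulrN1 opprK.
  by under eq_fun do rewrite mulN1r addrC.
apply: (is_derive_eq (is_derive_prod (is_derive_prod (is_derive_cst (A y) s 1) dB2)
  (dchi s))).
by rewrite /D2 /cst; ring.
Qed.

Lemma product_test_derive1 y s : derive1 (product_test^~ s) y = D1 y s.
Proof. by rewrite derive1E; have [] := is_derive_1 y s. Qed.

Lemma product_test_derive2 y s : derive1 (product_test y) s = D2 y s.
Proof. by rewrite derive1E; have [] := is_derive_2 y s. Qed.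

Lemma product_test_function (m : R) : ages G m ->
  (forall y s, ages G y -> 0 <= s -> m < y -> B (y + t - s) * chi s = 0) ->
  (exists s0, forall s, s0 < s -> chi s = 0) ->
  test_function G product_test.
Proof.
move=> [_ mG] Bchi [s0 chi0].
have c1 : continuous (fun z : R * R => z.1) by move=> z; exact: cvg_fst.
have c2 : continuous (fun z : R * R => z.2) by move=> z; exact: cvg_snd.
have c3 : continuous (fun z : R * R => z.1 + t - z.2).
  move=> z; apply: cvgB; last exact: c2.
  by apply: cvgD; [exact: c1|exact: cvg_cst].
have comp (f : R -> R) (h : R * R -> R) : continuous f -> continuous h ->
    continuous (fun z => f (h z)).
  by move=> cf ch z; apply: continuous_comp; [exact: ch|exact: cf].
split.
- by move=> y s; have [] := is_derive_1 y s.
- by move=> y s; have [] := is_derive_2 y s.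
- under [X in continuous X]eq_fun do rewrite product_test_derive1.
  move=> z; apply: cvgM; last exact: (comp _ _ cchi c2).
  by apply: cvgB; apply: cvgM; [exact: (comp _ _ ca c1)|exact: (comp _ _ cB c3)
    |exact: (comp _ _ cA c1)|exact: (comp _ _ ck c3)].
- under [X in continuous X]eq_fun do rewrite product_test_derive2.
  move=> z; apply: cvgM; first exact: (comp _ _ cA c1).
  by apply: cvgB; apply: cvgM; [exact: (comp _ _ ck c3)|exact: (comp _ _ cchi c2)
    |exact: (comp _ _ cB c3)|exact: (comp _ _ ckappa c2)].
- exists m, s0; split=> // y s gy s_ge0 /orP[my|ss]; rewrite /product_test.
    by rewrite -mulrA Bchi// mulr0.
  by rewrite chi0// mulr0.
Qed.

End product_test_function.

Section clamped_hazard.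
Context {R : realType}.
Notation leb := (@lebesgue_measure R).
Variables (g G : R -> R) (m : R).
Hypothesis hG : service_distribution g G.
Hypothesis hh : {within ages G, continuous (hazard g G)}.
Hypothesis m0 : 0 <= m.
Hypothesis Gm : G m < 1.

(** An extension of the hazard rate from [[0, m]] to a continuous function on the
    line, whose primitive is differentiable everywhere. *)
Definition clamped_hazard (x : R) := hazard g G (Num.max 0 (Num.min x m)).

Let clamp_itv x : 0 <= Num.max 0 (Num.min x m) <= m.
Proof. by rewrite le_max lexx/= ge_max m0 ge_min lexx orbT. Qed.

Let clamp_ages x : 0 <= x <= m -> ages G x.
Proof.
move=> /andP[x0 xm]; apply/(agesP hG); split=> //.
by apply: le_lt_trans Gm; exact: cdf_nd hG _ _ xm.
Qed.

Lemma clamped_hazardE x : 0 <= x <= m -> clamped_hazard x = hazard g G x.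
Proof.
by move=> /andP[x0 xm]; rewrite /clamped_hazard (min_idPl xm) (max_idPr x0).
Qed.

Lemma clamped_hazard_continuous : continuous clamped_hazard.
Proof.
move=> x; set y := Num.max 0 (Num.min x m).
have cy : (fun x : R => Num.max 0 (Num.min x m)) @ x --> y.
  by apply: cvg_max0; exact: cvg_min_cst.
have /subspace_continuousP/(_ y (clamp_ages (clamp_itv x))) ch := hh.
apply: (@cvg_comp _ _ _ (fun x : R => Num.max 0 (Num.min x m)) (hazard g G)
  _ (within (ages G) (nbhs y)) _ _ ch) => U wU.
have : nbhs x [set z | ages G (Num.max 0 (Num.min z m)) ->
  U (Num.max 0 (Num.min z m))] := cy _ wU.
by apply: filterS => z /=; apply; exact: clamp_ages.
Qed.

Lemma clamped_hazard_ge0 x : 0 <= clamped_hazard x.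
Proof.
rewrite /clamped_hazard /hazard divr_ge0 ?(density_ge0 hG)//.
by rewrite subr_ge0 (cdf_le1 hG).
Qed.

Lemma hazardM x : ages G x -> hazard g G x * (1 - G x) = g x.
Proof.
by move=> /(agesP hG)[_ Gx]; rewrite /hazard divfK// gt_eqF// subr_gt0.
Qed.

(** The derivative of [(1 - G) * expR L] vanishes on [[0, m]]. *)
Lemma expR_clamped_hazard (L : R -> R) : L 0 = 0 ->
  (forall x : R, is_derive x 1 L (clamped_hazard x)) ->
  forall u, 0 <= u <= m -> expR (- L u) = 1 - G u.
Proof.
move=> L0 dL u um; pose gam x := clamped_hazard x * (1 - G x).
have ch := clamped_hazard_continuous.
have cgam : continuous gam.
  move=> x; apply: cvgM; first exact: ch.
  by apply: cvgB; [exact: cvg_cst|exact: cdf_continuous hG x].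
have [Gam Gam0 dGam] := continuous_primitive cgam.
have GamE x : 0 <= x <= m -> Gam x = G x.
  move=> /andP[x0 xm]; rewrite (cdf_Rintegral hG).
  have := increment_integral x0 cgam dGam; rewrite Gam0 subr0 => <-.
  apply: eq_Rintegral => y.
  rewrite inE /= in_itv/= => /andP[y0 yx].
  have ym : 0 <= y <= m by rewrite y0 (le_trans yx).
  by rewrite /gam clamped_hazardE// hazardM//; exact: clamp_ages.
pose W x := (1 - Gam x) * expR (L x).
pose w x := - gam x * expR (L x) + (1 - Gam x) * (clamped_hazard x * expR (L x)).
have dW (x : R) : is_derive x 1 W (w x).
  apply: is_derive_prod; last exact: is_derive_exp.
  apply: (is_derive_eq (is_deriveB (is_derive_cst (1 : R) x 1) (dGam x))).
  by rewrite sub0r.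
have cexp : continuous (fun x => expR (L x)).
  by apply: derive_continuous => x; exact: is_derive_exp.
have cw : continuous w.
  move=> x; apply: cvgD; apply: cvgM; last first.
  - by apply: cvgM; [exact: ch|exact: cexp].
  - by apply: cvgB; [exact: cvg_cst|exact: derive_continuous dGam x].
  - exact: cexp.
  - by apply: cvgN; exact: cgam.
have /andP[u0 _] := um.
have : W u - W 0 = 0.
  rewrite -(increment_integral u0 cw dW); apply: Rintegral_eq0 => x.
  rewrite inE /= in_itv/= => /andP[x0 xu].
  have xm : 0 <= x <= m by case/andP: um => _ um; rewrite x0 (le_trans xu).
  by rewrite /w /gam GamE// /cst; ring.
rewrite /W Gam0 L0 expR0 GamE// subr0 mulr1 => /eqP; rewrite subr_eq0 => /eqP GL.
have e0 : expR (L u) != 0 by rewrite gt_eqF// expR_gt0.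
by rewrite expRN; apply: (mulIf e0); rewrite GL mulVf.
Qed.

End clamped_hazard.

(** * The fluid equation as a renewal equation *)

Lemma positive_part_swap (R : realDomainType) (a x : R) :
  Num.max (a - x) 0 = a - x + Num.max (x - a) 0.
Proof.
have [ax|/ltW xa] := leP a x.
  by rewrite (max_idPr _) ?subr_le0// (max_idPl _) ?subr_ge0//; ring.
by rewrite (max_idPl _) ?subr_ge0// (max_idPr _) ?subr_le0// addr0.
Qed.

Section fluid_renewal.
Context {R : realType}.
Notation leb := (@lebesgue_measure R).

Lemma truncated_convolution (f w : R -> R) (B m t : R) : 0 <= m -> m <= t ->
  leb.-integrable `[0, t] (EFin \o f) -> {in `[0, t], forall u, 0 <= f u} ->
  measurable_fun `[0, t] w -> {in `[0, t], forall u, `|w u| <= B} ->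
  `| \int[leb]_(u in `[0, t]) (f u * w u) - \int[leb]_(u in `[0, m]) (f u * w u) | <=
  B * \int[leb]_(u in `]m, t]) f u.
Proof.
move=> m0 mt fi f0 mw wB.
have mf : measurable_fun `[0, t] f by have /integrableP[/measurable_EFinP] := fi.
have B0 : 0 <= B.
  by apply: le_trans (wB 0 _); rewrite ?in_itv/= ?lexx//= (le_trans m0).
have fwi : leb.-integrable `[0, t] (EFin \o (fun u => f u * w u)).
  by apply: integrable_mul_bounded mw _ => // u ut; apply: wB.
rewrite Rintegral_itvB ?bnd_simp//.
have sub : `]m, t] `<=` (`[0, t]%classic : set R).
  by move=> u; rewrite /= !in_itv/= => /andP[mu ->]; rewrite (le_trans m0 (ltW mu)).
have fwi' := @integrableS _ _ R leb _ _ _ (measurable_itv _) (measurable_itv _) sub fwi.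
have fi' := @integrableS _ _ R leb _ _ _ (measurable_itv _) (measurable_itv _) sub fi.
have mI : measurable (`]m, t]%classic : set R) by [].
apply: (le_trans (@le_normr_Rintegral _ _ R leb _ _ mI fwi')).
rewrite -RintegralZl//; apply: le_Rintegral => //.
- exact: integrable_norm.
- by have := @integrableZl _ _ R leb _ mI B _ fi'; exact: eq_integrable.
move=> u um; have ut := sub u um; rewrite normrM mulrC (ger0_norm (f0 _ ut)).
by apply: ler_wpM2r; [exact: f0|exact: wB].
Qed.

Variables (g G : R -> R).
Hypothesis hG : service_distribution g G.
Hypothesis hh : {within ages G, continuous (hazard g G)}.
Variables (E : R -> R) (x0 : R) (nu0 : {measure set R -> \bar R}).
Variables (X : R -> R) (nu : R -> {measure set R -> \bar R}).
Hypothesis data : initial_data G E x0 nu0.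
Hypothesis sol : fluid_solution G (hazard g G) E x0 nu0 X nu.

Local Notation K := (fluid_K G (hazard g G) nu).
Local Notation D := (fluid_D G (hazard g G) nu).

Lemma fluid_D0 : D 0 = 0.
Proof. by rewrite /fluid_D /departure_integral set_itv1 integral_set1. Qed.

Lemma fluid_K0 : K 0 = 0.
Proof. by rewrite /fluid_K subrr add0r fluid_D0. Qed.

(** The existence of the Stieltjes integral in the fluid equation, already for the
    test function [0], contains the decomposition. *)
Lemma fluid_K_difference : exists F1 F2 : cumulative R R,
  forall s, 0 <= s -> K s = F1 s - F2 s.
Proof.
have T0 : test_function G (fun _ _ => 0).
  split.
  - by move=> x s; exact: derivable_cst.
  - by move=> x s; exact: derivable_cst.
  - under [X in continuous X]eq_fun do rewrite derive1_cst.
    by move=> z; exact: cvg_cst.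
  - under [X in continuous X]eq_fun do rewrite derive1_cst.
    by move=> z; exact: cvg_cst.
  - exists 0, 0; split=> //.
    by have [] : ages G 0 by apply/(agesP hG); rewrite (cdf_eq0 hG).
by have [I [F1 [F2 [KF _]]] _] := fluid_age sol (lexx 0) T0; exists F1, F2.
Qed.

Lemma cumulative_bounded (F : cumulative R R) (t : R) : exists C, forall u,
  0 <= u <= t -> `|F (t - u)| <= C.
Proof.
exists (`|F 0| + `|F t|) => u /andP[u0 ut].
have h1 : F 0 <= F (t - u) by apply: cumulative_is_nondecreasing; rewrite subr_ge0.
have h2 : F (t - u) <= F t by apply: cumulative_is_nondecreasing; rewrite gerBl.
have := ler_norm (F t); have := ler_norm (- F 0); rewrite normrN ler_norml.
have := normr_ge0 (F 0); have := normr_ge0 (F t); lra.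
Qed.

Lemma cumulative_measurable (F : cumulative R R) (t : R) (A : set R) :
  measurable_fun A (fun u => F (t - u)).
Proof.
apply: measurable_funTS; apply: (measurableT_comp (f := F)).
  by apply: nondecreasing_measurable => // x y xy; apply: cumulative_is_nondecreasing.
exact: measurable_funB.
Qed.

Lemma fluid_K_bounded (t : R) : exists B,
  measurable_fun `[0, t] (fun u => K (t - u)) /\
  forall u, 0 <= u <= t -> `|K (t - u)| <= B.
Proof.
have [F1 [F2 KF]] := fluid_K_difference.
have [C1 H1] := cumulative_bounded F1 t; have [C2 H2] := cumulative_bounded F2 t.
exists (C1 + C2); split=> [|u ut].
  apply: (@eq_measurable_fun _ _ _ _ `[0, t]%classic (fun u : R => F1 (t - u) - F2 (t - u))).
    by move=> u; rewrite inE /= in_itv/= => /andP[u0 ut]; rewrite KF// subr_ge0.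
  by apply: measurable_funB; exact: cumulative_measurable.
rewrite KF ?subr_ge0; last by case/andP: ut.
by rewrite (le_trans (ler_normB _ _))// lerD// ?H1 ?H2.
Qed.

(** For the test function [product_test] with [A = expR L] and
    [B = expR (- L) * c], where [L] is the cumulative hazard, the transport and the
    departure terms of the fluid equation cancel up to the time [t]. The Stieltjes
    term is a convolution with [k = - B'], which is the density [g] where the
    cutoff [c] is [1]. *)
Lemma fluid_truncated (m t : R) : 0 <= m -> G m < 1 -> 0 <= t ->
  exists c k : R -> R,
  [/\ continuous c, forall x, 0 <= c x <= 1, forall x, x <= m -> c x = 1,
      [/\ continuous k, forall x, 0 <= k x, forall x, 0 <= x <= m -> k x = g x &
          m <= t -> \int[leb]_(u in `]m, t]) k u <= 1 - G m] &
      pairing G c (nu t) = pairing G (fun y => survival G t y * c (y + t)) nu0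
        + K t - \int[leb]_(u in `[0, t]) (k u * K (t - u)) ].
Proof.
move=> m0 Gm t0.
(* The support of [c] ends at [m1 < m2], so that [chi] can be [1] up to [t] and
   vanish from [t + (m2 - m1)] on, while the ages stay below [m2]. *)
have [m2 mm2 Gm2] : exists2 m2, m < m2 & G m2 < 1.
  have G1 : 0 < 1 - G m by rewrite subr_gt0.
  have [d d0 Hd] := cdf_uniformly_continuous hG G1.
  exists (m + d / 2); first by rewrite ltrDl divr_gt0.
  have := Hd (m + d / 2) m; rewrite addrAC subrr add0r gtr0_norm ?divr_gt0//.
  rewrite gtr_pMr// invf_lt1// ltr1n => /(_ isT) /ltr_normlW; lra.
have m20 : 0 <= m2 by rewrite (le_trans m0)// ltW.
pose m1 := (m + m2) / 2.
have mm1 : m < m1 by rewrite /m1; lra.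
have m12 : m1 < m2 by rewrite /m1; lra.
have [c [kap [ckap dc cm cm1 c01]]] := cutoff mm1.
have tt : t < t + (m2 - m1) by lra.
have [chi [kap' [ckap' dchi chi1 chi2 _]]] := cutoff tt.
pose hz := clamped_hazard g G m2.
have chz : continuous hz by exact: clamped_hazard_continuous hG hh m20 Gm2.
have [L L0 dL] := continuous_primitive chz.
have expL := expR_clamped_hazard hG hh m20 Gm2 L0 dL.
have cL := derive_continuous dL.
have cc := derive_continuous dc.
have cexp (f : R -> R) : continuous f -> continuous (fun x => expR (f x)).
  by move=> cf x; apply: continuous_comp; [exact: cf|exact: continuous_expR].
have cNL : continuous (fun x => - L x) by move=> x; apply: cvgN; exact: cL.
pose A x := expR (L x); pose a x := hz x * expR (L x).
pose B x := expR (- L x) * c x.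
pose k x := hz x * expR (- L x) * c x + expR (- L x) * kap x.
have dA (x : R) : is_derive x 1 A (a x) by exact: is_derive_exp.
have dB (x : R) : is_derive x 1 B (- k x).
  have dNL : is_derive x 1 (fun x => - L x) (- hz x) by exact: is_deriveN.
  apply: (is_derive_eq (is_derive_prod (is_derive_exp dNL) (dc x))).
  by rewrite /k; ring.
have ca : continuous a by move=> x; apply: cvgM; [exact: chz|exact: cexp cL x].
have ck : continuous k.
  move=> x; apply: cvgD.
    apply: cvgM; last exact: cc.
    by apply: cvgM; [exact: chz|exact: cexp cNL x].
  by apply: cvgM; [exact: cexp cNL x|exact: ckap].
have k0 x : 0 <= k x.
  have [kap0 /andP[c0 _]] := c01 x.
  have hz0 : 0 <= hz x := clamped_hazard_ge0 m2 hG x.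
  have e0 := expR_ge0 (- L x).
  by apply: addr_ge0; [apply: mulr_ge0 => //|]; apply: mulr_ge0.
have agesm2 : ages G m2 by apply/(agesP hG).
have far y s : m2 < y -> s < t + (m2 - m1) -> c (y + t - s) = 0.
  by move=> my st; apply: (cm1 (y + t - s) _).1; lra.
have testf : test_function G (product_test A B chi t).
  apply: (product_test_function ca ck ckap' dA dB dchi agesm2).
    move=> y s _ _ my; have [/chi2[-> _]|st] := leP (t + (m2 - m1)) s.
      by rewrite mulr0.
    by rewrite /B far// mulr0 mul0r.
  by exists (t + (m2 - m1)) => s /ltW/chi2[].
have [I [F1 [F2 [KF IE]]] eq] := fluid_age sol t0 testf.
exists c, k; split; [exact: cc| | |split; [exact: ck|exact: k0| |]|].
- by move=> x; have [] := c01 x.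
- by move=> x /cm[].
- move=> x xm; have /andP[x0_ xm'] := xm.
  have xm2 : 0 <= x <= m2 by rewrite x0_ (le_trans xm')// ltW.
  rewrite /k; have [-> ->] := cm _ xm'; rewrite mulr0 addr0 mulr1 (expL _ xm2).
  rewrite /hz (clamped_hazardE _ _ xm2) (hazardM hG)//; apply/(agesP hG); split=> //.
  by apply: le_lt_trans Gm; exact: cdf_nd hG _ _ xm'.
- move=> mt; rewrite Rintegral_itv_obnd_cbnd; last first.
    apply: (@integrableS _ _ R leb _ _ _ _ _ _ (continuous_itv_integrable m t ck)) => //.
    exact: subset_itv_oc_cc.
  have dNB (x : R) : is_derive x 1 (- B) (k x) by rewrite -[k x]opprK; exact: is_deriveN.
  have := increment_integral mt ck dNB; rewrite !fctE => ->.
  have [cm_ _] := cm m (lexx m).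
  have Bt : 0 <= B t by rewrite mulr_ge0 ?expR_ge0//; have [_ /andP[]] := c01 t.
  have -> : - B t - - B m = B m - B t by ring.
  by rewrite /B cm_ mulr1 expL ?gerBl// m0 ltW.
have {}eq : pairing G c (nu t) =
    pairing G (fun y => survival G t y * c (y + t)) nu0 + I.
  have -> : pairing G c (nu t) = pairing G ((product_test A B chi t)^~ t) (nu t).
    apply: eq_Rintegral => x _; rewrite /product_test /A /B.
    rewrite addrK mulrA -expRD subrr expR0 mul1r.
    by have [-> _] := chi1 t (lexx t); rewrite mulr1.
  have -> : pairing G (fun y => survival G t y * c (y + t)) nu0 =
      pairing G ((product_test A B chi t)^~ 0) nu0.
    apply: eq_Rintegral => x /set_mem /(agesP hG)[x0_ Gx].
    rewrite /product_test /A /B subr0; have [-> _] := chi1 0 t0; rewrite mulr1.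
    have [/cm1[-> _]|xtm1] := leP m1 (x + t); first by rewrite !mulr0.
    rewrite mulrA; congr (_ * _).
    have xtm2 : x + t <= m2 by rewrite ltW// (lt_trans xtm1).
    have xm2 : x <= m2 by rewrite (le_trans _ xtm2)// lerDl.
    rewrite /survival -(expL (x + t)) ?xtm2 ?addr_ge0// -(expL x) ?x0_//.
    by rewrite -expRN opprK mulrC.
  rewrite eq; congr (_ + _); rewrite -[RHS]addr0 -addrA; congr (_ + _).
  apply/eqP; rewrite subr_eq0; apply/eqP; apply: eq_Rintegral => s.
  rewrite inE /= in_itv/= => /andP[s0 st]; apply: eq_Rintegral => x agx.
  rewrite (product_test_derive1 _ _ dA dB) (product_test_derive2 _ _ dB dchi).
  have [chis ->] := chi1 s st; rewrite /product_test chis !mulr1 mulr0 subr0.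
  have -> : forall p q : R, p + (q - p) = q by move=> p q; ring.
  have [xm2|m2x] := leP x m2; last first.
    by rewrite /B far// ?mulr0// (le_lt_trans st).
  rewrite /a /hz clamped_hazardE ?mulrA// xm2 andbT.
  by have [] := (agesP hG x).1 (set_mem agx).
rewrite {}eq -addrA; congr (_ + _).
have B0 : B 0 = 1 by rewrite /B L0 oppr0 expR0 mul1r; have [->] := cm 0 m0.
have stE (F : cumulative R R) :
    \int[lebesgue_stieltjes_measure F]_(s in `]0, t]) product_test A B chi t 0 s =
    (F t - F 0) - \int[leb]_(u in `[0, t]) (k u * (F (t - u) - F 0)).
  rewrite -[F t - F 0]mul1r -B0 -(stieltjes_convolution F t0 ck k0 dB).
  apply: eq_Rintegral => s; rewrite inE /= in_itv/= => /andP[s0 st].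
  rewrite /product_test /A L0 expR0 mul1r add0r.
  by have [->] := chi1 s st; rewrite mulr1.
have ci (F : cumulative R R) : leb.-integrable `[0, t]
    (EFin \o (fun u => k u * (F (t - u) - F 0))).
  have [C HC] := cumulative_bounded F t.
  apply: (@integrable_mul_bounded _ _ k (fun u => F (t - u) - F 0) (C + `|F 0|)) => //.
  - exact: continuous_itv_integrable.
  - by apply: measurable_funB => //; exact: cumulative_measurable.
  - by move=> u ut; rewrite (le_trans (ler_normB _ _))// lerD2r HC.
rewrite IE !stE.
have F12 : F1 0 = F2 0 by apply/eqP; rewrite -subr_eq0 -KF// fluid_K0.
have -> : \int[leb]_(u in `[0, t]) (k u * K (t - u)) =
    \int[leb]_(u in `[0, t]) (k u * (F1 (t - u) - F1 0)) -
    \int[leb]_(u in `[0, t]) (k u * (F2 (t - u) - F2 0)).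
  rewrite -(RintegralB _ (ci F1) (ci F2))//; apply: eq_Rintegral => u.
  rewrite inE /= in_itv/= => /andP[u0 ut]; rewrite KF ?subr_ge0//.
  by rewrite F12; ring.
by rewrite KF// F12; ring.
Qed.

(** For [m] with [G m = 1 - e], the densities [k] and [g] agree up to [m], and each
    has at most the mass [e] beyond. *)
Lemma fluid_truncated_density (e B t : R) : 0 < e <= 1 -> 0 <= t ->
  (forall u, 0 <= u <= t -> `|K (t - u)| <= B) ->
  exists c : R -> R,
  [/\ continuous c, forall x, 0 <= c x <= 1, forall x, G x < 1 - e -> c x = 1 &
    `| K t - \int[leb]_(u in `[0, t]) (g u * K (t - u)) -
       (pairing G c (nu t) - pairing G (fun y => survival G t y * c (y + t)) nu0) |
    <= 2 * B * e].
Proof.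
move=> /andP[e0 e1] t0 KB; have [x x_ge0 Gx] := cdf_cvg1 hG e0.
have [] := @IVT _ G 0 x (1 - e) x_ge0.
- by apply: continuous_subspaceT; exact: cdf_continuous hG.
- rewrite (cdf_eq0 hG (lexx 0)) (min_idPl _) ?(cdf_ge0 hG)//.
  by rewrite (max_idPr _) ?(cdf_ge0 hG)// subr_ge0 e1 ltW.
move=> m; rewrite in_itv/= => /andP[m0 _] Gm.
have Gm1 : G m < 1 by rewrite Gm ltrBlDr ltrDl.
have [c [k [cc c01 cm [ck k0 kg tail] eq]]] := fluid_truncated m0 Gm1 t0.
exists c; split=> //.
  move=> y; rewrite -Gm => Gy; apply: cm; apply/ltW; rewrite ltNge; apply/negP => my.
  by move: Gy; rewrite ltNge (cdf_nd hG).
rewrite eq; set p := pairing _ _ _; set Ik := \int[leb]_(u in _) (k u * _).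
set Ig := \int[leb]_(u in _) (g u * _).
have -> : K t - Ig - (p + K t - Ik - p) = Ik - Ig by ring.
have B0 : 0 <= B by apply: le_trans (KB 0 _); rewrite // lexx.
have [tm|mt] := leP t m.
  rewrite (_ : Ik = Ig) ?subrr ?normr0 ?mulr_ge0// ?ltW//.
  apply: eq_Rintegral => u; rewrite inE /= in_itv/= => /andP[u0 ut].
  by rewrite kg// u0 (le_trans ut).
have [B' [mK _]] := fluid_K_bounded t.
have KB' : {in `[0, t], forall u, `|K (t - u)| <= B} by move=> u; rewrite in_itv => /KB.
have mt' := ltW mt.
have ik := continuous_itv_integrable 0 t ck.
have ig : leb.-integrable `[0, t] (EFin \o g).
  by apply: (density_integrable hG) => //; exact: subset_itvl.
have h1 := truncated_convolution m0 mt' ik (fun u _ => k0 u) mK KB'.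
have h2 := truncated_convolution m0 mt' ig (fun u _ => density_ge0 hG u) mK KB'.
have t1 := tail mt'.
have t2 : \int[leb]_(u in `]m, t]) g u <= e.
  rewrite -(cdf_diff hG m0 mt'); have := cdf_le1 hG t; rewrite Gm; lra.
have eqm : \int[leb]_(u in `[0, m]) (k u * K (t - u)) =
    \int[leb]_(u in `[0, m]) (g u * K (t - u)).
  by apply: eq_Rintegral => u; rewrite inE /= in_itv/= => um; rewrite kg.
move: h1 h2; rewrite -/Ik -/Ig eqm; set Im := \int[leb]_(u in _) _ => h1 h2.
have -> : Ik - Ig = (Ik - Im) - (Ig - Im) by ring.
apply: le_trans (ler_normB _ _) _; rewrite -mulrA mulr_natl mulr2n.
apply: lerD; [apply: le_trans h1 _|apply: le_trans h2 _]; apply: ler_wpM2l => //.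
by rewrite (le_trans t1)// Gm; lra.
Qed.

(** The limit of [fluid_truncated_density] for [e] to [0], as the cutoffs tend
    to [1] at all ages. *)
Lemma fluid_mass_renewal (t : R) : 0 <= t ->
  mass G (nu t) = mean_survival G t nu0 + K t -
    \int[leb]_(u in `[0, t]) (g u * K (t - u)).
Proof.
move=> t0; have [B [_ KB]] := fluid_K_bounded t.
have B0 : 0 <= B by apply: le_trans (KB 0 _); rewrite // lexx.
have e01 n : 0 < (n.+1%:R^-1 : R) <= 1 by rewrite invr_gt0 ltr0n invf_le1// ler1n.
have /choice[c_ Hc] := fun n => fluid_truncated_density (e01 n) t0 KB.
pose L := K t - \int[leb]_(u in `[0, t]) (g u * K (t - u)).
pose a n := pairing G (c_ n) (nu t) -
  pairing G (fun y => survival G t y * c_ n (y + t)) nu0.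
have mc n (A : set R) : measurable_fun A (c_ n).
  by apply: measurable_funTS; apply: continuous_measurable_fun; have [] := Hc n.
have near1 x : G x < 1 -> \forall n \near \oo, c_ n x = 1.
  rewrite -subr_gt0 => Gx; near=> n; have [_ _ c1 _] := Hc n; apply: c1.
  by rewrite ltrBrDr -ltrBrDl; near: n; exact: (near_infty_natSinv_lt (PosNum Gx)).
have c_norm n x : `|c_ n x| <= 1.
  by have [_ /(_ x)/andP[c0 c1] _ _] := Hc n; rewrite ger0_norm.
have a_mass : a n @[n --> \oo] --> mass G (nu t) - mean_survival G t nu0.
  apply: cvgB.
    have [sub _ _] := fluid_nu_cadlag sol t0.
    apply: (@pairing_cvg _ _ _ hG _ 1 sub) => // x /(agesP hG)[_ Gx].
    by apply: cvg_near_cst; exact: near1.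
  apply: (@pairing_cvg _ _ _ hG _ 1 (data_nu0 data)).
  - move=> n; apply: measurable_funM; first exact: measurable_survival hG t.
    apply: measurable_funTS; apply: measurableT_comp; first exact: mc.
    exact: measurable_funD.
  - exact: measurable_survival hG t.
  - move=> n x agx; rewrite normrM; apply: mulr_ile1 => //.
    exact: (survival_norm hG).
  - move=> x agx; apply: cvg_near_cst.
    have := cdf_le1 hG (x + t); rewrite le_eqVlt => /predU1P[Gxt|/near1].
      by apply: nearW => n; rewrite /survival Gxt subrr !mul0r.
    by apply: filterS => n ->; rewrite mulr1.
have a_L : a n @[n --> \oo] --> L.
  apply/cvgrPdist_le => e e0.
  have e1 : 0 < e / (2 * B + 1) by rewrite divr_gt0// ltr_wpDl// mulr_ge0.
  near=> n; have [_ _ _ h] := Hc n; apply: le_trans h _.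
  have : n.+1%:R^-1 < e / (2 * B + 1).
    by near: n; exact: (near_infty_natSinv_lt (PosNum e1)).
  rewrite ltr_pdivlMr; last by rewrite ltr_wpDl// mulr_ge0.
  move=> /ltW; apply: le_trans.
  by rewrite mulrDr mulr1 mulrC lerDl invr_ge0.
have : mass G (nu t) - mean_survival G t nu0 = L by exact: cvg_unique a_mass a_L.
rewrite /L => h.
have -> : mass G (nu t) = mean_survival G t nu0 + (mass G (nu t) - mean_survival G t nu0).
  by ring.
by rewrite h addrA.
Unshelve. all: by end_near. Qed.

Lemma fluid_mass0 : mass G (nu 0) = mass G nu0.
Proof.
have := fluid_non_idling sol (lexx 0); rewrite (fluid_X sol (lexx 0)) fluid_D0.
rewrite (data_E0 data) addr0 subr0 -(data_non_idling data).
by move=> /addrI/oppr_inj.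
Qed.

(** The fluid counterpart of [departures_split] and [entries_convolution]. *)
Lemma fluid_departures (t : R) : 0 <= t ->
  D t = mass G nu0 - mean_survival G t nu0 +
    \int[leb]_(u in `[0, t]) (g u * K (t - u)).
Proof.
move=> t0; have := fluid_mass_renewal t0; rewrite /fluid_K -/D fluid_mass0.
set I := \int[leb]_(u in _) _; move: (mass G (nu t)) (mean_survival _ _ _) => p q.
by move: (D t) => z; lra.
Qed.

(** The fluid counterpart of [entries_reflection]. *)
Lemma fluid_entries (t : R) : 0 <= t ->
  K t = E t + Num.max (x0 - 1) 0 - Num.max (x0 + E t - D t - 1) 0.
Proof.
move=> t0; have := fluid_non_idling sol t0; rewrite (fluid_X sol t0) -/D.
have := data_non_idling data; rewrite /fluid_K -/D fluid_mass0.
rewrite (positive_part_swap 1 x0) (positive_part_swap 1 (x0 + E t - D t)).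
by move: (mass G _) (mass G _) (D t) (Num.max _ _) (Num.max _ _) => p q z u v; lra.
Qed.

End fluid_renewal.

(** * The dynamics of a path of the queue *)

Section path_dynamics.
Context {R : realType}.
Notation leb := (@lebesgue_measure R).
Variables (g G : R -> R) (N : nat) (q : queue R).
Hypothesis hG : service_distribution g G.
Hypothesis dyn : queue_dynamics G N q.

Lemma initial_label (i : nat) : (i < in_service0 q)%N ->
  - (in_service0 q)%:Z < label q i /\ label q i <= 0.
Proof. by move=> i_n; rewrite /label ltrDr subr_le0 lez_nat. Qed.

Lemma mass_initial : mass G (initial_age_measure q) = (in_service0 q)%:R.
Proof.
have mA := measurable_ages hG.
rewrite /mass /pairing Rintegral_cst// mul1r /initial_age_measure /= /msum.
rewrite (eq_bigr (fun=> 1%E)); last first.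
  move=> i _; rewrite /= diracE mem_set//.
  have [h1 h2] := initial_label (ltn_ord i).
  by have [] := initial_ages dyn h1 h2.
by rewrite sumEFin sumr_const card_ord.
Qed.

Lemma in_service0_le : (in_service0 q <= N)%N.
Proof.
have := initial_non_idling dyn; rewrite mass_initial => h.
by rewrite -(ler_nat R) -subr_ge0 h le_max lexx orbT.
Qed.

(** The non-idling condition at the times [0] and [t] determines the number of
    customers in service, and [positive_part_swap] turns idle servers into
    waiting customers. *)
Lemma entries_reflection (t : R) : 0 <= t ->
  (entries q t)%:R = (arrivals q t)%:R + Num.max ((in_system0 q)%:R - N%:R) 0
    - Num.max (in_system q t - N%:R) 0 :> R.
Proof.
move=> t0; rewrite (entriesE dyn t0).
have := non_idling dyn t0; have := initial_non_idling dyn.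
rewrite (positive_part_swap N%:R (in_system0 q)%:R).
rewrite (positive_part_swap N%:R (in_system q t)).
rewrite /in_system.
move: (mass _ _) (mass _ _) (departures _ _)%:R (arrivals _ _)%:R => m1 m2 x y.
by move: (Num.max _ _) (Num.max _ _) => p1 p2; lra.
Qed.

Lemma entries_le s t : 0 <= s -> s <= t -> (entries q s <= entries q t)%N.
Proof. by move=> s0 st; rewrite -(ler_nat R); exact: entries_nd dyn _ _ s0 st. Qed.

Lemma entry_time_ge0 (j : nat) : 0 <= entry_time q j.
Proof.
rewrite /entry_time; set A := [set _ | _].
have [A0|A0] := pselect (A !=set0); last by rewrite inf_out// => -[].
by apply: lb_le_inf => // t [].
Qed.

Lemma entry_time_le (j : nat) s : 0 <= s -> (j <= entries q s)%N ->
  entry_time q j <= s.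
Proof. by move=> s0 js; apply: ge_inf; [exists 0 => t []|split]. Qed.

(** By right continuity, the infimum in the definition of the entry time is
    attained. *)
Lemma entries_entry_time (j : nat) s u : 0 <= u -> (j <= entries q u)%N ->
  0 <= s -> entry_time q j <= s -> (j <= entries q s)%N.
Proof.
move=> u0 ju s0 sig_s; set A := [set t : R | 0 <= t /\ (j%:Z <= (entries q t)%:Z)].
have infA : has_inf A by split; [exists u; split|exists 0 => t []].
have sig0 := entry_time_ge0 j.
apply: leq_trans (entries_le sig0 sig_s); set sig := entry_time q j in sig0 *.
have [/cvgrPdist_lt/(_ 1 ltr01) near_sig _] := entries_cadlag dyn sig0.
have : \forall x \near sig^'+, (j <= entries q sig)%N; last by move=> /filter_ex[].
near=> x; have sx : sig < x by near: x; exact: nbhs_right_gt.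
have [a [a0 ja] ax] : exists2 a, A a & a < x by exact: (inf_lt infA.1 sx).
have jx : (j <= entries q x)%N.
  by apply: leq_trans (entries_le a0 (ltW ax)); rewrite -lez_nat.
apply: leq_trans jx _; rewrite -ltnS -(ltr_nat R) -natr1.
have : `|(entries q sig)%:R - (entries q x)%:R| < 1 :> R by near: x; exact: near_sig.
by rewrite ltr_norml => /andP[+ _]; lra.
Unshelve. all: by end_near. Qed.

Lemma departures_split (t : R) : 0 <= t ->
  (departures q t)%:R = (in_service0 q)%:R - (count_remaining q t)%:R +
    \sum_(i < entries q t) (requirement q i.+1%:Z <= t - entry_time q i.+1%:Z)%R%:R :> R.
Proof.
move=> t0; rewrite /departures big_split_ord/= natrD; congr (_ + _).
  rewrite /count_remaining !natr_sum -[X in X%:R - _]card_ord -sum1_card natr_sum -sumrB.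
  apply: eq_bigr => i _; have [_ l0] := initial_label (ltn_ord i).
  rewrite /age l0 eq_minr leNgt.
  by case: (_ < _); rewrite ?subrr ?subr0.
rewrite natr_sum; apply: eq_bigr => i _; congr ((nat_of_bool _)%:R).
have -> : label q (rshift (in_service0 q) i) = i.+1%:Z.
  by rewrite /label /= -addnS PoszD addrC addKr.
rewrite /age (_ : (i.+1%:Z <= 0) = false)//.
rewrite eq_minr; congr (_ <= _); apply/max_idPl; rewrite subr_ge0.
by apply: entry_time_le; rewrite // ltn_ord.
Qed.

(** Each customer contributes the integral of [g] over the time since the entry.
    This sum is what the number of departures among the new customers is compared
    with. *)
Lemma entries_convolution (t : R) : 0 <= t ->
  \int[leb]_(u in `[0, t]) (g u * (entries q (t - u))%:R) =
  \sum_(i < entries q t) G (t - entry_time q i.+1%:Z).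
Proof.
move=> t0; have e_le (i : 'I_(entries q t)) : entry_time q i.+1%:Z <= t.
  by apply: entry_time_le; rewrite // ltn_ord.
have iE (i : 'I_(entries q t)) (u : R) : 0 <= u <= t ->
    (u <= t - entry_time q i.+1%:Z) = (i < entries q (t - u))%N.
  move=> /andP[u0 ut]; rewrite lerBrDr -lerBrDl; apply/idP/idP => h.
    by apply: (@entries_entry_time _ _ t) => //; rewrite subr_ge0.
  by apply: entry_time_le => //; rewrite subr_ge0.
have gi : leb.-integrable `[0, t] (EFin \o g).
  by apply: (density_integrable hG) => //; exact: subset_itvl.
transitivity (\int[leb]_(u in `[0, t]) \sum_(i < entries q t)
    (g u * \1_(`[0, t - entry_time q i.+1%:Z]%classic) u)).
  apply: eq_Rintegral => u; rewrite inE /= in_itv/= => ut.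
  rewrite -mulr_sumr; congr (_ * _).
  have -> : (entries q (t - u))%:R = \sum_(i < entries q t) (i < entries q (t - u))%N%:R :> R.
    have le : (entries q (t - u) <= entries q t)%N.
      by case/andP: ut => u0 ut; apply: entries_le; rewrite ?subr_ge0 ?gerBl.
    rewrite -natr_sum; congr (_%:R).
    transitivity (\sum_(i < entries q t | (i < entries q (t - u))%N) 1)%N.
      by rewrite -(big_ord_widen _ (fun=> 1%N) le) sum1_card card_ord.
    by rewrite big_mkcond; apply: eq_bigr => i _; case: (_ < _)%N.
  apply: eq_bigr => i _; rewrite -iE// indicE; congr ((nat_of_bool _)%:R).
  have /andP[u0 _] := ut.
  by apply/idP/idP => [h|/set_mem]; [apply/mem_set|]; rewrite /= in_itv/= u0.
have gii (i : 'I_(entries q t)) : leb.-integrable `[0, t]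
    (EFin \o (fun u => g u * \1_(`[0, t - entry_time q i.+1%:Z]%classic) u)).
  apply: (integrable_mul_bounded (B := 1)) => // u _.
  by rewrite indicE; case: (_ \in _); rewrite ?normr1 ?normr0.
have mI : measurable (`[0, t]%classic : set R) by [].
rewrite /Rintegral.
under eq_integral do rewrite -sumEFin.
rewrite (@integral_sum _ _ R leb _ mI _ _ gii).
rewrite (eq_bigr (fun i : 'I_(entries q t) => (\int[leb]_(u in `[0, t])
    (g u * \1_(`[0, t - entry_time q i.+1%:Z]%classic) u))%:E)); last first.
  by move=> i _; rewrite /Rintegral fineK//; exact: integrable_fin_num (gii i).
rewrite sumEFin/=; apply: eq_bigr => i _; rewrite (cdf_Rintegral hG).
have sE : `[0, t - entry_time q i.+1%:Z]%classic `&` (`[0, t]%classic : set R) =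
    `[0, t - entry_time q i.+1%:Z]%classic.
  apply/setIidPl; apply: subset_itvl; rewrite bnd_simp.
  by rewrite gerBl entry_time_ge0.
rewrite -[X in _ = Rintegral _ X _]sE Rintegral_mkcondl; apply: eq_Rintegral => u _.
by rewrite patch_indic.
Qed.

Lemma count_remaining_le s t : s <= t ->
  (count_remaining q t <= count_remaining q s)%N.
Proof.
move=> st; apply: leq_sum => i _; case: (ltP (_ + t)) => // h.
by rewrite (le_lt_trans _ h)// lerD2l.
Qed.

End path_dynamics.

(** * Convergence of departures and entries *)

Section block_estimate.
Context {R : realType}.

Lemma initial_segment (P : pred nat) n :
  (forall i j, (i <= j)%N -> (j < n)%N -> P j -> P i) ->
  exists b, [/\ (b <= n)%N, (forall i, (i < b)%N -> P i) &
    forall i, (b <= i)%N -> (i < n)%N -> ~~ P i].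
Proof.
elim: n => [|n IHn] dc.
  by exists 0%N; split=> // i; rewrite ltn0.
have [|b [bn Pb nPb]] := IHn; first by move=> i j ij jn; apply: dc => //; exact: ltnW.
have [Pn|nPn] := boolP (P n).
  exists n.+1; split=> // i; first by move=> i_n; exact: (dc i n).
  by move=> n_i; rewrite ltnNge n_i.
exists b; split=> // [|i bi]; first exact: leqW.
by rewrite ltnS leq_eqVlt => /predU1P[->//|]; exact: nPb.
Qed.

(** If the [x i] are nonincreasing, then the indices for which [x i] is in an
    interval [[p dl, (p + 1) dl[] are consecutive. On such a block, the indicator
    of [v i <= x i] is between those of [v i <= p dl] and [v i <= (p + 1) dl], and
    the sums of these are controlled. *)
Lemma block_estimate (n L : nat) (x v : nat -> R) (G : R -> R) (dl w eta : R) :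
  (forall i j, (i <= j)%N -> (j < n)%N -> x j <= x i) ->
  (forall i, (i < n)%N -> 0 <= x i) -> (forall i, (i < n)%N -> x i < L%:R * dl) ->
  {homo G : s t / s <= t} ->
  (forall p, (p < L)%N -> G (p.+1%:R * dl) - G (p%:R * dl) <= w) ->
  (forall p b, (p <= L)%N -> (b <= n)%N ->
    `|\sum_(i < b) (v i <= p%:R * dl)%R%:R - b%:R * G (p%:R * dl)| <= eta) ->
  `|\sum_(i < n) ((v i <= x i)%R%:R - G (x i))| <= n%:R * w + 2 * L%:R * eta.
Proof.
move=> x_ni x_ge0 x_lt ndG Gw count.
pose D b := \sum_(i < b) ((v i <= x i)%R%:R - G (x i)).
(* Induction from the oldest block: [k] blocks, the times beyond [L - k] meshes. *)
suff H k : (k <= L)%N -> forall b, (b <= n)%N ->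
    (forall i, (i < b)%N -> (L - k)%:R * dl <= x i) ->
    `|D b| <= b%:R * w + 2 * k%:R * eta.
  by apply: H => // i i_n; rewrite subnn mul0r x_ge0.
elim: k => [|k IHk] kL b bn xb.
  have b0 : b = 0%N.
    apply/eqP; rewrite -leqn0 leqNgt; apply/negP => b0.
    have := xb 0%N b0; rewrite subn0 leNgt x_lt//.
    exact: leq_trans bn.
  by rewrite b0 /D big_ord0 normr0 mulr0 !mul0r addr0.
pose p := (L - k.+1)%N.
have pS : (L - k)%N = p.+1 by rewrite /p subnSK.
have pL : (p < L)%N by rewrite -pS leq_subr.
have [|a [ab xa xa']] := @initial_segment (fun i => (L - k)%:R * dl <= x i) b.
  move=> i j ij jb /le_trans; apply; apply: x_ni => //; exact: leq_trans bn.
have an : (a <= n)%N by exact: leq_trans bn.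
have {IHk} Da := IHk (ltnW kL) a an xa.
have split_sum (f : nat -> R) :
    \sum_(i < b) f i = \sum_(i < a) f i + \sum_(a <= i < b) f i.
  by rewrite -!(big_mkord predT f)/= (@big_cat_nat _ _ _ a).
have cp := count p b (ltnW pL) bn; have cp' := count p a (ltnW pL) an.
have cq := count p.+1 b pL bn; have cq' := count p.+1 a pL an.
pose m : R := (b - a)%:R; have mE : b%:R = a%:R + m by rewrite -natrD subnKC.
have m0 : 0 <= m by [].
have sum_cst (y : R) : \sum_(a <= i < b) y = m * y by rewrite big_const_nat iter_addr_0 mulr_natl.
have low : \sum_(a <= i < b) (v i <= p%:R * dl)%R%:R - m * G (p.+1%:R * dl) <=
    \sum_(a <= i < b) ((v i <= x i)%R%:R - G (x i)).
  rewrite -sum_cst -sumrB big_nat [leRHS]big_nat; apply: ler_sum => i /andP[ai ib].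
  apply: lerB.
    by rewrite ler_nat; case: leP => // vi; rewrite (le_trans vi)// xb.
  apply: ndG; rewrite -pS; apply/ltW; rewrite ltNge; exact: xa'.
have up : \sum_(a <= i < b) ((v i <= x i)%R%:R - G (x i)) <=
    \sum_(a <= i < b) (v i <= p.+1%:R * dl)%R%:R - m * G (p%:R * dl).
  rewrite -sum_cst -sumrB big_nat [leRHS]big_nat; apply: ler_sum => i /andP[ai ib].
  have xp : x i <= p.+1%:R * dl by rewrite -pS; apply/ltW; rewrite ltNge; exact: xa'.
  apply: lerB; last by apply: ndG; exact: xb.
  by rewrite ler_nat; case: (leP (v i) (x i)) => // vi; rewrite (le_trans vi).
have Db : D b = D a + \sum_(a <= i < b) ((v i <= x i)%R%:R - G (x i)).
  exact: split_sum.
have sp := split_sum (fun i => (v i <= p%:R * dl)%R%:R).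
have sq := split_sum (fun i => (v i <= p.+1%:R * dl)%R%:R).
have mw : m * (G (p.+1%:R * dl) - G (p%:R * dl)) <= m * w by apply: ler_wpM2l => //; exact: Gw.
have kE : 2 * k.+1%:R * eta = 2 * k%:R * eta + 2 * eta.
  by rewrite (_ : k.+1%:R = k%:R + 1 :> R) ?natr1//; ring.
move: Da cp cp' cq cq' low up mw; rewrite Db sp sq !ler_norml kE mE mulrBr.
rewrite !(mulrDl a%:R m).
move: (D a) (\sum_(i < a) _) (\sum_(i < a) _) (\sum_(a <= i < b) _).
move: (\sum_(a <= i < b) _) (\sum_(a <= i < b) _) => s1 s2 d1 s3 s4 s5.
move: (a%:R * w) (m * w) (2 * k%:R * eta) (a%:R * _) (a%:R * _) (m * _) (m * _).
by move=> *; lra.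
Qed.

End block_estimate.

Section measurable_paths.
Context {R : realType}.

Lemma path_measurable (f : R -> R) (t : R) :
  measurable_fun setT (fun s : R => f (Num.max s 0)) ->
  measurable_fun `[0, t] f /\ measurable_fun `[0, t] (fun u => f (t - u)).
Proof.
move=> mf; split.
  apply: (@eq_measurable_fun _ _ _ _ `[0, t]%classic (fun s : R => f (Num.max s 0))).
    by move=> s; rewrite inE /= in_itv/= => /andP[s0 _]; rewrite (max_idPl s0).
  exact: measurable_funTS.
apply: (@eq_measurable_fun _ _ _ _ `[0, t]%classic
  (fun u : R => f (Num.max (t - u) 0))).
  move=> u; rewrite inE /= in_itv/= => /andP[_ ut].
  by rewrite (max_idPl _)// subr_ge0.
apply: measurable_funTS; apply: (measurableT_comp (f := fun s : R => f (Num.max s 0))) => //.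
exact: measurable_funB.
Qed.

Lemma nondecreasing_path_measurable (f : R -> R) : nondecreasing_path f ->
  measurable_fun setT (fun s : R => f (Num.max s 0)).
Proof.
move=> ndf; apply: nondecreasing_measurable => // s t st.
apply: ndf; first by rewrite le_max lexx orbT.
by rewrite ge_max !le_max st lexx orbT.
Qed.

End measurable_paths.

Section uniform_lln.
Context {R : realType}.
Variables (q : nat -> queue R) (y p : R).
Hypothesis p0 : 0 <= p.
Hypothesis lln : forall i m : nat,
  (count_new (q N) y ((i * N) %/ m.+1))%:R / N%:R @[N --> \oo] --> i%:R / m.+1%:R * p.

Lemma truncn_frac (i m N : nat) :
  Num.truncn (i%:R / m.+1%:R * N%:R : R) = ((i * N) %/ m.+1)%N.
Proof.
apply/eqP; rewrite truncn_eq ?mulr_ge0// mulrAC -natrM.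
rewrite ler_pdivlMr// ltr_pdivrMr// -!natrM ler_nat ltr_nat.
by rewrite leq_divM mulnC -ltn_divLR//= ltnSn.
Qed.

Lemma count_new_le (a b : nat) N : (a <= b)%N ->
  (count_new (q N) y a <= count_new (q N) y b)%N.
Proof.
move=> ab; rewrite /count_new -!(big_mkord predT (fun i => nat_of_bool
  (requirement (q N) i.+1%:Z <= y))) (@big_cat_nat _ _ _ a 0 b)//=.
exact: leq_addr.
Qed.

(** [polya] for the number of customers, in units of [N], as the parameter. *)
Lemma count_new_uniform (C e : R) : 0 < e ->
  \forall N \near \oo, forall n : nat, n%:R <= C * N%:R ->
    `|(count_new (q N) y n)%:R - n%:R * p| <= e * N%:R.
Proof.
move=> e0; pose f (N : nat) (s : R) : R :=
  (count_new (q N) y (Num.truncn (s * N%:R)))%:R / N%:R.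
have f_nd N s t : 0 <= s -> s <= t -> f N s <= f N t.
  move=> s0 st; rewrite /f ler_wpM2r ?invr_ge0// ler_nat.
  by apply: count_new_le; apply: le_truncn; rewrite ler_wpM2r.
have ucp : locally_uc (fun s : R => s * p).
  move=> T r r0; have p1 : 0 < p + 1 by rewrite ltr_wpDl.
  exists (r / (p + 1)); first by rewrite divr_gt0.
  move=> s t _ _ st; rewrite -mulrBl normrM (ger0_norm p0).
  have := ler_wpM2r p0 (ltW st); move/le_trans; apply.
  rewrite mulrAC ler_pdivrMr// ler_wpM2l ?lerDl//; exact: ltW.
have f_cvg k m : f N (k%:R / m.+1%:R) @[N --> \oo] --> k%:R / m.+1%:R * p.
  by under eq_fun do rewrite /f truncn_frac; exact: lln.
have near_polya := polya C f_nd ucp f_cvg e0; near=> N => n nC.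
have N0 : (0 < N)%N by near: N; exact: nbhs_infty_gt.
have NR0 : 0 < N%:R :> R by rewrite ltr0n.
have H : forall s, 0 <= s <= C -> `|f N s - s * p| <= e by near: N.
have := H (n%:R / N%:R); rewrite divr_ge0//= ler_pdivrMr// nC => /(_ isT).
rewrite /f divfK ?gt_eqF// natrK mulrAC -mulrBl normrM [X in _ * X]gtr0_norm ?invr_gt0//.
by rewrite ler_pdivrMr.
Unshelve. all: by end_near. Qed.

End uniform_lln.

Section fluid_limit.
Context {R : realType}.
Notation leb := (@lebesgue_measure R).
Variables (g G : R -> R).
Hypothesis hG : service_distribution g G.
Hypothesis hh : {within ages G, continuous (hazard g G)}.
Variables (E : R -> R) (x0 : R) (nu0 : {measure set R -> \bar R}).
Variables (X : R -> R) (nu : R -> {measure set R -> \bar R}).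
Hypothesis data : initial_data G E x0 nu0.
Hypothesis sol : fluid_solution G (hazard g G) E x0 nu0 X nu.
Variable q : nat -> queue R.
Hypothesis dyn : forall N, (0 < N)%N -> queue_dynamics G N (q N).
Hypothesis arrivals_uniform : forall T e : R, 0 < e -> \forall N \near \oo,
  forall t, 0 <= t <= T -> `|(arrivals (q N) t)%:R / N%:R - E t| <= e.
Hypothesis x0_cvg : (in_system0 (q N))%:R / N%:R @[N --> \oo] --> x0.
Hypothesis remaining_cvg : forall i m : nat,
  (count_remaining (q N) (i%:R / m.+1%:R))%:R / N%:R @[N --> \oo] -->
  mean_survival G (i%:R / m.+1%:R) nu0.
Hypothesis new_cvg : forall i m k l : nat,
  (count_new (q N) (k%:R / l.+1%:R) ((i * N) %/ m.+1))%:R / N%:R @[N --> \oo]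
    --> i%:R / m.+1%:R * G (k%:R / l.+1%:R).

Local Notation K := (fluid_K G (hazard g G) nu).
Local Notation D := (fluid_D G (hazard g G) nu).

Let new_departures N t : R := \sum_(i < entries (q N) t)
  (requirement (q N) i.+1%:Z <= t - entry_time (q N) i.+1%:Z)%R%:R.

Lemma mean_survival0 : mean_survival G 0 nu0 = mass G nu0.
Proof.
apply: eq_Rintegral => x /set_mem /(agesP hG)[_ Gx].
by rewrite /survival addr0 divff// gt_eqF// subr_gt0.
Qed.

Lemma count_remaining0 N : (0 < N)%N ->
  count_remaining (q N) 0 = in_service0 (q N).
Proof.
move=> N0; rewrite /count_remaining -[RHS]card_ord -sum1_card.
apply: eq_bigr => i _; have [l1 l2] := @initial_label R (q N) i (ltn_ord i).
by have [_ av] := initial_ages (dyn N0) l1 l2; rewrite addr0 av.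
Qed.

Lemma initial_departures_uniform (T e : R) : 0 < e -> \forall N \near \oo,
  forall t, 0 <= t <= T ->
  `|((in_service0 (q N))%:R - (count_remaining (q N) t)%:R) / N%:R -
    (mass G nu0 - mean_survival G t nu0)| <= e.
Proof.
move=> e0.
apply: (polya (f_ := fun N t => ((in_service0 (q N))%:R -
  (count_remaining (q N) t)%:R) / N%:R)
  (f := fun t => mass G nu0 - mean_survival G t nu0)) => //.
- move=> N s t s0 st; rewrite ler_wpM2r ?invr_ge0// lerD2l lerN2 ler_nat.
  exact: count_remaining_le.
- move=> S r r0; have [d d0 Hd] := mean_survival_uc hG (data_nu0 data) r0.
  exists d => // s t /andP[s0 _] /andP[t0 _] st.
  have -> : forall a b c : R, a - b - (a - c) = c - b by move=> *; ring.
  by rewrite distrC; exact: Hd.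
- move=> k m; have h0 := @remaining_cvg 0%N 0%N; rewrite mul0r in h0.
  have {}h0 : (in_service0 (q N))%:R / N%:R @[N --> \oo] --> mass G nu0.
    rewrite -mean_survival0; apply: cvg_trans h0; apply: near_eq_cvg; near=> N.
    by rewrite count_remaining0//; near: N; exact: nbhs_infty_gt.
  under eq_fun do rewrite mulrBl.
  by apply: cvgB; [exact: h0|exact: (@remaining_cvg k m)].
Unshelve. all: by end_near. Qed.

Lemma entries_bounded (T : R) : exists2 C : R, 0 < C & \forall N \near \oo,
  forall t, 0 <= t <= T -> (entries (q N) t)%:R <= C * N%:R.
Proof.
have x0_ge0 := data_x0_ge0 data.
exists (`|E T| + x0 + 2); first by rewrite ltr_wpDl// addr_ge0.
have /cvgrPdist_le/(_ _ ltr01) near_x := x0_cvg.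
have near_A := arrivals_uniform T ltr01.
near=> N => t tT; have N0 : (0 < N)%N by near: N; exact: nbhs_infty_gt.
have NR0 : 0 < N%:R :> R by rewrite ltr0n.
have /andP[t0 tT'] := tT.
have EtT := data_E_nd data t0 tT'.
have hA : `|(arrivals (q N) t)%:R / N%:R - E t| <= 1.
  by move: t tT {t0 tT' EtT}; near: N.
have : `|x0 - (in_system0 (q N))%:R / N%:R| <= 1 by near: N.
rewrite ler_norml => /andP[hx _].
rewrite -ler_pdivrMr// (entries_reflection (dyn N0) t0).
apply: (@le_trans _ _ ((arrivals (q N) t)%:R / N%:R + (in_system0 (q N))%:R / N%:R)).
  rewrite -mulrDl ler_wpM2r ?invr_ge0// lerBlDr -addrA lerD2l.
  apply: (@le_trans _ _ (in_system0 (q N))%:R); last first.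
    by rewrite lerDl le_max lexx orbT.
  by rewrite ge_max gerBl !ler0n.
move: hA; rewrite ler_norml => /andP[_ hA]; have := ler_norm (E T).
move: hA hx EtT; move: (_ / _) (_ / _) => a b; lra.
Unshelve. all: by end_near. Qed.

(** The times since the entry decrease with the label, so that [block_estimate]
    applies; its hypothesis on initial segments holds eventually for all the
    random numbers of entries, by [count_new_uniform]. *)
Lemma new_departures_uniform (T e : R) : 0 < e -> \forall N \near \oo,
  forall t, 0 <= t <= T ->
  `|new_departures N t -
    \int[leb]_(u in `[0, t]) (g u * (entries (q N) (t - u))%:R)| <= e * N%:R.
Proof.
move=> e0; have [C C0 near_C] := entries_bounded T.
have w0 : 0 < e / (2 * C) by rewrite divr_gt0// mulr_gt0.
have [d d0 Hd] := cdf_uniformly_continuous hG w0.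
pose l := Num.truncn d^-1; pose dl : R := l.+1%:R^-1.
have dl0 : 0 < dl by rewrite invr_gt0.
have dld : dl < d by rewrite invf_plt ?posrE// /l truncnS_gt.
pose L := (Num.truncn (T * l.+1%:R)).+1.
have TL : T < L%:R * dl by rewrite ltr_pdivlMr// truncnS_gt.
have L0 : 0 < L%:R :> R by rewrite ltr0n.
have eta0 : 0 < e / (4 * L%:R) by rewrite divr_gt0// mulr_gt0.
have near_lln : \forall N \near \oo, forall p : 'I_L.+1, forall n : nat,
    n%:R <= C * N%:R ->
    `|(count_new (q N) (p%:R * dl) n)%:R - n%:R * G (p%:R * dl)| <=
    e / (4 * L%:R) * N%:R.
  apply: filter_forall => p; apply: count_new_uniform eta0.
    exact: cdf_ge0 hG _.
  by move=> i m; exact: (@new_cvg).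
near=> N => t tT; have N0 : (0 < N)%N by near: N; exact: nbhs_infty_gt.
have /andP[t0 tT'] := tT; have dynN := dyn N0.
have KC : (entries (q N) t)%:R <= C * N%:R by move: t tT {t0 tT'}; near: N.
have lln : forall p : 'I_L.+1, forall n : nat, n%:R <= C * N%:R ->
    `|(count_new (q N) (p%:R * dl) n)%:R - n%:R * G (p%:R * dl)| <=
    e / (4 * L%:R) * N%:R by near: N.
rewrite (entries_convolution hG dynN t0) -sumrB.
have e_le i : (i < entries (q N) t)%N -> entry_time (q N) i.+1%:Z <= t.
  by move=> it; apply: entry_time_le.
have := @block_estimate R (entries (q N) t) L
  (fun i => t - entry_time (q N) i.+1%:Z) (fun i => requirement (q N) i.+1%:Z)
  G dl (e / (2 * C)) (e / (4 * L%:R) * N%:R).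
move=> H; apply: le_trans (H _ _ _ _ _ _) _ => {H}.
- move=> i j ij jt; rewrite lerD2l lerN2; apply: entry_time_le.
    exact: entry_time_ge0.
  apply: leq_ltn_trans ij _.
  by apply: (entries_entry_time dynN t0 jt) => //; exact: entry_time_ge0.
- by move=> i it; rewrite subr_ge0 e_le.
- move=> i it; apply: le_lt_trans TL; apply: le_trans tT'.
  by rewrite gerBl entry_time_ge0.
- by move=> s u; exact: (cdf_nd hG).
- move=> p pL; apply/ltW; apply: le_lt_trans (ler_norm _) _; apply: Hd.
  by rewrite -mulrBl -natrB ?leqnSn// subSnn mul1r gtr0_norm.
- move=> p b pL bt; rewrite -natr_sum.
  apply: (lln (Ordinal (pL : (p < L.+1)%N)) b).
  by apply: le_trans KC; rewrite ler_nat.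
have -> : 2 * L%:R * (e / (4 * L%:R) * N%:R) = e / 2 * N%:R.
  by field; rewrite gt_eqF.
have : (entries (q N) t)%:R * (e / (2 * C)) <= C * N%:R * (e / (2 * C)).
  by rewrite ler_wpM2r// ltW.
have -> : C * N%:R * (e / (2 * C)) = e / 2 * N%:R by field; rewrite gt_eqF.
move=> h; apply: le_trans (lerD h (lexx _)) _.
by rewrite -mulrDl -splitr.
Unshelve. all: by end_near. Qed.

Lemma fluid_K_measurable : measurable_fun setT (fun s : R => K (Num.max s 0)).
Proof.
have [F1 [F2 KF]] := fluid_K_difference hG sol.
have mF (F : cumulative R R) : measurable_fun setT (fun s : R => F (Num.max s 0)).
  apply: nondecreasing_path_measurable => s t _ st.
  exact: cumulative_is_nondecreasing.
have -> : (fun s : R => K (Num.max s 0)) =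
    (fun s : R => F1 (Num.max s 0) - F2 (Num.max s 0)).
  by apply/funext => s; rewrite KF// le_max lexx orbT.
exact: measurable_funB.
Qed.

Lemma max0_lip (a b : R) : `|Num.max a 0 - Num.max b 0| <= `|a - b|.
Proof.
wlog ab : a b / a <= b.
  move=> H; have [|/ltW] := leP a b; first exact: H.
  by rewrite distrC (distrC a); exact: H.
rewrite distrC (distrC a) !ger0_norm ?subr_ge0//; last first.
  by rewrite ge_max !le_max ab lexx orbT.
have [b0|/ltW b0] := leP b 0; first by rewrite (max_idPr (le_trans ab b0)) subrr subr_ge0.
by rewrite lerD2l lerN2 le_max lexx.
Qed.

(** The deviations of the departures and of the entries satisfy the hypotheses of
    [volterra_stability]: the errors come from the arrivals, the initial data and
    the laws of large numbers, and the positive part is 1-Lipschitz. *)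
Lemma departures_entries_cvg (T e : R) : 0 < e -> \forall N \near \oo,
  forall t, 0 <= t <= T ->
  `|(departures (q N) t)%:R / N%:R - D t| <= e /\
  `|(entries (q N) t)%:R / N%:R - K t| <= e.
Proof.
move=> e0.
have [c c0 stable] := volterra_stability (density_measurable hG)
  (density_ge0 hG) (density_total hG) T.
(* [c * r] bounds the deviation of the departures, [c * r + r = e] that of the
   entries. *)
pose r := e / (c + 1); have r0 : 0 < r by rewrite divr_gt0// addr_gt0.
have r40 : 0 < r / 4 by rewrite divr_gt0.
have near_A := arrivals_uniform T r40.
have /cvgrPdist_le/(_ _ r40) near_x := x0_cvg.
have near_I := initial_departures_uniform T r40.
have near_N := new_departures_uniform T r40.
have [C C0 near_C] := entries_bounded T.
have [B [_ KB]] := fluid_K_bounded hG sol T.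
have mK := fluid_K_measurable.
near=> N; have N0 : (0 < N)%N by near: N; exact: nbhs_infty_gt.
have NR0 : 0 < N%:R :> R by rewrite ltr0n.
have dynN := dyn N0.
have hA : forall t, 0 <= t <= T -> `|(arrivals (q N) t)%:R / N%:R - E t| <= r / 4
  by near: N.
have hx : `|x0 - (in_system0 (q N))%:R / N%:R| <= r / 4 by near: N.
have hI : forall t, 0 <= t <= T ->
  `|((in_service0 (q N))%:R - (count_remaining (q N) t)%:R) / N%:R -
    (mass G nu0 - mean_survival G t nu0)| <= r / 4 by near: N.
have hN : forall t, 0 <= t <= T -> `|new_departures N t -
    \int[leb]_(u in `[0, t]) (g u * (entries (q N) (t - u))%:R)| <= r / 4 * N%:R
  by near: N.
have hC : forall t, 0 <= t <= T -> (entries (q N) t)%:R <= C * N%:R by near: N.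
pose KN t : R := (entries (q N) t)%:R / N%:R.
pose d t : R := (departures (q N) t)%:R / N%:R - D t.
pose w t : R := KN t - K t.
have mKN : measurable_fun setT (fun s : R => KN (Num.max s 0)).
  apply: nondecreasing_path_measurable => s t s0 st.
  by rewrite /KN ler_wpM2r ?invr_ge0//; exact: entries_nd dynN _ _ s0 st.
have KN_bound t : 0 <= t <= T -> `|KN t| <= C.
  by move=> tT; rewrite ger0_norm ?divr_ge0// ler_pdivrMr// hC.
have K_bound t : 0 <= t <= T -> `|K t| <= B.
  move=> /andP[t0 tT]; have := KB (T - t); rewrite subKr; apply.
  by rewrite subr_ge0 tT gerBl.
have mw : measurable_fun `[0, T] w.
  have mw0 : measurable_fun setT (fun s : R => w (Num.max s 0)) by exact: measurable_funB.
  exact: (path_measurable T mw0).1.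
have w_bound t : 0 <= t <= T -> `|w t| <= C + B.
  by move=> tT; rewrite (le_trans (ler_normB _ _))// lerD ?KN_bound ?K_bound.
have wd t : 0 <= t <= T -> `|w t| <= `|d t| + r.
  move=> tT; have /andP[t0 _] := tT.
  rewrite /w /KN (entries_reflection dynN t0) (fluid_entries data sol t0).
  set m1 := Num.max _ _; set m2 := Num.max _ _.
  set m3 := Num.max _ _; set m4 := Num.max _ _.
  pose A := (arrivals (q N) t)%:R / N%:R : R.
  pose x := (in_system0 (q N))%:R / N%:R : R.
  pose DN := (departures (q N) t)%:R / N%:R : R.
  have scale y : Num.max (y - N%:R) 0 / N%:R = Num.max (y / N%:R - 1) 0 :> R.
    by rewrite maxr_pMl ?invr_ge0// mul0r mulrBl divff// gt_eqF.
  have m1E : m1 / N%:R = Num.max (x - 1) 0 by exact: scale.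
  have m2E : m2 / N%:R = Num.max (x + A - DN - 1) 0.
    by rewrite scale /in_system mulrBl mulrDl.
  rewrite mulrBl mulrDl m1E m2E.
  have h1 := max0_lip (x - 1) (x0 - 1).
  have h2 := max0_lip (x + A - DN - 1) (x0 + E t - D t - 1).
  have hAt := hA t tT.
  have h3 : `|x - x0| <= r / 4 by rewrite distrC.
  have h4 : `|x + A - DN - 1 - (x0 + E t - D t - 1)| <= r / 4 + r / 4 + `|d t|.
    have -> : x + A - DN - 1 - (x0 + E t - D t - 1) = (x - x0) + (A - E t) - d t.
      by rewrite /d -/DN; ring.
    by rewrite (le_trans (ler_normB _ _))// lerD2r (le_trans (ler_normD _ _))// lerD.
  rewrite -/A -/m3 -/m4 in h1 h2 *; move: h1; rewrite opprB addrA subrK => h1.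
  have -> : A + Num.max (x - 1) 0 - Num.max (x + A - DN - 1) 0 - (E t + m3 - m4) =
      (A - E t) + (Num.max (x - 1) 0 - m3) - (Num.max (x + A - DN - 1) 0 - m4) by ring.
  apply: le_trans (ler_normB _ _) _.
  apply: le_trans (lerD (ler_normD _ _) (lexx _)) _.
  move: (le_trans h1 h3) (le_trans h2 h4) hAt; rewrite -/A.
  move: `|A - E t| `|_ - m3| `|_ - m4| `|d t| => a1 a2 a3 a4; lra.
have dw t : 0 <= t <= T ->
    `|d t| <= r + `|\int[leb]_(u in `[0, t]) (g u * w (t - u))|.
  move=> tT; have /andP[t0 tT'] := tT.
  have gi : leb.-integrable `[0, t] (EFin \o g).
    by apply: (density_integrable hG) => //; exact: subset_itvl.
  have i1 : leb.-integrable `[0, t] (EFin \o (fun u => g u * KN (t - u))).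
    apply: (integrable_mul_bounded (B := C)) => //.
      exact: (path_measurable t mKN).2.
    move=> u; rewrite /= in_itv/= => /andP[u0 ut]; apply: KN_bound; rewrite subr_ge0 ut (le_trans _ tT')//.
    by rewrite gerBl.
  have i2 : leb.-integrable `[0, t] (EFin \o (fun u => g u * K (t - u))).
    apply: (integrable_mul_bounded (B := B)) => //.
      exact: (path_measurable t mK).2.
    move=> u; rewrite /= in_itv/= => /andP[u0 ut]; apply: K_bound; rewrite subr_ge0 ut (le_trans _ tT')//.
    by rewrite gerBl.
  have mI : measurable (`[0, t]%classic : set R) by [].
  have wE : \int[leb]_(u in `[0, t]) (g u * w (t - u)) =
      \int[leb]_(u in `[0, t]) (g u * KN (t - u)) -
      \int[leb]_(u in `[0, t]) (g u * K (t - u)).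
    rewrite -(@RintegralB _ _ R leb _ _ _ mI i1 i2).
    by apply: eq_Rintegral => u _; rewrite -mulrBr.
  have i0 : leb.-integrable `[0, t]
      (EFin \o (fun u => g u * (entries (q N) (t - u))%:R)).
    have := @integrableZl _ _ R leb _ mI N%:R _ i1; apply: eq_integrable => // u _.
    by rewrite /= -EFinM mulrCA /KN (mulrC N%:R) divfK ?gt_eqF.
  have KNE : \int[leb]_(u in `[0, t]) (g u * KN (t - u)) =
      (\int[leb]_(u in `[0, t]) (g u * (entries (q N) (t - u))%:R)) / N%:R.
    rewrite mulrC -RintegralZl//.
    by apply: eq_Rintegral => u _; rewrite /KN [RHS]mulrCA (mulrC N%:R^-1).
  rewrite wE KNE /d (departures_split (q N) t0) (fluid_departures hG hh data sol t0).
  move: (hI t tT) (hN t tT); rewrite -/(new_departures N t).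
  set I1 := \int[leb]_(u in _) _; set I2 := \int[leb]_(u in _) _.
  set nd := new_departures N t => hIt hNt.
  have hNt' : `|(nd - I1) / N%:R| <= r / 4.
    by rewrite normrM [X in _ * X]gtr0_norm ?invr_gt0// ler_pdivrMr.
  rewrite mulrDl; move: hIt; set J1 := _ / N%:R; set J2 := mass G nu0 - _ => hIt.
  have -> : J1 + nd / N%:R - (J2 + I2) = (J1 - J2) + (nd - I1) / N%:R + (I1 / N%:R - I2).
    by ring.
  apply: le_trans (ler_normD _ _) _; rewrite lerD2r.
  apply: le_trans (ler_normD _ _) _; apply: le_trans (lerD hIt hNt') _.
  by lra.
move=> t tT; have dt : `|d t| <= c * r := stable d w r (C + B) (ltW r0) mw w_bound wd dw t tT.
have cr : c * r + r = e.
  by rewrite -[X in _ + X]mul1r -mulrDl /r mulrC divfK// gt_eqF// addr_gt0.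
split.
  by rewrite -/(d t) (le_trans dt)// -cr lerDl ltW.
by rewrite -/(w t) (le_trans (wd t tT))// -cr lerD2r.
Unshelve. all: by end_near. Qed.

End fluid_limit.

(** * Inverses of increasing paths *)

Section inverses.
Context {R : realType}.
Implicit Types (f : R -> R) (s t y : R).

Definition real_inv f y : R := inf [set s | 0 <= s /\ y <= f s].

Lemma invE f y s : 0 <= s -> y <= f s -> Defs.inv f y = (real_inv f y)%:E.
Proof.
move=> s0 ys; rewrite /Defs.inv ereal_inf_EFin//; last by exists s.
by exists 0 => u [].
Qed.

Lemma real_inv_ge0 f y : 0 <= real_inv f y.
Proof.
rewrite /real_inv; set A := [set _ | _].
have [A0|A0] := pselect (A !=set0); last by rewrite inf_out// => -[].
by apply: lb_le_inf => // t [].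
Qed.

Lemma real_inv_lt f y u : (exists s, 0 <= s /\ y <= f s) ->
  (real_inv f y < u <-> exists s, [/\ 0 <= s, s < u & y <= f s]).
Proof.
move=> ne; split=> [lu|[s [s0 su ys]]].
  by have [s [s0 ys] su] := inf_lt ne lu; exists s.
by apply: le_lt_trans su; apply: ge_inf; [exists 0 => t []|split].
Qed.

(** By the slope of [f], the path [f_] has reached the level [y_] at the time
    [k + 2 * d / theta], and not yet before [k - 2 * d / theta]. *)
Lemma real_inv_stability f (f_ : R -> R) (theta d T k y y_ : R) :
  0 < theta -> 0 <= d ->
  (forall s t, 0 <= s -> s <= t -> theta * (t - s) <= f t - f s) ->
  (forall s, 0 <= s <= T -> `|f_ s - f s| <= d) -> `|y_ - y| <= d ->
  0 <= k -> f k = y -> k + 2 * d / theta <= T ->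
  `|real_inv f_ y_ - k| <= 2 * d / theta.
Proof.
move=> th0 d0 slope ff yy k0 fk kT; set r := 2 * d / theta.
have r0 : 0 <= r by rewrite divr_ge0// ?mulr_ge0// ltW.
have thr : theta * r = 2 * d by rewrite /r mulrC divfK// gt_eqF.
have hit : y_ <= f_ (k + r).
  have /ler_normlP[_ h1] := yy.
  have h2 : `|f_ (k + r) - f (k + r)| <= d by apply: ff; rewrite kT addr_ge0.
  have := slope k (k + r) k0; rewrite lerDl => /(_ r0).
  rewrite addrAC subrr add0r thr fk; move: h2; rewrite ler_norml => /andP[h2 _]; lra.
have kr0 : 0 <= k + r by rewrite addr_ge0.
rewrite ler_norml; apply/andP; split; last first.
  by rewrite lerBlDl; apply: ge_inf; [exists 0 => t []|split].
rewrite lerBrDl; apply: lb_le_inf; first by exists (k + r).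
move=> s [s0 ys]; have [ks|/ltW sk] := leP k s.
  by apply: le_trans ks; rewrite gerBl.
have h2 : `|f_ s - f s| <= d.
  by apply: ff; rewrite s0 (le_trans sk)// (le_trans _ kT)// lerDl.
have := slope s k s0 sk; rewrite fk.
have : theta * (k - s) <= 2 * d -> k - r <= s.
  by rewrite -thr ler_pM2l// lerBlDr addrC -lerBlDr.
move=> h h3; apply: h; apply: le_trans h3 _.
by move: h2 yy; rewrite !ler_norml; lra.
Qed.

(** The solution of [f k = y] exists by the intermediate value theorem and is
    unique because of the slope. *)
Lemma right_inv_slope f (theta y : R) : 0 < theta -> locally_uc f ->
  (forall s t, 0 <= s -> s <= t -> theta * (t - s) <= f t - f s) -> f 0 <= y ->
  exists k, [/\ 0 <= k, k <= (y - f 0) / theta, f k = y & right_inv f y = k%:E].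
Proof.
move=> th0 ucf slope f0y; set S := (y - f 0) / theta.
have S0 : 0 <= S by rewrite divr_ge0 ?subr_ge0// ltW.
have fS : y <= f S.
  have := slope 0 S (lexx 0) S0; rewrite subr0 /S mulrC divfK ?gt_eqF//.
  by rewrite lerBrDr subrK.
have [] := @IVT _ f 0 S y S0.
- apply/subspace_continuousP => s /=; rewrite in_itv/= => /andP[s0 sS].
  apply/cvgrPdist_le => e e0; have [d d0 Hd] := ucf S e e0.
  rewrite near_withinE; near=> u => /=; rewrite in_itv/= => /andP[u0 uS].
  apply: Hd; rewrite ?s0 ?u0//; near: u; apply: cvgr_dist_lt => //; exact: cvg_id.
- by rewrite ge_min f0y/= le_max fS orbT.
move=> k; rewrite in_itv/= => /andP[k0 kS] fk; exists k; split=> //.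
have inj s : 0 <= s -> f s <= y -> s <= k.
  move=> s0 fs; rewrite leNgt; apply/negP => ks.
  have := slope k s k0 (ltW ks); rewrite fk => h.
  have : 0 < theta * (s - k) by rewrite mulr_gt0// subr_gt0.
  lra.
apply/eqP; rewrite eq_le; apply/andP; split.
  by apply: ge_ereal_sup => _ [s [s0 fs] <-]; rewrite lee_fin inj.
by apply: ereal_sup_ubound; exists k => //; split=> //; rewrite fk.
Unshelve. all: by end_near. Qed.

Lemma right_inv_uc f E (thf : R) : 0 < thf -> locally_uc f ->
  (forall s t, 0 <= s -> s <= t -> thf * (t - s) <= f t - f s) ->
  locally_uc E -> (forall t, 0 <= t -> f 0 <= E t) ->
  locally_uc (fun t => fine (right_inv f (E t)) - t).
Proof.
move=> th0 ucf slope ucE E0 T e e0.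
have e20 : 0 < e / 2 by rewrite divr_gt0.
have et0 : 0 < thf * (e / 2) by rewrite mulr_gt0.
have [d d0 Hd] := ucE T _ et0; exists (Num.min d (e / 2)).
  by rewrite lt_min d0.
move=> s t sT tT; rewrite lt_min => /andP[std ste].
have /andP[s0 _] := sT; have /andP[t0 _] := tT.
have [ks [ks0 _ fks ->]] := right_inv_slope th0 ucf slope (E0 s s0).
have [kt [kt0 _ fkt ->]] := right_inv_slope th0 ucf slope (E0 t t0).
have : `|ks - kt| <= e / 2.
  have Est := Hd s t sT tT std.
  wlog le : s t ks kt sT tT s0 t0 std ste ks0 fks kt0 fkt Est / ks <= kt.
    move=> H; have [|/ltW] := leP ks kt; first exact: (H s t).
    move=> kts; rewrite distrC; apply: (H t s) => //; by rewrite distrC.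
  rewrite distrC ger0_norm ?subr_ge0// -(ler_pM2l th0).
  apply: le_trans (slope _ _ ks0 le) _; rewrite fks fkt; apply: le_trans Est.
  by rewrite distrC ler_norm.
move: ste; move=> /ltW ste kk /=.
have -> : ks - s - (kt - t) = (ks - kt) - (s - t) by ring.
by rewrite (splitr e); apply: le_trans (ler_normB _ _) _; apply: lerD.
Qed.

End inverses.

Section counting_paths.
Context {R : realType}.

Lemma natr_dist_lt1 (a b : nat) : `|a%:R - b%:R| < 1 :> R -> a = b.
Proof.
wlog ab : a b / (a <= b)%N.
  by move=> H; case/orP: (leq_total a b) => ab; [|rewrite distrC => h; apply/esym; move: h]; exact: H.
rewrite distrC -natrB// normr_nat -[1]/(1%:R) ltr_nat ltnS leqn0 subn_eq0 => ba.
by apply/eqP; rewrite eqn_leq ab.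
Qed.

Lemma counting_near_constant (A : R -> nat) (F : set_system R) (l : R) :
  ProperFilter F -> (A t)%:R @[t --> F] --> l ->
  exists n, \forall t \near F, A t = n.
Proof.
move=> FF Al; have h0 : 0 < 1 / 2 :> R by rewrite divr_gt0.
have /cvgrPdist_lt/(_ _ h0) near_l := Al.
have [s sl] := filter_ex near_l; exists (A s); near=> t.
have tl : `|l - (A t)%:R| < 1 / 2 by near: t.
by apply: natr_dist_lt1; move: sl tl; rewrite !ltr_norml; lra.
Unshelve. all: by end_near. Qed.

(** A counting path is constant on each side of a time, close to it, and every
    function of the count inherits this. *)
Lemma counting_cadlag (A : R -> nat) (psi : nat -> R) :
  cadlag (fun t => (A t)%:R : R) -> cadlag (fun t => psi (A t)).
Proof.
move=> cA t t0; have [Ar Al] := cA t t0; split=> [|t_gt0].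
  have /cvgrPdist_lt/(_ _ ltr01) near_At := Ar.
  apply: cvg_near_cst; near=> s; congr psi.
  have st : `|(A t)%:R - (A s)%:R| < 1 :> R by near: s.
  by apply: natr_dist_lt1; rewrite distrC.
have /cvg_ex[l cl] := Al t_gt0.
have [n near_n] := counting_near_constant _ cl.
apply/cvg_ex; exists (psi n); apply: cvg_near_cst.
by apply: filterS near_n => s ->.
Unshelve. all: by end_near. Qed.

End counting_paths.

Section all_customers_leave.
Context {R : realType}.
Variables (g G : R -> R) (N : nat) (q : queue R).
Hypothesis hG : service_distribution g G.
Hypothesis dyn : queue_dynamics G N q.

Lemma sum_ord_le (f : nat -> R) n m : (forall i, 0 <= f i) -> (n <= m)%N ->
  \sum_(i < n) f i <= \sum_(i < m) f i.
Proof.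
move=> f0 nm; rewrite -!(big_mkord predT f) (@big_cat_nat _ _ _ n 0 m)//=.
by rewrite lerDl sumr_ge0.
Qed.

Lemma departures_nd : nondecreasing_path (fun t => (departures q t)%:R : R).
Proof.
move=> s t s0 st; have t0 := le_trans s0 st.
rewrite (departures_split q s0) (departures_split q t0); apply: lerD.
  by rewrite lerD2l lerN2 ler_nat count_remaining_le.
pose f u i : R := (requirement q i.+1%:Z <= u - entry_time q i.+1%:Z)%R%:R.
apply: (@le_trans _ _ (\sum_(i < entries q s) f t i)).
  apply: ler_sum => i _; rewrite ler_nat; case: leP => // h.
  by rewrite (le_trans h)// lerD2r.
by apply: sum_ord_le; [move=> i; exact: ler0n|exact: (entries_le dyn)].
Qed.

(** Past this time, the initial customers and the first [k] to enter service have
    had the time for all of their requirements. *)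
Lemma departures_reach (k : nat) s1 : 0 <= s1 -> (k <= entries q s1)%N ->
  exists2 s, 0 <= s & forall u, s <= u -> (in_service0 q + k <= departures q u)%N.
Proof.
move=> s10 ks1.
pose V := \sum_(i < in_service0 q) `|requirement q (label q i)|.
pose W := \sum_(i < k) (`|requirement q i.+1%:Z| + entry_time q i.+1%:Z).
have ew i : 0 <= `|requirement q i.+1%:Z| + entry_time q i.+1%:Z.
  by rewrite addr_ge0// entry_time_ge0.
have V0 : 0 <= V by exact: sumr_ge0.
have W0 : 0 <= W by apply: sumr_ge0 => i _; exact: ew.
exists (s1 + V + W); first by rewrite !addr_ge0.
move=> u su; have u0 : 0 <= u by apply: le_trans su; rewrite !addr_ge0.
have s1u : s1 <= u by apply: le_trans su; rewrite -addrA lerDl addr_ge0.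
rewrite -(ler_nat R) (departures_split q u0) natrD.
have -> : count_remaining q u = 0%N.
  rewrite /count_remaining big1// => i _.
  have [l1 l2] := initial_label (ltn_ord i).
  have [/(agesP hG)[a0 _] _] := initial_ages dyn l1 l2.
  rewrite ltNge (_ : _ <= _ = true)//; apply: le_trans (ler_norm _) _.
  apply: (@le_trans _ _ V); last first.
    apply: (@le_trans _ _ u); last by rewrite lerDr.
    by apply: le_trans su; rewrite addrAC lerDr addr_ge0.
  by rewrite /V (bigD1 i)//= lerDl sumr_ge0.
rewrite subr0 lerD2l.
pose f i : R := (requirement q i.+1%:Z <= u - entry_time q i.+1%:Z)%R%:R.
have kK : (k <= entries q u)%N by apply: leq_trans ks1 (entries_le dyn _ _).
have := @sum_ord_le f k _ (fun i => ler0n _ _) kK; apply: le_trans.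
rewrite (eq_bigr (fun=> 1)) ?sumr_const ?card_ord// => i _; rewrite /f.
rewrite (_ : _ <= _ = true)//; rewrite lerBrDr.
apply: (@le_trans _ _ (`|requirement q i.+1%:Z| + entry_time q i.+1%:Z)).
  by rewrite lerD2r ler_norm.
apply: (@le_trans _ _ W); last by apply: le_trans su; rewrite lerDr addr_ge0.
by rewrite /W (bigD1 i)//= lerDl sumr_ge0.
Qed.

(** If only [k] customers ever entered service, then all of them would leave, and
    a non-idling server would take the next customer who has arrived. *)
Lemma entries_reach t : (0 < N)%N -> 0 <= t ->
  exists2 s, 0 <= s & (arrivals q t <= entries q s)%N.
Proof.
move=> N0 t0; apply: contrapT => no.
have lt_A s : 0 <= s -> (entries q s < arrivals q t)%N.
  by move=> s0; rewrite ltnNge; apply/negP => h; apply: no; exists s.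
pose Pk k := `[< exists2 s, 0 <= s & entries q s = k >].
have exP : exists k, Pk k by exists (entries q 0); apply/asboolP; exists 0.
have ubP k : Pk k -> (k <= arrivals q t)%N.
  by move=> /asboolP[s s0 <-]; apply/ltnW/lt_A.
have [k /asboolP[s1 s10 <-] kmax] := ex_maxnP exP ubP.
have [s s0 Hs] := departures_reach s10 (leqnn _).
pose u := Num.max s t.
have u0 : 0 <= u by rewrite le_max s0.
have tu : t <= u by rewrite le_max lexx orbT.
have Du : (in_service0 q)%:R + (entries q s1)%:R <= (departures q u)%:R :> R.
  by rewrite -natrD ler_nat Hs// le_max lexx.
have Ku : (entries q u)%:R <= (entries q s1)%:R :> R.
  by rewrite ler_nat kmax//; apply/asboolP; exists u.
have KA : (entries q u)%:R < (arrivals q t)%:R :> R by rewrite ltr_nat lt_A.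
have At : (arrivals q t)%:R <= (arrivals q u)%:R :> R := arrivals_nd dyn t0 tu.
have := entries_reflection dyn u0; have := initial_non_idling dyn.
rewrite (mass_initial hG dyn) (positive_part_swap N%:R (in_system0 q)%:R).
have X0N : 0 <= Num.max ((in_system0 q)%:R - N%:R) 0 :> R by rewrite le_max lexx orbT.
have NR0 : 0 < N%:R :> R by rewrite ltr0n.
have [XN|XN] := leP (in_system q u) N%:R.
  by rewrite [Num.max (in_system _ _ - _) _](max_idPr _) ?subr_le0//; lra.
rewrite [Num.max (in_system _ _ - _) _](max_idPl _) ?subr_ge0 ?ltW// /in_system; lra.
Qed.

Lemma departures_reach_arrivals t : (0 < N)%N -> 0 <= t ->
  exists2 s, 0 <= s & (arrivals q t <= departures q s)%N.
Proof.
move=> N0 t0; have [s1 s10 As1] := entries_reach N0 t0.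
have [s s0 Hs] := departures_reach s10 As1.
by exists s => //; apply: leq_trans (Hs s (lexx s)); exact: leq_addl.
Qed.

End all_customers_leave.

(** * Measurability and convergence of inverse times *)

Section measurable_inverses.
Context {d : measure_display} {T : measurableType d} {R : realType}.

Lemma measurable_count_ge (n : T -> nat) (j : nat) :
  (forall k, measurable [set w | n w = k]) -> measurable [set w | (j <= n w)%N].
Proof.
move=> mn; rewrite (_ : mkset _ = \bigcup_(k in [set k | (j <= k)%N]) [set w | n w = k]).
  by apply: bigcup_measurable => k _.
apply/seteqP; split=> [w jw|w [k jk nk]]; first by exists (n w).
by rewrite /= nk.
Qed.

Lemma measurable_nat_comp (n : T -> nat) (h : nat -> T -> R) :
  (forall k, measurable [set w | n w = k]) ->
  (forall k, measurable_fun setT (h k)) ->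
  measurable_fun setT (fun w => h (n w) w).
Proof.
move=> mn mh _ B mB; rewrite setTI.
rewrite (_ : _ @^-1` B = \bigcup_k ([set w | n w = k] `&` h k @^-1` B)).
  apply: bigcup_measurable => k _; apply: measurableI => //.
  by rewrite -[X in measurable X]setTI; exact: mh.
by apply/seteqP; split=> [w Bw|w [k _ [<-]]//]; exists (n w).
Qed.

Lemma measurable_real_inv (F : T -> R -> nat) (j : nat) :
  (forall t k, 0 <= t -> measurable [set w | F w t = k]) ->
  (forall w, nondecreasing_path (fun t => (F w t)%:R : R)) ->
  measurable_fun setT (fun w => real_inv (fun t => (F w t)%:R) (j%:R : R)).
Proof.
move=> mF ndF.
have mFj t : 0 <= t -> measurable [set w | (j <= F w t)%N].
  by move=> t0; apply: measurable_count_ge => k; exact: mF.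
have F_le w s t : 0 <= s -> s <= t -> (F w s <= F w t)%N.
  by move=> s0 st; rewrite -(ler_nat R); exact: ndF.
pose reach : set T := \bigcup_n [set w | (j <= F w n%:R)%N].
have mreach : measurable reach by apply: bigcup_measurable => n _; exact: mFj.
have reachP w : reach w <-> exists s, 0 <= s /\ (j%:R : R) <= (F w s)%:R.
  split=> [[n _ /= jn]|[s [s0]]]; first by exists n%:R; rewrite ler_nat.
  rewrite ler_nat => js; exists (Num.truncn s).+1 => //=.
  by apply: leq_trans js _; apply: F_le => //; rewrite ltW// truncnS_gt.
(* The rational times suffice, as the paths are nondecreasing. Off [reach] the
   infimum is that of the empty set, which is [0]. *)
pose below (u : R) : set T := \bigcup_k \bigcup_m [set w | (k%:R / m.+1%:R < u) /\
  (j <= F w (k%:R / m.+1%:R))%N].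
have mbelow u : measurable (below u).
  apply: bigcup_measurable => k _; apply: bigcup_measurable => m _.
  have [ku|ku] := pselect (k%:R / m.+1%:R < u).
    rewrite (_ : mkset _ = [set w | (j <= F w (k%:R / m.+1%:R))%N]).
      by apply: mFj; rewrite divr_ge0.
    by apply/seteqP; split=> w /=; [case|].
  by rewrite (_ : mkset _ = set0)//; apply/seteqP; split=> w //= -[].
apply: (measurability _ (@RGenInftyO.measurableE R)) => _ [_ [u ->] <-].
rewrite setTI (_ : _ @^-1` _ = (reach `&` below u) `|` (~` reach `&` [set _ | 0 < u])).
  apply: measurableU; first exact: measurableI.
  apply: measurableI; first exact: measurableC.
  by have [u0|u0] := pselect (0 < u); [rewrite (_ : mkset _ = setT)|rewrite (_ : mkset _ = set0)];
    rewrite ?set0P//; apply/seteqP; split.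
apply/seteqP; split=> w /=; rewrite in_itv/=.
  move=> lu; have [rw|nrw] := pselect (reach w); last first.
    right; split=> //; move: lu; rewrite /real_inv inf_out// => -[[s [s0 js]] _].
    by apply: nrw; apply/reachP; exists s.
  left; split=> //; move/reachP: (rw) => ne.
  have /(real_inv_lt _ ne)[s [s0 su]] := lu; rewrite ler_nat => js.
  have us : 0 < u - s by rewrite subr_gt0.
  have [m _ um] : exists2 m : nat, True & m.+1%:R^-1 < u - s.
    exists (Num.truncn (u - s)^-1) => //; rewrite invf_plt ?posrE//.
    exact: truncnS_gt.
  exists (Num.truncn (s * m.+1%:R)).+1 => //; exists m => //=.
  have sm0 : 0 <= s * m.+1%:R by rewrite mulr_ge0.
  split.
    rewrite ltr_pdivrMr//; apply: (@le_lt_trans _ _ (s * m.+1%:R + 1)).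
      by rewrite -natr1 lerD2r truncn_le.
    rewrite -ltrBrDl -mulrBl; move: um; rewrite invf_plt ?posrE//.
    by rewrite -[X in X < _ -> _]mul1r ltr_pdivrMr// mulrC.
  apply: leq_trans js _; apply: F_le => //.
  by rewrite ler_pdivlMr// ltW// truncnS_gt.
move=> [[rw [k _ [m _ /= [ku jk]]]]|[nrw u0]].
  apply/(real_inv_lt _ ((reachP w).1 rw)).
  by exists (k%:R / m.+1%:R); rewrite divr_ge0// ler_nat.
rewrite /real_inv inf_out// => -[[s [s0 js]] _].
by apply: nrw; apply/reachP; exists s.
Qed.

End measurable_inverses.

Section inverse_times.
Context {d : measure_display} {T : measurableType d} {R : realType}.
Variables (P : probability T R) (A F : nat -> T -> R -> nat) (E f : T -> R -> R).
Variable Gd : set T.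
Hypotheses (mGd : measurable Gd) (aeGd : {ae P, forall w, Gd w}).
Hypothesis mA : forall n t k, 0 <= t -> measurable [set w | A n w t = k].
Hypothesis mF : forall n t k, 0 <= t -> measurable [set w | F n w t = k].
Hypothesis A_nd : forall n w, nondecreasing_path (fun t => (A n w t)%:R : R).
Hypothesis F_nd : forall n w, nondecreasing_path (fun t => (F n w t)%:R : R).
Hypothesis A_cadlag : forall n w, cadlag (fun t => (A n w t)%:R : R).
Hypothesis F_reach : forall n w t, 0 <= t ->
  exists2 s, 0 <= s & (A n w t <= F n w s)%N.
Hypothesis A_off : forall n w t, ~ Gd w -> A n w t = 0%N.

Definition increasing_limit (h : R -> R) (h_ : nat -> R -> nat) :=
  [/\ h 0 = 0, locally_uc h,
      exists2 theta, 0 < theta & forall s t, 0 <= s -> s <= t ->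
        theta * (t - s) <= h t - h s &
      forall S e, 0 < e -> \forall n \near \oo, forall t, 0 <= t <= S ->
        `|(h_ n t)%:R / n.+1%:R - h t| <= e].

Hypothesis E_limit : forall w, Gd w -> increasing_limit (E w) (A ^~ w).
Hypothesis f_limit : forall w, Gd w -> increasing_limit (f w) (F ^~ w).

Let psi n (w : T) (j : nat) : R := real_inv (fun t => (F n w t)%:R) j%:R -
  real_inv (fun t => (A n w t)%:R) j%:R.

Let Z_ n w : skorokhod R := fun t => psi n w (A n w t).

Let Z w : skorokhod R := fun t =>
  if `[< Gd w >] then fine (right_inv (f w) (E w t)) - t else 0.

Lemma increasing_limit_ge0 h h_ t : increasing_limit h h_ -> 0 <= t -> 0 <= h t.
Proof.
move=> [h0 _ [th th0 slope] _] t0; have := slope 0 t (lexx 0) t0.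
by rewrite h0 !subr0; apply: le_trans; rewrite mulr_ge0// ltW.
Qed.

Lemma real_inv_scale (h : R -> R) y (c : R) : 0 < c ->
  real_inv h y = real_inv (fun t => h t / c) (y / c).
Proof.
move=> c0; rewrite /real_inv; congr inf; apply/seteqP.
by split=> s /= [s0 ys]; split=> //; move: ys; rewrite ler_pM2r// invr_gt0.
Qed.

Let psi0 n w : psi n w 0 = 0.
Proof.
rewrite /psi; suff h (B : R -> nat) : real_inv (fun t => (B t)%:R) 0%:R = 0 :> R.
  by rewrite !h subrr.
apply/eqP; rewrite eq_le real_inv_ge0 andbT; apply: ge_inf.
  by exists 0 => s [].
by split=> //; rewrite ler0n.
Qed.

(** Dividing a path and the level by the number of servers does not change the
    inverse, so that [real_inv_stability] applies to the scaled paths, at the level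
    [E w t]. The inverse of [E w] at this level is [t]. *)
Lemma inverse_times_uniform w S e : Gd w -> 0 < e -> \forall n \near \oo,
  forall t, 0 <= t <= S -> `|(Z_ n w : R -> R) t - (Z w : R -> R) t| <= e.
Proof.
move=> Gw e0; have [E0 ucE [thE thE0 slopeE] cvE] := E_limit Gw.
have [f0 ucf [thf thf0 slopef] cvf] := f_limit Gw.
have e20 : 0 < e / 2 by rewrite divr_gt0.
have [S0|S0] := ltP S 0.
  by apply: nearW => n t /andP[t0 tS]; move: (le_lt_trans (le_trans t0 tS) S0); rewrite ltxx.
pose r := Num.min thf thE * e / 4.
have m0 : 0 < Num.min thf thE by rewrite lt_min thf0.
have r0 : 0 < r by rewrite /r divr_gt0// mulr_gt0.
have r_le th : Num.min thf thE <= th -> 0 < th -> 2 * r / th <= e / 2.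
  move=> mth th0; rewrite ler_pdivrMr// /r.
  have -> : 2 * (Num.min thf thE * e / 4) = e / 2 * Num.min thf thE by field.
  by rewrite ler_wpM2l// ltW.
have rf : 2 * r / thf <= e / 2 by apply: r_le => //; rewrite ge_min lexx.
have rE : 2 * r / thE <= e / 2 by apply: r_le => //; rewrite ge_min lexx orbT.
have near_f := cvf (E w S / thf + e / 2) r r0.
have near_E := cvE (S + e / 2) r r0.
near=> n => t tS; have /andP[t0 tS'] := tS.
have n0 : 0 < n.+1%:R :> R by [].
have hE : forall t, 0 <= t <= S + e / 2 -> `|(A n w t)%:R / n.+1%:R - E w t| <= r.
  by near: n.
have hf : forall t, 0 <= t <= E w S / thf + e / 2 ->
  `|(F n w t)%:R / n.+1%:R - f w t| <= r by near: n.
have Et0 := increasing_limit_ge0 (E_limit Gw) t0.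
have Et_y : `|(A n w t)%:R / n.+1%:R - E w t| <= r.
  by apply: hE; rewrite t0 (le_trans tS')// lerDl ltW.
have Etf : f w 0 <= E w t by rewrite f0.
have [k [k0 kle fk kE]] := right_inv_slope thf0 ucf slopef Etf.
have EtS : E w t <= E w S.
  rewrite -subr_ge0; apply: le_trans (slopeE t S t0 tS').
  by rewrite mulr_ge0 ?subr_ge0// ltW.
have kS : k + 2 * r / thf <= E w S / thf + e / 2.
  apply: lerD => //; apply: le_trans kle _; rewrite f0 subr0.
  by rewrite ler_pM2r// invr_gt0.
have h1 := real_inv_stability thf0 (ltW r0) slopef hf Et_y k0 fk kS.
have tr : t + 2 * r / thE <= S + e / 2 by apply: lerD.
have h2 := real_inv_stability thE0 (ltW r0) slopeE hE Et_y t0 erefl tr.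
rewrite -(real_inv_scale (fun s => (F n w s)%:R) _ n0) in h1.
rewrite -(real_inv_scale (fun s => (A n w s)%:R) _ n0) in h2.
rewrite /Z_ /psi /Z asboolT// kE /=.
move: (le_trans h1 rf) (le_trans h2 rE); rewrite !ler_norml.
by move: (real_inv _ _) (real_inv _ _) => a b /andP[a1 a2] /andP[b1 b2]; lra.
Unshelve. all: by end_near. Qed.

Let Z_cvg w t : 0 <= t -> (Z_ n w : R -> R) t @[n --> \oo] --> (Z w : R -> R) t.
Proof.
move=> t0; have [Gw|nGw] := pselect (Gd w); last first.
  rewrite /Z asboolF//; apply: cvg_near_cst; apply: nearW => n.
  by rewrite /Z_ A_off// psi0.
apply/cvgrPdist_le => e e0; have := inverse_times_uniform t Gw e0.
by apply: filterS => n /(_ t); rewrite t0 lexx distrC; apply.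
Qed.

Let mZ_ n t : 0 <= t -> measurable_fun setT (fun w => (Z_ n w : R -> R) t).
Proof.
move=> t0; apply: (measurable_nat_comp (h := fun j w => psi n w j)).
  by move=> k; exact: mA.
move=> j; apply: measurable_funB.
  by apply: measurable_real_inv; [move=> s k; exact: mF|exact: F_nd].
by apply: measurable_real_inv; [move=> s k; exact: mA|exact: A_nd].
Qed.

Let Z__random n : Drandom_element (Z_ n).
Proof.
apply: Drandom_element_coordinates => [w|t t0]; last exact: mZ_.
by apply: counting_cadlag; exact: A_cadlag.
Qed.

(** The coordinates of [Z] are limits of those of [Z_], everywhere: both vanish
    off [Gd]. *)
Let Z_random : Drandom_element Z.
Proof.
apply: Drandom_element_coordinates => [w|t t0]; last first.
  apply: (@measurable_fun_cvg _ _ _ setT (fun n w => (Z_ n w : R -> R) t)).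
    by move=> n; exact: mZ_.
  by move=> w _; exact: Z_cvg.
have [Gw|nGw] := pselect (Gd w); last first.
  rewrite /Z asboolF// => t t0; split=> [|_]; first exact: cvg_cst.
  by apply/cvg_ex; exists 0; exact: cvg_cst.
rewrite /Z asboolT//; apply: locally_uc_cadlag.
have [_ ucE _ _] := E_limit Gw; have [f0 ucf [thf thf0 slopef] _] := f_limit Gw.
apply: right_inv_uc thf0 ucf slopef ucE _ => t t0; rewrite f0.
exact: increasing_limit_ge0 (E_limit Gw) t0.
Qed.

(** The infinite values are excluded: each level of the arrivals is reached, by
    [F_reach]. *)
Lemma inverse_times_cvg : cvg_in_distribution P
  (fun n w t => (Defs.inv (fun s => (F n w s)%:R) (A n w t)%:R -
    Defs.inv (fun s => (A n w s)%:R) (A n w t)%:R)%E)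
  (fun w t => (right_inv (f w) (E w t) - t%:E)%E).
Proof.
exists Z_, Z; split=> //.
- move=> n; apply: aeW => w t t0.
  have [s s0 As] := F_reach n w t0.
  rewrite (@invE _ (fun s => (F n w s)%:R) _ s s0); last by rewrite ler_nat.
  by rewrite (@invE _ (fun s => (A n w s)%:R) _ t t0).
- apply: filterS aeGd => w Gw t t0; rewrite /Z asboolT//.
  have [f0 ucf [thf thf0 slopef] _] := f_limit Gw.
  have Etf : f w 0 <= E w t by rewrite f0 (increasing_limit_ge0 (E_limit Gw)).
  by have [k [_ _ _ ->]] := right_inv_slope thf0 ucf slopef Etf.
- move=> h ch bh; apply: (J1_cvg_expectation Z__random Z_random _ ch bh).
  apply: filterS aeGd => w Gw; apply: locally_uniform_J1_cvg => S e e0.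
  exact: inverse_times_uniform.
Qed.

End inverse_times.

(** * Convergence of the waiting and sojourn times *)

Section measurable_departures.
Context {d : measure_display} {T : measurableType d} {R : realType}.
Variables (Q : T -> queue R) (Gd : set T).
Hypothesis mQ : queue_measurable Q.
Hypothesis mGd : measurable Gd.

(** A count whose path properties hold almost surely is replaced by [0] off a
    measurable set of full measure, so that they hold for every outcome. *)
Definition cut (n : T -> nat) (w : T) : nat := if `[< Gd w >] then n w else 0%N.

Lemma measurable_cut (n : T -> nat) :
  (forall k, measurable (Gd `&` [set w | n w = k])) ->
  forall k, measurable [set w | cut n w = k].
Proof.
move=> mn k; rewrite (_ : mkset _ = (Gd `&` [set w | n w = k]) `|`
  (~` Gd `&` [set _ | 0%N = k])).
  apply: measurableU => //; apply: measurableI; first exact: measurableC.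
  by have [->|k0] := eqVneq k 0%N; [rewrite (_ : mkset _ = setT)|
    rewrite (_ : mkset _ = set0)] => //; apply/seteqP; split=> // w /= k0';
    rewrite -k0' eqxx in k0.
apply/seteqP; split=> w /=; rewrite /cut.
  by have [Gw|nGw] := pselect (Gd w); [rewrite asboolT//; left|
    rewrite asboolF//; right].
by case=> -[Gw <-]; [rewrite asboolT|rewrite asboolF].
Qed.

Lemma measurable_lt_nat (a b : T -> R) : measurable_fun setT a ->
  measurable_fun setT b -> measurable_fun setT (fun w => (a w < b w)%R%:R : R).
Proof.
move=> ma mb; rewrite (_ : (fun _ => _) = \1_((b \- a) @^-1` `]0, +oo[)).
  apply: measurable_indic; rewrite -[X in measurable X]setTI.
  exact: (measurable_funB mb ma).
apply/funext => w; rewrite indicE; congr ((nat_of_bool _)%:R).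
by apply/idP/idP => [h|/set_mem]; [apply/mem_set|]; rewrite /= in_itv/= andbT subr_gt0.
Qed.

Lemma measurable_le_nat (a b : T -> R) : measurable_fun setT a ->
  measurable_fun setT b -> measurable_fun setT (fun w => (a w <= b w)%R%:R : R).
Proof.
move=> ma mb; rewrite (_ : (fun _ => _) = (fun w => 1 - (b w < a w)%R%:R)).
  by apply: measurable_funB => //; exact: measurable_lt_nat.
by apply/funext => w; rewrite leNgt; case: (_ < _); rewrite ?subrr ?subr0.
Qed.

Hypothesis entries_mono : forall w, Gd w ->
  nondecreasing_path (fun t => (entries (Q w) t)%:R : R).

Lemma measurable_cut_entries t k : 0 <= t ->
  measurable [set w | cut (fun w => entries (Q w) t) w = k].
Proof.
move=> t0; apply: measurable_cut => j; apply: measurableI => //.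
exact: entries_meas.
Qed.

(** On [Gd], the departures are a measurable function of the requirements, the
    ages at time 0 and the entry times, by [departures_split]; the entry times are
    inverses of the entries. *)
Lemma measurable_cut_departures t k : 0 <= t ->
  measurable [set w | cut (fun w => departures (Q w) t) w = k].
Proof.
move=> t0; pose Kc w s := cut (fun w => entries (Q w) s) w.
pose sigma j w : R := real_inv (fun s => (Kc w s)%:R) j%:R.
have msigma j : measurable_fun setT (sigma j).
  apply: measurable_real_inv; first by move=> s i; exact: measurable_cut_entries.
  move=> w s u s0 su; rewrite /Kc /cut; case: asboolP => // Gw.
  exact: entries_mono.
pose init n w : R := n%:R - \sum_(i < n)
  (age0 (Q w) (i.+1%:Z - n%:Z) + t < requirement (Q w) (i.+1%:Z - n%:Z))%R%:R.
pose new n w : R := \sum_(i < n) (requirement (Q w) i.+1%:Z <= t - sigma i.+1 w)%R%:R.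
have minit n : measurable_fun setT (init n).
  apply: measurable_funB => //; apply: measurable_sum => i.
  apply: measurable_lt_nat; last exact: requirement_meas.
  by apply: measurable_funD => //; exact: age0_meas.
have mnew n : measurable_fun setT (new n).
  apply: measurable_sum => i; apply: measurable_le_nat.
    exact: requirement_meas.
  exact: measurable_funB.
pose D w : R := init (in_service0 (Q w)) w + new (Kc w t) w.
have mD : measurable_fun setT D.
  apply: measurable_funD; apply: measurable_nat_comp => //.
    by move=> j; exact: in_service0_meas.
  by move=> j; exact: measurable_cut_entries.
have DE w : Gd w -> (departures (Q w) t)%:R = D w.
  move=> Gw; rewrite (departures_split _ t0) /D /init /new /count_remaining natr_sum.
  have KcE s : Kc w s = entries (Q w) s by rewrite /Kc /cut asboolT.
  rewrite KcE; congr (_ + _); apply: eq_bigr => i _; congr ((nat_of_bool (_ <= _ - _))%:R).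
  rewrite /entry_time /sigma /real_inv; congr inf; apply/seteqP.
  by split=> s /=; rewrite KcE ler_nat lez_nat.
apply: measurable_cut => j.
rewrite (_ : _ `&` _ = Gd `&` D @^-1` [set j%:R]).
  by apply: measurableI => //; rewrite -[X in measurable X]setTI; exact: mD.
apply/seteqP; split=> w /= [Gw h]; split=> //; first by rewrite -(DE w Gw) h.
by apply/eqP; rewrite -(eqr_nat R) (DE w Gw) h.
Qed.

End measurable_departures.

Section convergence.
Context {R : realType} {d : measure_display} {T : measurableType d}.
Variables (P : probability T R) (g G : R -> R).
Hypothesis hG : service_distribution g G.
Variable Q : nat -> T -> queue R.
Hypothesis hQ : forall N, (0 < N)%N -> many_server_queue P G N (Q N).
Variables (E : T -> R -> R) (X0 : T -> R) (nu0 : T -> {measure set R -> \bar R}).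
Hypothesis hA : convergence_assumption P G Q E X0 nu0.
Hypothesis hh : {within ages G, continuous (hazard g G)}.
Variables (X : T -> R -> R) (nu : T -> R -> {measure set R -> \bar R}).
Hypothesis hsol : {ae P, forall w,
  fluid_solution G (hazard g G) (E w) (X0 w) (nu0 w) (X w) (nu w)}.
Hypothesis hE : {ae P, forall w, uniformly_strictly_increasing (E w)}.

Lemma ae_measurable_subset (S : T -> Prop) : {ae P, forall w, S w} ->
  exists Gd : set T, [/\ measurable Gd, {ae P, forall w, Gd w} & Gd `<=` S].
Proof.
move=> [B [mB B0 sB]]; exists (~` B); split; first exact: measurableC.
- by exists B; split=> //; rewrite setCK.
- by move=> w nB; apply: contrapT => nS; apply: nB; exact: sB.
Qed.

Lemma near_succ (S : nat -> Prop) :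
  (\forall n \near \oo, S n) -> \forall n \near \oo, S n.+1.
Proof. by move=> [n _ Sn]; exists n => // m nm; apply: Sn; exact: leqW. Qed.

Definition good_path w := [/\
  forall N, (0 < N)%N -> queue_dynamics G N (Q N w),
  initial_data G (E w) (X0 w) (nu0 w) /\ uniformly_strictly_increasing (E w) &
  forall S e, 0 < e ->
    (\forall N \near \oo, forall t, 0 <= t <= S ->
      `|(arrivals (Q N w) t)%:R / N%:R - E w t| <= e) /\
    (\forall N \near \oo, forall t, 0 <= t <= S ->
    `|(departures (Q N w) t)%:R / N%:R - fluid_D G (hazard g G) (nu w) t| <= e /\
    `|(entries (Q N w) t)%:R / N%:R - fluid_K G (hazard g G) (nu w) t| <= e)].

Lemma ae_good_path : {ae P, forall w, good_path w}.
Proof.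
have dynA : {ae P, forall w, forall N, (0 < N)%N -> queue_dynamics G N (Q N w)}.
  apply: ae_foralln => N; have [->|N0] := posnP N; first exact: aeW.
  by have := msq_dynamics (hQ N0); apply: filterS => w.
have serviceA : {ae P, forall w, forall N, (0 < N)%N ->
    (in_service0 (Q N w) <= N)%N}.
  by apply: filterS dynA => w dyn N N0; exact: (in_service0_le hG (dyn N N0)).
have agesA : {ae P, forall w, forall N i, (0 < N)%N -> (i < in_service0 (Q N w))%N ->
    ages G (age0 (Q N w) (label (Q N w) i)) /\
    age0 (Q N w) (label (Q N w) i) < requirement (Q N w) (label (Q N w) i)}.
  apply: filterS dynA => w dyn N i N0 i_n.
  have [l1 l2] := initial_label i_n.
  exact: (initial_ages (dyn N N0) l1 l2).
have subA : {ae P, forall w, sub_probability G (nu0 w)}.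
  by apply: filterS (limit_data hA) => w; exact: data_nu0.
have remA := initial_customers_lln hG hQ serviceA subA (initial_age_cvg hA) agesA.
have newA := new_customers_lln hG hQ serviceA.
apply: filterS3 (filterI dynA hE) (filterI (filterI remA newA) (limit_data hA))
  (filterI (filterI (arrivals_cvg hA) (in_system0_cvg hA)) hsol).
move=> w [dyn usiE] [[rem new] data] [[arr x0] sol]; split=> // S e e0.
have arr_unif S' e' : 0 < e' -> \forall N \near \oo, forall t, 0 <= t <= S' ->
    `|(arrivals (Q N w) t)%:R / N%:R - E w t| <= e'.
  by move=> e'0; exact: (J1_cvg_locally_uniform (uniformly_strictly_increasing_uc usiE) arr).
split; first exact: arr_unif.
exact: (departures_entries_cvg hG hh data sol dyn arr_unif x0 rem new).
Qed.

(** The common form of both claims, where [F] is the number of entries or of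
    departures. *)
Lemma customer_times_cvg (F : queue R -> R -> nat) (f : T -> R -> R) :
  (forall N Gd t k, (0 < N)%N -> 0 <= t -> measurable Gd -> Gd `<=` good_path ->
    measurable [set w | cut Gd (fun w => F (Q N w) t) w = k]) ->
  (forall N q, queue_dynamics G N q -> nondecreasing_path (fun t => (F q t)%:R : R)) ->
  (forall N q t, (0 < N)%N -> queue_dynamics G N q -> 0 <= t ->
    exists2 s, 0 <= s & (arrivals q t <= F q s)%N) ->
  (forall w, f w 0 = 0) ->
  (forall w S e, good_path w -> 0 < e -> \forall N \near \oo,
    forall t, 0 <= t <= S -> `|(F (Q N w) t)%:R / N%:R - f w t| <= e) ->
  {ae P, forall w, uniformly_strictly_increasing (f w)} ->
  cvg_in_distribution P
    (fun n w t =>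
      (Defs.inv (fun s => (F (Q n.+1 w) s)%:R) (arrivals (Q n.+1 w) t)%:R -
       Defs.inv (fun s => (arrivals (Q n.+1 w) s)%:R) (arrivals (Q n.+1 w) t)%:R)%E)
    (fun w t => (right_inv (f w) (E w t) - t%:E)%E).
Proof.
move=> mF F_nd F_reach f0 cvF usif.
have [Gd [mGd aeGd Gd_good]] := ae_measurable_subset (filterI ae_good_path usif).
have good w : Gd w -> good_path w by move=> /Gd_good[].
pose Ac n w t := cut Gd (fun w => arrivals (Q n.+1 w) t) w.
pose Fc n w t := cut Gd (fun w => F (Q n.+1 w) t) w.
have AcE n w t : Gd w -> Ac n w t = arrivals (Q n.+1 w) t.
  by move=> Gw; rewrite /Ac /cut asboolT.
have FcE n w t : Gd w -> Fc n w t = F (Q n.+1 w) t.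
  by move=> Gw; rewrite /Fc /cut asboolT.
have off n w t : ~ Gd w -> Ac n w t = 0%N /\ Fc n w t = 0%N.
  by move=> nGw; rewrite /Ac /Fc /cut asboolF.
have dyn n w : Gd w -> queue_dynamics G n.+1 (Q n.+1 w).
  by move=> /good[dyn _ _]; exact: dyn.
have limit (h : T -> R -> R) (H : queue R -> R -> nat) (Hc : nat -> T -> R -> nat) :
    (forall n w t, Gd w -> Hc n w t = H (Q n.+1 w) t) ->
    (forall w, Gd w -> h w 0 = 0) ->
    (forall w, Gd w -> uniformly_strictly_increasing (h w)) ->
    (forall w S e, Gd w -> 0 < e -> \forall N \near \oo,
      forall t, 0 <= t <= S -> `|(H (Q N w) t)%:R / N%:R - h w t| <= e) ->
    forall w, Gd w -> increasing_limit (h w) (Hc ^~ w).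
  move=> HcE h0 usih cvH w Gw; split.
  - exact: h0.
  - exact: uniformly_strictly_increasing_uc (usih w Gw).
  - exact: uniformly_strictly_increasing_slope (usih w Gw).
  - move=> S e e0; have := near_succ (cvH w S e Gw e0).
    by apply: filterS => n Hn t /Hn; rewrite HcE.
have [Z_ [Z [DZ_ DZ WZ_ WZ cv]]] : cvg_in_distribution P
  (fun n w t => (Defs.inv (fun s => (Fc n w s)%:R) (Ac n w t)%:R -
    Defs.inv (fun s => (Ac n w s)%:R) (Ac n w t)%:R)%E)
  (fun w t => (right_inv (f w) (E w t) - t%:E)%E).
  apply: (@inverse_times_cvg _ _ _ P Ac Fc E f Gd) => //.
  - move=> n t k t0; apply: measurable_cut => // j; apply: measurableI => //.
    by have [mQ _ _ _] := hQ (ltn0Sn n); exact: arrivals_meas.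
  - by move=> n t k t0; exact: mF.
  - move=> n w; have [Gw|nGw] := pselect (Gd w).
      by move=> s t s0 st; rewrite !AcE//; exact: arrivals_nd (dyn n w Gw) _ _ s0 st.
    by move=> s t s0 st; have [-> _] := off n w s nGw; rewrite ler0n.
  - move=> n w; have [Gw|nGw] := pselect (Gd w).
      by move=> s t s0 st; rewrite !FcE//; exact: F_nd (dyn n w Gw) _ _ s0 st.
    by move=> s t s0 st; have [_ ->] := off n w s nGw; rewrite ler0n.
  - move=> n w; have [Gw|nGw] := pselect (Gd w).
      rewrite (_ : (fun t => _) = (fun t => (arrivals (Q n.+1 w) t)%:R)).
        exact: arrivals_cadlag (dyn n w Gw).
      by apply/funext => t; rewrite AcE.
    rewrite (_ : (fun t => _) = cst 0).
      move=> t t0; split=> [|_]; first exact: cvg_cst.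
      by apply/cvg_ex; exists 0; exact: cvg_cst.
    by apply/funext => t; have [-> _] := off n w t nGw.
  - move=> n w t t0; have [Gw|nGw] := pselect (Gd w).
      have [s s0 h] := F_reach _ _ t (ltn0Sn n) (dyn n w Gw) t0.
      by exists s => //; rewrite AcE// FcE.
    by exists 0 => //; have [-> _] := off n w t nGw.
  - by move=> n w t nGw; have [] := off n w t nGw.
  - apply: (limit E (@arrivals R) Ac AcE) => // w.
    + by move=> /good[_ [data _] _]; exact: data_E0 data.
    + by move=> /good[_ []].
    + by move=> S e /good[_ _ H] e0; have [] := H S e e0.
  - apply: (limit f F Fc FcE) => // w.
    + by move=> /Gd_good[].
    + by move=> S e /good Gw e0; exact: cvF.
exists Z_, Z; split=> // n; apply: filterS2 aeGd (WZ_ n) => w Gw H t t0.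
rewrite -H//; congr (_ - _)%E; rewrite AcE//.
  by congr (Defs.inv _ _); apply/funext => s; rewrite FcE.
by congr (Defs.inv _ _); apply/funext => s; rewrite AcE.
Qed.

End convergence.

Theorem theorem3p8 (R : realType) (d : measure_display) (T : measurableType d)
    (P : probability T R)
    (g G : R -> R) (hG : service_distribution g G)
    (Q : nat -> T -> queue R)
    (hQ : forall N, (0 < N)%N -> many_server_queue P G N (Q N))
    (E : T -> R -> R) (X0 : T -> R) (nu0 : T -> {measure set R -> \bar R})
    (hA : convergence_assumption P G Q E X0 nu0)
    (hh : {within ages G, continuous (hazard g G)})
    (X : T -> R -> R) (nu : T -> R -> {measure set R -> \bar R})
    (hXm : forall t, 0 <= t -> measurable_fun setT (X ^~ t))
    (hnum : forall t (B : set R), 0 <= t -> measurable B ->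
       measurable_fun setT (fun w => nu w t B))
    (hsol : {ae P, forall w, unique_fluid_solution G (hazard g G)
       (E w) (X0 w) (nu0 w) (X w) (nu w)})
    (hE : {ae P, forall w, uniformly_strictly_increasing (E w)}) :
  ({ae P, forall w,
      uniformly_strictly_increasing (fluid_K G (hazard g G) (nu w))} ->
   cvg_in_distribution P
     (fun n w t => waiting_time (Q n.+1 w) (arrivals (Q n.+1 w) t))
     (fun w t => fluid_waiting_time G (hazard g G) (E w) (nu w) t)) /\
  ({ae P, forall w,
      uniformly_strictly_increasing (fluid_D G (hazard g G) (nu w))} ->
   cvg_in_distribution P
     (fun n w t => sojourn_time (Q n.+1 w) (arrivals (Q n.+1 w) t))
     (fun w t => fluid_sojourn_time G (hazard g G) (E w) (nu w) t)).
Proof.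
have sol : {ae P, forall w,
    fluid_solution G (hazard g G) (E w) (X0 w) (nu0 w) (X w) (nu w)}.
  by apply: filterS hsol => w [].
have cut_mono N (Gd : set T) : (0 < N)%N -> Gd `<=` good_path g G Q E X0 nu0 nu ->
    forall w, Gd w -> nondecreasing_path (fun t => (entries (Q N w) t)%:R : R).
  by move=> N0 sub w /sub[dyn _ _]; exact: entries_nd (dyn N N0).
split=> usi; apply: (customer_times_cvg hG hQ hA hh sol hE) usi.
- move=> N Gd t k N0 t0 mGd sub; have [mQ _ _ _] := hQ N N0.
  exact: measurable_cut_entries.
- by move=> N q dyn; exact: entries_nd dyn.
- by move=> N q t N0 dyn t0; exact: (entries_reach hG dyn N0 t0).
- by move=> w; exact: fluid_K0.
- move=> w S e [_ _ H] e0; have [_] := H S e e0.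
  by apply: filterS => N HN t /HN[].
- move=> N Gd t k N0 t0 mGd sub; have [mQ _ _ _] := hQ N N0.
  exact: (measurable_cut_departures mQ mGd (cut_mono N Gd N0 sub)).
- by move=> N q dyn; exact: (departures_nd dyn).
- by move=> N q t N0 dyn t0; exact: (departures_reach_arrivals hG dyn N0 t0).
- by move=> w; exact: fluid_D0.
- move=> w S e [_ _ H] e0; have [_] := H S e e0.
  by apply: filterS => N HN t /HN[].
Qed.
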